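(* For complex-valued $q,M_0\in L_2(0,\pi)$ put $M(x)=(\pi-x)^{-1}M_0(x)$, $\mathbf f=\{q,M_0\}$, and let $\mu_k$ ($k\ge1$) be the eigenvalues of the Dirichlet–Neumann problem $$-y''(x)+q(x)y(x)+\int_0^x M(x-t)y(t)\,dt=\mu y(x)\ \ (0<x<\pi),\qquad y(0)=y'(\pi)=0,$$ and $\rho'_k=\mu_k^{1/2}$ with $-\pi/2<\arg\rho'_k\le\pi/2$. There exist absolute constants $c_1,c_2>0$ such that for all $k\ge1$, all $r>0$ and all $\mathbf f\in L_2\oplus L_2$ lying in the ball of radius $r$ (i.e. $\|\mathbf f\|\le r$), $$\Big|\rho'_k-k+\frac12\Big|\le C\|\mathbf f\|\,\Big(k-\frac12\Big)^{-1},\qquad C=\max(c_2r,\,c_1).$$ Moreover, the constants $c_1,c_2$ can be taken the same as for the Dirichlet problem: for any $c_1>1/\sqrt\pi$ there is $c_2$ (depending on $c_1$) such that, with this pair $c_1,c_2$, both the estimate $|\rho'_k-k+\frac12|\le \max(c_2r,c_1)\|\mathbf f\|(k-\frac12)^{-1}$ and the estimate $|\rho_k-k|\le \max(c_2r,c_1)\|\mathbf f\|k^{-1}$ hold for all $k\ge1$, $r>0$ and $\|\mathbf f\|\le r$, where $\rho_k=\lambda_k^{1/2}$ and $\lambda_k$ ($k\ge 1$) are the eigenvalues of the same equation (with spectral parameter $\lambda$) under the Dirichlet conditions $y(0)=y(\pi)=0$.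
   Context: $L_2=L_2(0,\pi)$; the norm on pairs is $\|\mathbf f\|=\|q\|_{L_2}+2\|M_0\|_{L_2}$. ''Absolute'' means independent of $k$, $\mathbf f$ and $r$. Conventions on eigenvalues: let $S(x,\rho)$ be the solution of the equation with spectral parameter $\rho^2$ and $S(0,\rho)=0$, $S'(0,\rho)=1$ (prime denotes $d/dx$). The numbers $\rho'_k$ (respectively $\rho_k$) are the zeros of the even entire function $\rho\mapsto S'(\pi,\rho)$ (respectively $\rho\mapsto S(\pi,\rho)$) with argument in $(-\pi/2,\pi/2]$; eigenvalues $\mu_k=(\rho'_k)^2$ (respectively $\lambda_k=\rho_k^2$) are counted with algebraic multiplicity (multiplicity as zeros of $\mu\mapsto S'(\pi,\sqrt\mu)$, respectively $\lambda\mapsto S(\pi,\sqrt\lambda)$) and numbered $k=1,2,\dots$ in order of increasing modulus. *)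

(* Defs.v *)
From mathcomp Require Export all_boot all_order all_algebra.
From mathcomp Require Export all_classical all_reals all_analysis.
From mathcomp Require Export complex.
Set Implicit Arguments.
Unset Strict Implicit.
Unset Printing Implicit Defensive.
Export Order.TTheory GRing.Theory Num.Theory.
Export numFieldNormedType.Exports.
Local Open Scope classical_set_scope.
Local Open Scope ring_scope.

(* R[i] seen through its numClosedFieldType structure: this is the form from
   which the canonical norm, topology and complex derivative are inferred. *)
Definition Cplx (R : realType) : numClosedFieldType := R[i].

(* |z| as an element of R (the MathComp norm `|z| lives in R[i]). *)
Definition cmod (R : realType) (z : Cplx R) : R := complex.Re `|z|.

Definition cintegrable (R : realType) (D : set R) (f : R -> Cplx R) : Prop :=
  lebesgue_measure.-integrable D (fun x => (complex.Re (f x))%:E) /\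
  lebesgue_measure.-integrable D (fun x => (complex.Im (f x))%:E).

Definition cintegral (R : realType) (D : set R) (f : R -> Cplx R) : Cplx R :=
  Complex (\int[lebesgue_measure]_(x in D) complex.Re (f x))
          (\int[lebesgue_measure]_(x in D) complex.Im (f x)).

Definition in_L2 (R : realType) (f : R -> Cplx R) : Prop :=
  [/\ measurable_fun `]0, pi[ (fun x => complex.Re (f x)),
      measurable_fun `]0, pi[ (fun x => complex.Im (f x)) &
      lebesgue_measure.-integrable `]0, pi[ (fun x => (cmod (f x) ^+ 2)%:E)].

Definition L2norm (R : realType) (f : R -> Cplx R) : R :=
  Num.sqrt (\int[lebesgue_measure]_(x in `]0, pi[) cmod (f x) ^+ 2).

Definition pair_norm (R : realType) (q M0 : R -> Cplx R) : R :=
  L2norm q + 2 * L2norm M0.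

Definition kernel_of (R : realType) (M0 : R -> Cplx R) (x : R) : Cplx R :=
  ((pi - x)^-1)%:C%C * M0 x.

(* (y, dy) is the solution (S, S') of
     - y'' + q y + \int_0^x M(x - t) y(t) dt = rho^2 y   a.e. on (0, pi),
     y(0) = 0, y'(0) = 1,
   in the Caratheodory sense: y and y' = dy are absolutely continuous on
   [0, pi], i.e. indefinite Lebesgue integrals of dy and of some integrable
   ddy = y''.  The initial values are built into the two integral formulas. *)
Definition sine_solution (R : realType) (q M0 : R -> Cplx R) (rho : Cplx R)
    (y dy : R -> Cplx R) : Prop :=
  exists ddy : R -> Cplx R,
  [/\ cintegrable `[0, pi] ddy,
      forall x : R, 0 <= x <= pi -> y x = cintegral `[0, x] dy,
      forall x : R, 0 <= x <= pi -> dy x = 1 + cintegral `[0, x] ddy &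
      {ae lebesgue_measure, forall x : R, 0 < x < pi ->
         - ddy x + q x * y x
           + cintegral `]0, x[ (fun t => kernel_of M0 (x - t) * y t)
         = rho ^+ 2 * y x}].

(* z is a zero of f of multiplicity m (m = 0 when f z != 0); the derivatives
   are complex ones. *)
Definition zero_multiplicity (R : realType) (f : Cplx R -> Cplx R)
    (z : Cplx R) (m : nat) : Prop :=
  (forall j : nat, (j < m)%N -> derive1n j f z = 0) /\ derive1n m f z != 0.

(* mu 1, mu 2, ... are all the zeros of f, each repeated according to its
   multiplicity, in order of nondecreasing modulus; mu 0 is irrelevant. *)
Definition enumerates_zeros (R : realType) (f : Cplx R -> Cplx R)
    (mu : nat -> Cplx R) : Prop :=
  (forall k : nat, (1 <= k)%N -> cmod (mu k) <= cmod (mu k.+1)) /\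
  (forall z : Cplx R, exists m : nat,
     zero_multiplicity f z m /\
     ([set k : nat | (1 <= k)%N /\ mu k = z] #= `I_m)%card).

(* sqrtC is some branch of the square root; S(x, rho) is even in rho, so the
   choice of the branch does not matter. *)
Definition Dirichlet_Neumann_eigenvalues (R : realType) (q M0 : R -> Cplx R)
    (mu : nat -> Cplx R) : Prop :=
  exists S dS : Cplx R -> R -> Cplx R,
    (forall rho : Cplx R, sine_solution q M0 rho (S rho) (dS rho)) /\
    enumerates_zeros (fun z => dS (sqrtC z) pi) mu.

Definition Dirichlet_eigenvalues (R : realType) (q M0 : R -> Cplx R)
    (lambda : nat -> Cplx R) : Prop :=
  exists S dS : Cplx R -> R -> Cplx R,
    (forall rho : Cplx R, sine_solution q M0 rho (S rho) (dS rho)) /\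
    enumerates_zeros (fun z => S (sqrtC z) pi) lambda.

(* rho = z^{1/2} with - pi/2 < arg rho <= pi/2 (and rho = 0 when z = 0). *)
Definition principal_sqrt (R : realType) (z rho : Cplx R) : Prop :=
  rho ^+ 2 = z /\
  exists theta : R, - (pi / 2) < theta <= pi / 2 /\
    rho = Complex (cmod rho * cos theta) (cmod rho * sin theta).

(* Main.v *)
From HB Require Import structures.
Require Import Defs.
From mathcomp Require Import measurable_realfun ring lra.
Set Implicit Arguments.
Unset Strict Implicit.
Unset Printing Implicit Defensive.
Local Open Scope classical_set_scope.
Local Open Scope ring_scope.

(** The characteristic functions [S(pi)] and [S'(pi)] are entire in the spectral
    parameter and are compared with those of the free problem [q = M = 0], whose
    zeros are the squares of [a_k = k - theta], with [theta = 0] (Dirichlet) or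
    [theta = 1/2] (Dirichlet-Neumann).

    Put [K = sqrt pi * ||f||], which bounds [int |q| + int |M0|].  By Tonelli the
    convolution term costs no more than [int |M0|], the weight [1 / (pi - s)] being
    compensated by the length of the range of the outer variable; so variation of
    constants bounds the relative error of the comparison at [rho] by
    [kappa / (1 - kappa)], where [kappa = K / |rho|].

    Rouche's theorem on circles halfway between consecutive [a_n] counts the zeros.
    If [K <= k / 200], the k-th zero is the one close to [a_k], and
    [|sin (pi (rho - a_k))| <= e^(pi |Im rho|) kappa / (1 - kappa)] gives
    [pi |rho_k - a_k| <= kappa (1 + O(kappa))]: the leading constant is
    [K / pi = ||f|| / sqrt pi], which is where [c_1 > 1 / sqrt pi] comes from.
    If [K > k / 200], the circle of radius about [200 K] still gives
    [|rho_k| = O(K)], hence [|rho_k - a_k| = O(K) = O(K^2 / a_k)], and such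
    quadratic terms are absorbed by [c_2 r]. *)

(** Complex analysis is reduced to polynomials. An entire function is a limit of polynomials in a
    norm on coefficients for which division by [z - a] is continuous; the argument principle becomes
    an average over the roots of [z^N = r^N]; Rouche's theorem for entire functions follows from the
    polynomial case once the zeros to be counted are divided out. Multiplicity enters only through
    that division, each removed linear factor lowering one multiplicity by one.

    The solutions are merely given for each [rho], so their dependence on the parameter has to be
    constructed: divided differences in the parameter solve the equation again, and in the weight
    [exp (w x)] with w large each is bounded by an arbitrarily small multiple of the bound for the
    previous one. The same a priori estimate, with other fundamental pairs and weights, gives the
    asymptotic comparison and excludes a Dirichlet-Neumann zero near 0.

    The gap between [c_1] and [1 / sqrt pi] leaves room for the quadratic remainder: for small
    [||f||] the gap absorbs it, and otherwise r is bounded below and [c_2 r] dominates. *)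

Section ComplexModulus.
Variable R : realType.
Implicit Types (x y z w : Cplx R) (a b : R).
Local Notation C := (Cplx R).

Lemma CplxP z w : complex.Re z = complex.Re w -> complex.Im z = complex.Im w ->
  z = w.
Proof. by case: z => a b; case: w => c d /= -> ->. Qed.

Lemma ReD z w : complex.Re (z + w) = complex.Re z + complex.Re w.
Proof. by case: z => a b; case: w => c d. Qed.
Lemma ImD z w : complex.Im (z + w) = complex.Im z + complex.Im w.
Proof. by case: z => a b; case: w => c d. Qed.
Lemma ReN z : complex.Re (- z) = - complex.Re z. Proof. by case: z. Qed.
Lemma ImN z : complex.Im (- z) = - complex.Im z. Proof. by case: z. Qed.
Lemma ReM z w : complex.Re (z * w) =
  complex.Re z * complex.Re w - complex.Im z * complex.Im w.
Proof. by case: z => a b; case: w => c d. Qed.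
Lemma ImM z w : complex.Im (z * w) =
  complex.Re z * complex.Im w + complex.Im z * complex.Re w.
Proof. by case: z => a b; case: w => c d. Qed.
Lemma ReRC a : complex.Re (a%:C%C : C) = a. Proof. by []. Qed.
Lemma ImRC a : complex.Im (a%:C%C : C) = 0. Proof. by []. Qed.
Lemma Re1 : complex.Re (1 : C) = 1. Proof. by []. Qed.
Lemma Im1 : complex.Im (1 : C) = 0. Proof. by []. Qed.
Lemma Re0 : complex.Re (0 : C) = 0. Proof. by []. Qed.
Lemma Im0 : complex.Im (0 : C) = 0. Proof. by []. Qed.
Definition ReImE := (ReD, ImD, ReN, ImN, ReM, ImM, ReRC, ImRC, Re1, Im1, Re0, Im0).

Lemma normE z : `|z| = ((cmod z)%:C)%C.
Proof. by rewrite /cmod; case: z => a b. Qed.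

Lemma cmod_def z : cmod z = Num.sqrt (complex.Re z ^+ 2 + complex.Im z ^+ 2).
Proof. by rewrite /cmod; case: z. Qed.

Lemma sqr_cmod z : cmod z ^+ 2 = complex.Re z ^+ 2 + complex.Im z ^+ 2.
Proof. by rewrite cmod_def sqr_sqrtr ?addr_ge0 ?sqr_ge0. Qed.

Lemma RC_inj a b : (a%:C%C : C) = b%:C%C -> a = b. Proof. by case. Qed.
Lemma RCD a b : ((a + b)%:C)%C = (a%:C)%C + (b%:C)%C :> C. Proof. exact: rmorphD. Qed.
Lemma RCM a b : ((a * b)%:C)%C = (a%:C)%C * (b%:C)%C :> C. Proof. exact: rmorphM. Qed.
Lemma RCN a : ((- a)%:C)%C = - (a%:C)%C :> C. Proof. exact: rmorphN. Qed.
Lemma RCV a : ((a^-1)%:C)%C = (a%:C)%C^-1 :> C. Proof. exact: fmorphV. Qed.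
Lemma RCn n : ((n%:R : R)%:C)%C = n%:R :> C. Proof. exact: rmorph_nat. Qed.

Lemma cmod_ge0 z : 0 <= cmod z. Proof. by rewrite cmod_def sqrtr_ge0. Qed.
Lemma cmod0 : cmod (0 : C) = 0.
Proof. by apply: RC_inj; rewrite -normE normr0. Qed.
Lemma cmod1 : cmod (1 : C) = 1.
Proof. by apply: RC_inj; rewrite -normE normr1. Qed.
Lemma cmodM z w : cmod (z * w) = cmod z * cmod w.
Proof. by apply: RC_inj; rewrite -normE normrM !normE RCM. Qed.
Lemma cmodN z : cmod (- z) = cmod z.
Proof. by apply: RC_inj; rewrite -!normE normrN. Qed.
Lemma cmodV z : cmod (z^-1) = (cmod z)^-1.
Proof. by apply: RC_inj; rewrite -normE normfV !normE RCV. Qed.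
Lemma cmodX z n : cmod (z ^+ n) = cmod z ^+ n.
Proof. by elim: n => [|n IH]; rewrite ?expr0 ?cmod1 // !exprS cmodM IH. Qed.
Lemma cmodD z w : cmod (z + w) <= cmod z + cmod w.
Proof. by have := ler_normD z w; rewrite !normE -RCD lecR. Qed.
Lemma cmod_eq0 z : (cmod z == 0) = (z == 0).
Proof.
apply/eqP/eqP => [h|->]; last exact: cmod0.
by apply/eqP; rewrite -normr_eq0 normE h.
Qed.
Lemma cmod_gt0 z : (0 < cmod z) = (z != 0).
Proof. by rewrite lt_def cmod_ge0 andbT cmod_eq0. Qed.
Lemma cmodBC z w : cmod (z - w) = cmod (w - z).
Proof. by rewrite -cmodN opprB. Qed.
Lemma cmodB z w : cmod (z - w) <= cmod z + cmod w.
Proof. by rewrite -(cmodN w); exact: cmodD. Qed.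
Lemma cmodB_ge z w : cmod z - cmod w <= cmod (z - w).
Proof. by rewrite lerBlDr; apply: le_trans (cmodD _ _); rewrite subrK. Qed.
Lemma cmodD_ge z w : cmod z - cmod w <= cmod (z + w).
Proof. by have := cmodB_ge z (- w); rewrite cmodN opprK. Qed.
Lemma cmodRC a : cmod (a%:C%C : C) = `|a|.
Proof. by rewrite cmod_def /= expr0n /= addr0 sqrtr_sqr. Qed.
Lemma cmodn n : cmod (n%:R : C) = n%:R.
Proof. by rewrite -RCn cmodRC ger0_norm ?ler0n. Qed.
Lemma cmod_sum I (r : seq I) (P : pred I) (F : I -> C) :
  cmod (\sum_(i <- r | P i) F i) <= \sum_(i <- r | P i) cmod (F i).
Proof.
elim/big_ind2 : _ => [|x a y b h1 h2|//]; first by rewrite cmod0.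
exact: le_trans (cmodD _ _) (lerD _ _).
Qed.
Lemma normr_Re z : `|complex.Re z| <= cmod z.
Proof.
rewrite cmod_def -sqrtr_sqr ler_sqrt ?addr_ge0 ?sqr_ge0 //.
by rewrite lerDl sqr_ge0.
Qed.
Lemma normr_Im z : `|complex.Im z| <= cmod z.
Proof.
rewrite cmod_def -sqrtr_sqr ler_sqrt ?addr_ge0 ?sqr_ge0 //.
by rewrite lerDr sqr_ge0.
Qed.
Lemma cmod_leD z : cmod z <= `|complex.Re z| + `|complex.Im z|.
Proof.
rewrite -(@ler_pXn2r _ 2%N) ?nnegrE ?addr_ge0 ?cmod_ge0 //.
rewrite sqr_cmod sqrrD !real_normK ?num_real // lerD2r lerDl.
by rewrite mulrn_wge0 // mulr_ge0.
Qed.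

End ComplexModulus.

(** * Entire functions and their zeros *)

Section PolyNorm.
Variable R : realType.
Local Notation C := (Cplx R).
Implicit Types (p q : {poly C}) (a z : C) (r : R).

(* Dominates |p| on the disc of radius r, and passes to difference quotients;
   this makes division by z - a continuous without any Cauchy formula. *)
Definition pnorm r p : R := \sum_(i < size p) cmod p`_i * r ^+ i.

Lemma pnormE n r p : (size p <= n)%N ->
  pnorm r p = \sum_(i < n) cmod p`_i * r ^+ i.
Proof.
move=> pn; rewrite /pnorm (big_ord_widen n (fun i => cmod p`_i * r ^+ i) pn).
rewrite big_mkcond; apply: eq_bigr => i _; case: ltnP => // h.
by rewrite nth_default // cmod0 mul0r.
Qed.

Lemma pnorm_ge0 r p : 0 <= r -> 0 <= pnorm r p.
Proof.
by move=> r0; apply: sumr_ge0 => i _; rewrite mulr_ge0 ?cmod_ge0 ?exprn_ge0.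
Qed.

Lemma pnorm_lin r q a : pnorm r (q * 'X + a%:P) = r * pnorm r q + cmod a.
Proof.
rewrite (@pnormE (size q).+1); last by rewrite size_MXaddC; case: ifP.
rewrite big_ord_recl /= expr0 mulr1 addrC; congr (_ + _); last first.
  by rewrite coefD coefMX coefC /= add0r.
rewrite /pnorm mulr_sumr; apply: eq_bigr => i _.
by rewrite coefD coefMX coefC /= addr0 exprS mulrCA.
Qed.

Lemma pnormD r p q : 0 <= r -> pnorm r (p + q) <= pnorm r p + pnorm r q.
Proof.
move=> r0; set n := maxn (size p) (size q).
rewrite !(@pnormE n) ?leq_maxl ?leq_maxr ?(leq_trans (size_polyD _ _)) //.
rewrite -big_split /=; apply: ler_sum => i _.
by rewrite coefD -mulrDl ler_wpM2r ?exprn_ge0 ?cmodD.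
Qed.

Lemma pnormZ r a p : pnorm r (a *: p) = cmod a * pnorm r p.
Proof.
rewrite !(@pnormE (size p)) ?(leq_trans (size_scale_leq _ _)) //.
by rewrite mulr_sumr; apply: eq_bigr => i _; rewrite coefZ cmodM mulrA.
Qed.

Lemma pnorm_mono r r' p : 0 <= r -> r <= r' -> pnorm r p <= pnorm r' p.
Proof.
move=> r0 rr'; apply: ler_sum => i _; rewrite ler_wpM2l ?cmod_ge0 //.
by rewrite lerXn2r ?nnegrE // (le_trans r0).
Qed.

Lemma horner_pnorm r p z : cmod z <= r -> cmod p.[z] <= pnorm r p.
Proof.
move=> zr; rewrite horner_coef (le_trans (cmod_sum _ _ _)) //.
apply: ler_sum => i _; rewrite cmodM cmodX ler_wpM2l ?cmod_ge0 //.
by rewrite lerXn2r ?nnegrE ?cmod_ge0 // (le_trans _ zr) ?cmod_ge0.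
Qed.

Lemma pnormMX r p a : 0 <= r ->
  pnorm r (p * ('X - a%:P)) <= pnorm r p * (r + cmod a).
Proof.
move=> r0; rewrite mulrBr (_ : p * 'X - _ = (p * 'X + 0%:P) + (- a) *: p); last first.
  by rewrite polyC0 addr0 scaleNr -mul_polyC [a%:P * p]mulrC.
apply: le_trans (pnormD _ _ r0) _.
by rewrite pnorm_lin pnormZ cmod0 addr0 cmodN; lra.
Qed.

(** From [(q X + c)' = q' X + q]: enlarging the radius by 1 pays for the extra summand [q] at each
    Horner step. *)
Lemma deriv_pnorm r p : 0 <= r -> pnorm r p^`() <= pnorm (r + 1) p.
Proof.
move=> r0; elim/poly_ind: p => [|q c IH].
  by rewrite deriv0 {1}/pnorm size_poly0 big_ord0 pnorm_ge0 // addr_ge0.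
rewrite derivD derivC addr0 derivM derivX mulr1 pnorm_lin.
apply: le_trans (pnormD _ _ r0) _.
rewrite -(addr0 (q^`() * 'X)) -polyC0 pnorm_lin cmod0 addr0.
apply: ler_wpDr; first exact: cmod_ge0.
rewrite mulrDl mul1r lerD ?ler_wpM2l //.
by apply: pnorm_mono => //; rewrite lerDl.
Qed.

Definition divdiff a p : {poly C} := (p - p.[a]%:P) %/ ('X - a%:P).

Lemma divdiffP a p : p - p.[a]%:P = divdiff a p * ('X - a%:P).
Proof.
apply/esym/divpK; rewrite dvdp_XsubCl /root.
by rewrite hornerD hornerN hornerC subrr.
Qed.

Lemma XsubC_inj a p q : p * ('X - a%:P) = q * ('X - a%:P) -> p = q.
Proof. by apply: mulIf; rewrite polyXsubC_eq0. Qed.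

Lemma divdiffB a p q : divdiff a (p - q) = divdiff a p - divdiff a q.
Proof.
apply: (@XsubC_inj a); rewrite -divdiffP mulrBl -!divdiffP.
by rewrite hornerD hornerN polyCD polyCN; ring.
Qed.

Lemma divdiff_lin a q c : divdiff a (q * 'X + c%:P) = q + a *: divdiff a q.
Proof.
apply: (@XsubC_inj a); rewrite -divdiffP mulrDl -scalerAl -divdiffP.
rewrite !hornerE -mul_polyC !polyCD !polyCM; ring.
Qed.

Lemma divdiff_deriv a p : (divdiff a p).[a] = p^`().[a].
Proof.
have := congr1 (fun p => (deriv p).[a]) (divdiffP a p).
rewrite derivD derivN derivC derivM derivXsubC !hornerE /= subrr => h.
by move: h; rewrite ?subr0 ?mulr0 ?add0r.
Qed.

Lemma horner_divdiff a p z : p.[z] - p.[a] = (z - a) * (divdiff a p).[z].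
Proof.
have := congr1 (fun p => p.[z]) (divdiffP a p).
by rewrite !hornerE => ->; rewrite mulrC.
Qed.

(** Horner's scheme: the quotient of [q X + c] is [q] plus [a] times the quotient of [q]. The radius
    [r + |a| + 1] makes room for the factor [|a|] and, through the 1, for the summand [q]. *)
Lemma divdiff_pnorm r a p : 0 <= r ->
  pnorm r (divdiff a p) <= pnorm (r + cmod a + 1) p.
Proof.
move=> r0; have a0 := cmod_ge0 a; elim/poly_ind: p => [|q c IH].
  have -> : divdiff a 0 = 0.
    by apply: (@XsubC_inj a); rewrite -divdiffP horner0 mul0r subr0.
  by rewrite {1}/pnorm size_poly0 big_ord0 pnorm_ge0 //; lra.
rewrite divdiff_lin pnorm_lin; apply: le_trans (pnormD _ _ r0) _.
rewrite pnormZ; have := cmod_ge0 c.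
have h1 : pnorm r q <= pnorm (r + cmod a + 1) q by apply: pnorm_mono; lra.
have h2 : cmod a * pnorm r (divdiff a q) <= cmod a * pnorm (r + cmod a + 1) q.
  by rewrite ler_wpM2l.
have h3 : 0 <= r * pnorm (r + cmod a + 1) q.
  by rewrite mulr_ge0 // pnorm_ge0 //; lra.
by rewrite !mulrDl mul1r; lra.
Qed.

End PolyNorm.

Section EntireFunctions.
Variable R : realType.
Local Notation C := (Cplx R).
Implicit Types (f g h : C -> C) (a z : C) (r e : R).

Definition pcauchy (p : nat -> {poly C}) := forall r e, 0 <= r -> 0 < e ->
  exists m0, forall m l, (m0 <= m)%N -> (m0 <= l)%N -> pnorm r (p m - p l) <= e.

Definition seqlim (u : nat -> C) (l : C) := forall e, 0 < e ->
  exists m0, forall m, (m0 <= m)%N -> cmod (l - u m) <= e.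

(* Locally uniform limits of polynomials, with uniformity measured by [pnorm]. *)
Definition entire f := exists p, pcauchy p /\ forall z, seqlim (fun m => (p m).[z]) (f z).

Lemma rcauchy_lim (u : nat -> R) :
  (forall e, 0 < e -> exists m0, forall m l, (m0 <= m)%N -> (m0 <= l)%N ->
     `|u m - u l| <= e) ->
  exists v, forall e, 0 < e -> exists m0, forall m, (m0 <= m)%N -> `|v - u m| <= e.
Proof.
move=> uC; have cu : cvg (u @ \oo).
  apply/cauchy_cvgP/cauchy_ballP => e e0.
  have e20 : 0 < e / 2 by rewrite divr_gt0.
  have [m0 h] := uC _ e20.
  exists (u @` [set n | (m0 <= n)%N], u @` [set n | (m0 <= n)%N]) => /=.
    by split; exists m0 => // n hn; exists n.
  move=> [_ _] [/= [x hx <-] [y hy <-]].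
  rewrite /ball /= (le_lt_trans (h _ _ hx hy)) //.
  by rewrite ltr_pdivrMr // ltr_pMr // ltr1n.
exists (lim (u @ \oo)) => e e0.
have /cvgrPdist_le /(_ e e0) [m0 _ h] := cu.
by exists m0 => m hm; apply: h.
Qed.

Lemma cauchy_seqlim (u : nat -> C) :
  (forall e, 0 < e -> exists m0, forall m l, (m0 <= m)%N -> (m0 <= l)%N ->
     cmod (u m - u l) <= e) ->
  exists v, seqlim u v.
Proof.
move=> uC.
have [|x hx] := @rcauchy_lim (fun n => complex.Re (u n)).
  move=> e /uC [m0 h]; exists m0 => m l hm hl; apply: le_trans (h _ _ hm hl).
  by rewrite -ReN -ReD normr_Re.
have [|y hy] := @rcauchy_lim (fun n => complex.Im (u n)).
  move=> e /uC [m0 h]; exists m0 => m l hm hl; apply: le_trans (h _ _ hm hl).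
  by rewrite -ImN -ImD normr_Im.
exists (Complex x y) => e e0.
have e20 : 0 < e / 2 by rewrite divr_gt0.
have [m1 h1] := hx _ e20; have [m2 h2] := hy _ e20.
exists (maxn m1 m2) => m; rewrite geq_max => /andP[hm1 hm2].
apply: le_trans (cmod_leD _) _; rewrite !ReImE /=.
by have := h1 _ hm1; have := h2 _ hm2; lra.
Qed.

Lemma seqlim_uniq u v w : seqlim u v -> seqlim u w -> v = w.
Proof.
move=> uv uw; apply/eqP; rewrite -subr_eq0 -cmod_eq0; apply/eqP/le_anti.
rewrite cmod_ge0 andbT; apply/ler_addgt0Pl => e e0.
have e20 : 0 < e / 2 by rewrite divr_gt0.
have [m1 h1] := uv _ e20; have [m2 h2] := uw _ e20.
have := h1 _ (leq_maxl m1 m2); have := h2 _ (leq_maxr m1 m2).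
set x := u _; rewrite (_ : v - w = (v - x) - (w - x)); last by ring.
by have := cmodB (v - x) (w - x); lra.
Qed.

(** The threshold [m0] comes from the Cauchy condition alone, which does not involve [z]; the second
    index, chosen after [z], serves only to approximate [f z]. *)
Lemma entire_unif f p : pcauchy p -> (forall z, seqlim (fun m => (p m).[z]) (f z)) ->
  forall r e, 0 <= r -> 0 < e -> exists m0, forall m, (m0 <= m)%N ->
  forall z, cmod z <= r -> cmod (f z - (p m).[z]) <= e.
Proof.
move=> pC pf r e r0 e0; have e20 : 0 < e / 2 by rewrite divr_gt0.
have [m0 h0] := pC _ _ r0 e20; exists m0 => m hm z zr.
have [m1 h1] := pf z _ e20.
have := h0 _ _ (leq_maxl m0 m1) hm; have := h1 _ (leq_maxr m0 m1).
set l := maxn _ _; move=> a1 a2.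
have a3 := le_trans (horner_pnorm (p l - p m) zr) a2.
rewrite (_ : f z - _ = (f z - (p l).[z]) + (p l - p m).[z]); last first.
  by rewrite hornerD hornerN; ring.
by have := cmodD (f z - (p l).[z]) (p l - p m).[z]; lra.
Qed.

Lemma entire_lim p : pcauchy p ->
  exists g, entire g /\ forall z, seqlim (fun m => (p m).[z]) (g z).
Proof.
move=> pC.
have H z : exists v, seqlim (fun m => (p m).[z]) v.
  apply: cauchy_seqlim => e e0; have [m0 h] := pC _ _ (cmod_ge0 z) e0.
  exists m0 => m l hm hl; rewrite -hornerN -hornerD.
  exact: le_trans (horner_pnorm _ (lexx _)) (h _ _ hm hl).
have [g hg] := choice H.
by exists g; split => //; exists p.
Qed.

Lemma pcauchy_divdiff a p : pcauchy p -> pcauchy (fun m => divdiff a (p m)).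
Proof.
move=> pC r e r0 e0; have r10 : 0 <= r + cmod a + 1.
  by rewrite !addr_ge0 ?cmod_ge0.
have [m0 h] := pC _ _ r10 e0; exists m0 => m l hm hl.
by rewrite -divdiffB (le_trans (divdiff_pnorm _ _ r0)) ?h.
Qed.

Lemma pcauchy_deriv p : pcauchy p -> pcauchy (fun m => (p m)^`()).
Proof.
move=> pC r e r0 e0; have r10 : 0 <= r + 1 by rewrite !addr_ge0.
have [m0 h] := pC _ _ r10 e0; exists m0 => m l hm hl.
by rewrite -derivB (le_trans (deriv_pnorm _ r0)) ?h.
Qed.

(** The quotients of the approximating polynomials are again Cauchy in [pnorm], and [g] is their
    limit. The third clause is what later identifies the derivative of [f] as the limit of the
    polynomial derivatives. *)
Lemma entire_div_strong f p a : pcauchy p ->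
  (forall z, seqlim (fun m => (p m).[z]) (f z)) ->
  exists g, [/\ entire g, forall z, f z - f a = (z - a) * g z &
             seqlim (fun m => (p m)^`().[a]) (g a)].
Proof.
move=> pC pf; have [g [ge hg]] := entire_lim (pcauchy_divdiff a pC).
exists g; split => //; last first.
  by move=> e /(hg a) [m0 h]; exists m0 => m /h; rewrite divdiff_deriv.
move=> z; apply: (@seqlim_uniq (fun m => (p m).[z] - (p m).[a])) => e e0.
  have e20 : 0 < e / 2 by rewrite divr_gt0.
  have [m1 h1] := pf z _ e20; have [m2 h2] := pf a _ e20.
  exists (maxn m1 m2) => m; rewrite geq_max => /andP[/h1 k1 /h2 k2].
  rewrite (_ : _ - _ = (f z - (p m).[z]) - (f a - (p m).[a])); last by ring.
  by have := cmodB (f z - (p m).[z]) (f a - (p m).[a]); lra.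
have e20 : 0 < e / (cmod (z - a) + 1) by rewrite divr_gt0 // ltr_wpDl ?cmod_ge0.
have [m0 h] := hg z _ e20; exists m0 => m /h.
rewrite horner_divdiff -mulrBr cmodM.
rewrite ler_pdivlMr ?ltr_wpDl ?cmod_ge0 // => h'.
by have := cmod_ge0 (g z - (divdiff a (p m)).[z]); nra.
Qed.

Lemma entire_div f a : entire f ->
  exists g, entire g /\ forall z, f z - f a = (z - a) * g z.
Proof.
by move=> [p [pC pf]]; have [g []] := entire_div_strong a pC pf; exists g.
Qed.

Lemma entire_bounded f r : 0 <= r -> entire f ->
  exists B, 0 <= B /\ forall z, cmod z <= r -> cmod (f z) <= B.
Proof.
move=> r0 [p [pC pf]]; have [m0 h] := entire_unif pC pf r0 ltr01.
exists (1 + pnorm r (p m0)); split; first by rewrite addr_ge0 ?pnorm_ge0.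
move=> z zr; rewrite -(subrK (p m0).[z] (f z)).
by rewrite (le_trans (cmodD _ _)) // lerD ?h // horner_pnorm.
Qed.

Lemma entire_cont f a e : entire f -> 0 < e ->
  exists d, 0 < d /\ forall z, cmod (z - a) <= d -> cmod (f z - f a) <= e.
Proof.
move=> ef e0; have [g [eg hg]] := entire_div a ef.
have r0 : 0 <= cmod a + 1 by rewrite addr_ge0 ?cmod_ge0.
have [B [B0 hB]] := entire_bounded r0 eg.
exists (Num.min 1 (e / (B + 1))); rewrite lt_min ltr01 divr_gt0 ?ltr_wpDl //.
split => // z; rewrite le_min => /andP[h1 h2]; rewrite hg cmodM.
have h3 : cmod (g z) <= B.
  apply: hB; rewrite -(subrK a z) addrC.
  by have := cmodD a (z - a); lra.
move: h2; rewrite ler_pdivlMr ?ltr_wpDl // => h2.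
by have := cmod_ge0 (z - a); have := cmod_ge0 (g z); nra.
Qed.

Lemma derive1_quot f g a : (forall z, f z - f a = (z - a) * g z) ->
  (forall e, 0 < e -> exists d, 0 < d /\
     forall z, cmod (z - a) <= d -> cmod (g z - g a) <= e) ->
  derive1 f a = g a.
Proof.
move=> fg gc; rewrite derive1E /derive; apply: cvg_lim => //.
apply/cvgrPdist_le => /= eps eps0.
(* Radii of the topology live in [R[i]], where being positive forces the imaginary part to
   vanish. *)
have epsE : eps = ((complex.Re eps)%:C)%C.
  by move: eps0; rewrite ltcE => /andP[/eqP h _]; apply: CplxP; rewrite //= h.
have e0 : 0 < complex.Re eps by move: eps0; rewrite ltcE => /andP[].
have [d [d0 hd]] := gc _ e0.
exists ((d%:C)%C) => /=; first by rewrite ltcR.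
move=> h /=; rewrite sub0r normrN normE ltcR => hd1 h0.
rewrite /GRing.scale /= mulr1 fg addrK mulrA mulVf // mul1r normE epsE lecR cmodBC.
by apply: hd; rewrite addrK ltW.
Qed.

Lemma derive1_entire f g a : entire g -> (forall z, f z - f a = (z - a) * g z) ->
  derive1 f a = g a.
Proof.
move=> eg fg; apply: derive1_quot fg _ => e e0.
exact: entire_cont.
Qed.

Lemma entire_derive f : entire f -> entire (derive1 f).
Proof.
move=> ef; have [p [pC pf]] := ef; exists (fun m => (p m)^`()); split.
  exact: pcauchy_deriv.
move=> a; have [g [eg fg hg]] := entire_div_strong a pC pf.
by rewrite (derive1_entire eg fg).
Qed.

Lemma entire_deriven f n : entire f -> entire (derive1n n f).
Proof. by move=> ef; elim: n => [|n IH] //; rewrite derive1nS; exact: entire_derive. Qed.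

Lemma entireD f g : entire f -> entire g -> entire (fun z => f z + g z).
Proof.
move=> [p [pC pf]] [q [qC qg]]; exists (fun m => p m + q m).
split => [r e r0 e0|z e e0].
  have e20 : 0 < e / 2 by rewrite divr_gt0.
  have [m1 h1] := pC _ _ r0 e20; have [m2 h2] := qC _ _ r0 e20.
  exists (maxn m1 m2) => m l; rewrite !geq_max => /andP[a1 a2] /andP[b1 b2].
  rewrite (_ : _ - _ = (p m - p l) + (q m - q l)); last by ring.
  have := pnormD (p m - p l) (q m - q l) r0.
  by have := h1 _ _ a1 b1; have := h2 _ _ a2 b2; lra.
have e20 : 0 < e / 2 by rewrite divr_gt0.
have [m1 h1] := pf z _ e20; have [m2 h2] := qg z _ e20.
exists (maxn m1 m2) => m; rewrite !geq_max => /andP[/h1 a1 /h2 a2].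
rewrite hornerD (_ : _ - _ = (f z - (p m).[z]) + (g z - (q m).[z])); last by ring.
by have := cmodD (f z - (p m).[z]) (g z - (q m).[z]); lra.
Qed.

Lemma entireZ c f : entire f -> entire (fun z => c * f z).
Proof.
move=> [p [pC pf]]; exists (fun m => c *: p m); have c0 := cmod_ge0 c.
split => [r e r0 e0|z e e0].
  have e20 : 0 < e / (cmod c + 1) by rewrite divr_gt0 // ltr_wpDl.
  have [m1 h1] := pC _ _ r0 e20; exists m1 => m l hm hl.
  rewrite -scalerBr pnormZ; have := h1 _ _ hm hl.
  rewrite ler_pdivlMr ?ltr_wpDl // => h.
  by have := pnorm_ge0 (p m - p l) r0; nra.
have e20 : 0 < e / (cmod c + 1) by rewrite divr_gt0 // ltr_wpDl.
have [m0 h] := pf z _ e20; exists m0 => m /h.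
rewrite hornerZ -mulrBr cmodM ler_pdivlMr ?ltr_wpDl // => h'.
by have := cmod_ge0 (f z - (p m).[z]); nra.
Qed.

Lemma derive1_cmulX c f g a b : entire f -> entire g ->
  derive1 (fun z => c * f z + (z - a) * g z) b =
  c * derive1 f b + g b + (b - a) * derive1 g b.
Proof.
move=> ef eg; have [k [ek gk]] := entire_div b eg.
have [h [eh fh]] := entire_div b ef.
rewrite (derive1_entire ek gk) (derive1_entire eh fh).
apply: (@derive1_entire _ (fun z => c * h z + g z + (b - a) * k z)).
  by apply: entireD; [apply: entireD => //|]; apply: entireZ.
move=> z; have := gk z; move=> /eqP; rewrite subr_eq => /eqP ->.
have := fh z; move=> /eqP; rewrite subr_eq => /eqP ->; ring.
Qed.

(** Leibniz rule for a linear factor. At [n = 0] the truncated index [n.-1] is harmless because its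
    coefficient is 0. *)
Lemma deriven_mulX f g a : entire g -> (forall z, f z = (z - a) * g z) ->
  forall n z, derive1n n f z =
    n%:R * derive1n n.-1 g z + (z - a) * derive1n n g z.
Proof.
move=> eg fg; elim=> [|n IH] z; first by rewrite !derive1n0 mul0r add0r fg.
rewrite derive1nS (_ : derive1n n f = (fun z => n%:R * derive1n n.-1 g z +
  (z - a) * derive1n n g z)); last by apply/funext.
rewrite derive1_cmulX; try exact: entire_deriven.
rewrite -derive1nS /=; congr (_ + _); case: n {IH} => [|n] /=.
  by rewrite mul0r add0r mul1r.
by rewrite -derive1nS -[in RHS]addn1 natrD mulrDl mul1r.
Qed.

Lemma zero_multiplicity_root f g a m : entire g ->
  (forall z, f z = (z - a) * g z) -> zero_multiplicity f a m ->
  (0 < m)%N /\ zero_multiplicity g a m.-1.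
Proof.
move=> eg fg [h1 h2].
have E n : derive1n n.+1 f a = n.+1%:R * derive1n n g a.
  by rewrite (deriven_mulX eg fg) subrr mul0r addr0.
case: m h1 h2 => [|m] h1 h2.
  by move: h2; rewrite derive1n0 fg subrr mul0r eqxx.
split => //=; split.
  move=> j jm; have := h1 j.+1 jm; rewrite E => /eqP.
  by rewrite mulf_eq0 pnatr_eq0 /= => /eqP.
by move: h2; rewrite E mulf_eq0 pnatr_eq0.
Qed.

(** At [b] the Leibniz relations between the derivatives of [f] and [g] form a triangular system
    with diagonal entry [b - a != 0], so the order of vanishing is the same for both. *)
Lemma zero_multiplicity_nonroot f g a b m : entire g ->
  (forall z, f z = (z - a) * g z) -> b != a -> zero_multiplicity f b m ->
  zero_multiplicity g b m.
Proof.
move=> eg fg ba [h1 h2].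
have H j : (j < m)%N -> derive1n j g b = 0.
  elim: j => [|j IH] jm.
    have := h1 0%N jm; rewrite !derive1n0 fg => /eqP.
    by rewrite mulf_eq0 subr_eq0 (negbTE ba) => /eqP.
  have := h1 _ jm; rewrite (deriven_mulX eg fg) /= IH ?(ltnW jm) //.
  by rewrite mulr0 add0r => /eqP; rewrite mulf_eq0 subr_eq0 (negbTE ba) => /eqP.
split => //; move: h2; rewrite (deriven_mulX eg fg).
case: m h1 H => [|m] h1 H; first by rewrite mul0r add0r mulf_eq0 negb_or => /andP[].
by rewrite /= H // mulr0 add0r mulf_eq0 negb_or => /andP[].
Qed.

Lemma enumerates_zeros_root f mu k : enumerates_zeros f mu -> (1 <= k)%N ->
  f (mu k) = 0.
Proof.
move=> [_ h] k1; have [m [[hm1 _] hm2]] := h (mu k).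
case: m hm1 hm2 => [|m] hm1 hm2; last by have := hm1 0%N isT.
move: hm2; rewrite II0 card_eq0 => /eqP hm2.
have : [set j : nat | (1 <= j)%N /\ mu j = mu k] k by [].
by rewrite hm2.
Qed.

Lemma enumerates_zeros_mem f mu z : enumerates_zeros f mu -> f z = 0 ->
  exists k, (1 <= k)%N /\ mu k = z.
Proof.
move=> [_ h] fz; have [m [[hm1 hm0] hm2]] := h z.
case: m hm1 hm0 hm2 => [|m] hm1 hm0 hm2.
  by move: hm0; rewrite derive1n0 fz eqxx.
have : [set k : nat | (1 <= k)%N /\ mu k = z] !=set0.
  apply/set0P/negP => /eqP e; move: hm2; rewrite e -II0 => /card_eq_II.
  by [].
by move=> [k hk]; exists k.
Qed.

(** Dividing by [z - mu 1] and dropping the index 1 agree at every point: over [mu 1] the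
    multiplicity and the fibre of the enumeration both lose one, elsewhere both stay. The shifted
    fibre is compared with the old one through the successor map. *)
Lemma enumerates_zeros_div f g mu : entire g ->
  (forall z, f z = (z - mu 1%N) * g z) -> enumerates_zeros f mu ->
  enumerates_zeros g (fun k => mu k.+1).
Proof.
move=> eg fg [h1 h2]; split; first by move=> k _; apply: h1.
move=> z; have [m [hm1 hm2]] := h2 z.
set B := [set k : nat | (1 <= k)%N /\ mu k.+1 = z].
have SB : (S @` B #= B)%card by apply: inj_card_eq => i j _ _ [].
have [zm|zm] := eqVneq z (mu 1%N); last first.
  exists m; split; first exact: zero_multiplicity_nonroot hm1.
  rewrite -(card_eql SB) (_ : S @` B = [set k : nat | (1 <= k)%N /\ mu k = z]) //.
  apply/seteqP; split => [_ [k [k1 hk] <-] //|[|[|k]] [k1 hk]] //.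
    by move: zm; rewrite -hk eqxx.
  by exists k.+1.
have [m0 hg] := @zero_multiplicity_root _ _ _ _ eg fg (eq_ind z (fun z => zero_multiplicity f z m) hm1 _ zm).
exists m.-1; split; first by rewrite zm.
rewrite -(card_eql SB).
set A := [set k : nat | (1 <= k)%N /\ mu k = z] in hm2.
have -> : S @` B = A `\ 1%N.
  apply/seteqP; split => [_ [k [k1 hk] <-] /=|[|[|k]] [[k1 hk] /= h]] //.
    by split => //; case: k k1 {hk}.
  by exists k.+1.
have /finite_setP[n hn] : finite_set (A `\ 1%N).
  apply: sub_finite_set (_ : finite_set A); first exact: subDsetl.
  by apply/finite_setP; exists m.
have hA : (A #= `I_n.+1)%card by apply/eq_cardSP; exists 1%N.
suff -> : m = n.+1 by [].
by apply/card_eq_II; rewrite -(card_eqr hA) card_eq_sym.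
Qed.

End EntireFunctions.

(** * Rouche's theorem *)

Section Rouche.
Variable R : realType.
Local Notation C := (Cplx R).
Implicit Types (p q : {poly C}) (a z w : C) (r e : R) (s t : seq C).

Definition rootprod s : {poly C} := \prod_(a <- s) ('X - a%:P).

Lemma rootprod_eq0 s z : ((rootprod s).[z] == 0) = (z \in s).
Proof. by rewrite -/(root _ _) root_prod_XsubC. Qed.

Lemma logderiv_rootprod s z : z \notin s ->
  (rootprod s)^`().[z] = (rootprod s).[z] * \sum_(a <- s) (z - a)^-1.
Proof.
elim: s => [|a s IH]; first by rewrite /rootprod !big_nil derivC horner0 mulr0.
rewrite inE negb_or => /andP[za zs]; rewrite /rootprod !big_cons -/(rootprod s).
rewrite derivM derivXsubC mul1r !hornerE IH // mulrDr -mulrA; congr (_ + _).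
  by rewrite mulrCA mulfV ?mulr1 // subr_eq0.
by rewrite mulrA.
Qed.

Lemma logderiv_scale c s z : (c *: rootprod s).[z] != 0 ->
  (c *: rootprod s)^`().[z] / (c *: rootprod s).[z] = \sum_(a <- s) (z - a)^-1.
Proof.
rewrite derivZ !hornerZ mulf_eq0 negb_or => /andP[c0 pz].
have zs : z \notin s by rewrite -rootprod_eq0.
by rewrite logderiv_rootprod // mulrA mulrC mulKf // mulf_neq0.
Qed.

(* Averaging z / (z - a) over the N-th roots of r^N replaces the contour integral:
   as N grows, 1 / (1 - (a/r)^N) tends to 1 inside the circle and to 0 outside. *)
Lemma circle_nodes (r : R) N : 0 < r -> (0 < N)%N -> exists Z : seq C,
  [/\ size Z = N, forall z, z \in Z -> cmod z = r &
   forall a, cmod a != r ->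
     N%:R^-1 * \sum_(z <- Z) z / (z - a) = (1 - (a / (r%:C)%C) ^+ N)^-1].
Proof.
move=> r0 N0; pose p : {poly C} := 'X^N - ((r%:C)%C ^+ N)%:P.
have [Z hZ] := closed_field_poly_normal p.
have pm : p \is monic by rewrite monicXnsubC.
move: hZ; rewrite (monicP pm) scale1r -/(rootprod Z) => hZ.
have rC0 : (r%:C)%C != 0 :> C by rewrite -cmod_eq0 cmodRC normr_eq0 gt_eqF.
have pE z : p.[z] = z ^+ N - (r%:C)%C ^+ N by rewrite !hornerE.
exists Z; split.
- by have := size_prod_XsubC Z id; rewrite -/(rootprod Z) -hZ size_XnsubC // => -[].
- move=> z; rewrite -rootprod_eq0 -hZ pE subr_eq0 => /eqP /(congr1 (@cmod R)).
  rewrite !cmodX cmodRC gtr0_norm // => /eqP.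
  by rewrite eqrXn2 ?cmod_ge0 ?ltW // => /eqP.
move=> a ar; have aZ : p.[a] != 0.
  rewrite pE subr_eq0; apply: contra ar => /eqP /(congr1 (@cmod R)).
  rewrite !cmodX cmodRC gtr0_norm // => /eqP.
  by rewrite eqrXn2 ?cmod_ge0 ?ltW.
have aZ' : a \notin Z by rewrite -rootprod_eq0 -hZ.
have NC : N%:R != 0 :> C by rewrite pnatr_eq0 -lt0n.
have sN : size Z = N.
  by have := size_prod_XsubC Z id; rewrite -/(rootprod Z) -hZ size_XnsubC // => -[].
(* Since [z / (z - a) = 1 - a / (a - z)], what remains is the logarithmic derivative of [X^N - r^N]
   at [a]. *)
have -> : \sum_(z <- Z) z / (z - a) = N%:R - a * \sum_(z <- Z) (a - z)^-1.
  rewrite mulr_sumr -sN -sum1_size natr_sum -sumrB.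
  rewrite big_seq [RHS]big_seq; apply: eq_bigr => z zZ.
  have za : z - a != 0 by rewrite subr_eq0; apply: contraNneq aZ' => <-.
  rewrite -(opprB z a) invrN; field.
  by rewrite za.
have := logderiv_rootprod aZ'; rewrite -hZ derivB derivXn derivC subr0 hornerMn.
rewrite hornerXn pE; set S := \sum_(_ <- _) _ => h.
have D0 : a ^+ N - (r%:C)%C ^+ N != 0 by rewrite -pE.
have -> : S = a ^+ N.-1 *+ N / (a ^+ N - (r%:C)%C ^+ N).
  by rewrite h mulrC mulKf.
have -> : a * (a ^+ N.-1 *+ N / (a ^+ N - (r%:C)%C ^+ N)) =
   N%:R * (a ^+ N / (a ^+ N - (r%:C)%C ^+ N)).
  have aN : a ^+ N = a * a ^+ N.-1 by rewrite -exprS prednK.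
  by rewrite aN in D0 *; rewrite -mulr_natl; field.
rewrite expr_div_n; have rN : (r%:C)%C ^+ N != 0 :> C by rewrite expf_neq0.
move: (a ^+ N) ((r%:C)%C ^+ N) D0 rN => u v uv v0.
field; rewrite NC v0 uv /=.
by rewrite -(opprB u v) oppr_eq0 uv.
Qed.

Lemma small_pow (x e : R) : 0 <= x -> x < 1 -> 0 < e ->
  exists N0, forall N, (N0 <= N)%N -> x ^+ N <= e.
Proof.
move=> x0 x1 e0; have := @cvg_expr R x.
rewrite ger0_norm // => /(_ x1) /cvgrPdist_le /(_ e e0) [N0 _ h].
exists N0 => N hN; have := h N hN; rewrite sub0r normrN ger0_norm //.
exact: exprn_ge0.
Qed.

Lemma term_lim (r : R) a e : 0 < r -> cmod a != r -> 0 < e -> exists N0, forall N,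
  (N0 <= N)%N -> cmod ((1 - (a / (r%:C)%C) ^+ N)^-1 - (nat_of_bool (cmod a < r)%R)%:R) <= e.
Proof.
move=> r0 ar e0; have rr : cmod ((r%:C)%C : C) = r by rewrite cmodRC gtr0_norm.
have [lt|ge] := ltrP (cmod a) r.
  have x1 : cmod (a / (r%:C)%C) < 1.
    by rewrite cmodM cmodV rr ltr_pdivrMr // mul1r.
  have m0 : 0 < Num.min (e / 2) (1 / 2) by rewrite lt_min !divr_gt0.
  have [N0 h] := small_pow (cmod_ge0 _) x1 m0; exists N0 => N /h.
  rewrite -cmodX le_min; set w := _ ^+ N => /andP[w1 w2].
  have d : 1 / 2 <= cmod (1 - w) by have := cmodB_ge 1 w; rewrite cmod1; lra.
  have d0 : 1 - w != 0 by rewrite -cmod_gt0; lra.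
  have -> : (1 - w)^-1 - true%:R = w / (1 - w) by rewrite /=; field.
  rewrite cmodM cmodV ler_pdivrMr ?cmod_gt0 //; nra.
have gt : r < cmod a by rewrite lt_def ar.
have a0 : a != 0 by rewrite -cmod_gt0 (lt_trans r0).
have x1 : cmod ((r%:C)%C / a) < 1.
  by rewrite cmodM cmodV rr ltr_pdivrMr ?cmod_gt0 // mul1r.
have m0 : 0 < Num.min (e / 2) (1 / 2) by rewrite lt_min !divr_gt0.
have [N0 h] := small_pow (cmod_ge0 _) x1 m0; exists N0 => N /h.
rewrite -cmodX le_min (_ : (a / (r%:C)%C) ^+ N = (((r%:C)%C / a) ^+ N)^-1); last first.
  by rewrite -exprVn invfM invrK mulrC.
set w := _ ^+ N => /andP[w1 w2].
have w0 : w != 0.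
  by rewrite expf_neq0 // mulf_neq0 ?invr_eq0 // -cmod_eq0 rr gt_eqF.
have d : 1 / 2 <= cmod (w - 1) by have := cmodB_ge 1 w; rewrite cmod1 cmodBC; lra.
have d0 : w - 1 != 0 by rewrite -cmod_gt0; lra.
have -> : (1 - w^-1)^-1 - false%:R = w / (w - 1) by rewrite /=; field; rewrite w0 d0.
rewrite cmodM cmodV ler_pdivrMr ?cmod_gt0 //; nra.
Qed.

Lemma sum_lim (r : R) s e : 0 < r -> (forall a, a \in s -> cmod a != r) -> 0 < e ->
  exists N0, forall N, (N0 <= N)%N ->
  cmod (\sum_(a <- s) (1 - (a / (r%:C)%C) ^+ N)^-1 -
        (count (fun a => (cmod a < r)%R) s)%:R) <= e.
Proof.
move=> r0; elim: s e => [|a s IH] e hs e0.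
  by exists 0%N => N _; rewrite big_nil /= subrr cmod0 ltW.
have e20 : 0 < e / 2 by rewrite divr_gt0.
have [N1 h1] := term_lim r0 (hs a (mem_head _ _)) e20.
have [|N2 h2] := IH _ _ e20; first by move=> b bs; apply: hs; rewrite inE bs orbT.
exists (maxn N1 N2) => N; rewrite geq_max => /andP[/h1 k1 /h2 k2].
rewrite big_cons /= natrD opprD addrACA.
by have := cmodD ((1 - (a / (r%:C)%C) ^+ N)^-1 - (nat_of_bool (cmod a < r)%R)%:R)
  (\sum_(a <- s) (1 - (a / (r%:C)%C) ^+ N)^-1 -
        (count (fun a => (cmod a < r)%R) s)%:R); lra.
Qed.

(** The averages of [z p'/p] and [z q'/q] over the nodes come within 1/8 of the two counts, and the
    hypothesis keeps them within 1/2 of each other. The two integers therefore differ by at most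
    3/4, hence coincide. The Wronskian form of the hypothesis avoids denominators. *)
Lemma count_close (r : R) c d s t : 0 < r ->
  let p := c *: rootprod s in let q := d *: rootprod t in
  (forall z, cmod z = r -> [/\ p.[z] != 0, q.[z] != 0 &
     cmod (z * (p^`().[z] * q.[z] - q^`().[z] * p.[z])) <=
       2^-1 * cmod (p.[z] * q.[z])]) ->
  count (fun a => cmod a < r) s = count (fun a => cmod a < r) t.
Proof.
move=> r0 p q h.
have sr a : a \in s -> cmod a != r.
  move=> as_; apply/eqP => /h [+ _ _]; rewrite /p hornerZ.
  by move: as_; rewrite -rootprod_eq0 => /eqP ->; rewrite mulr0 eqxx.
have tr a : a \in t -> cmod a != r.
  move=> as_; apply/eqP => /h [_ + _]; rewrite /q hornerZ.
  by move: as_; rewrite -rootprod_eq0 => /eqP ->; rewrite mulr0 eqxx.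
have e0 : 0 < 8^-1 :> R by rewrite invr_gt0.
have [N1 h1] := sum_lim r0 sr e0; have [N2 h2] := sum_lim r0 tr e0.
set N := (maxn N1 N2).+1.
have {}h1 := h1 N (leqW (leq_maxl _ _)); have {}h2 := h2 N (leqW (leq_maxr _ _)).
have [Z [sZ cZ avg]] := circle_nodes r0 (ltn0Sn (maxn N1 N2)).
have E u : (forall a, a \in u -> cmod a != r) ->
    \sum_(a <- u) (1 - (a / (r%:C)%C) ^+ N)^-1 =
    N%:R^-1 * \sum_(z <- Z) z * \sum_(a <- u) (z - a)^-1.
  move=> ur; have -> : \sum_(z <- Z) z * \sum_(a <- u) (z - a)^-1 =
            \sum_(z <- Z) \sum_(a <- u) z / (z - a).
    by apply: eq_bigr => z _; rewrite mulr_sumr.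
  rewrite exchange_big /= mulr_sumr big_seq [RHS]big_seq.
  by apply: eq_bigr => a /ur /avg ->.
have D : cmod (\sum_(a <- s) (1 - (a / (r%:C)%C) ^+ N)^-1 -
               \sum_(a <- t) (1 - (a / (r%:C)%C) ^+ N)^-1) <= 2^-1.
  rewrite !E // -mulrBr -sumrB cmodM cmodV cmodn mulrC ler_pdivrMr ?ltr0n //.
  apply: le_trans (cmod_sum _ _ _) _.
  apply: (@le_trans _ _ (\sum_(z <- Z) 2^-1)); last first.
    by rewrite big_const_seq count_predT sZ iter_addr_0 mulr_natr.
  rewrite big_seq [leRHS]big_seq; apply: ler_sum => z /cZ /h [pz qz].
  rewrite -(logderiv_scale pz) -(logderiv_scale qz) -/p -/q -mulrBr.
  have -> : p^`().[z] / p.[z] - q^`().[z] / q.[z] =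
    (p^`().[z] * q.[z] - q^`().[z] * p.[z]) / (p.[z] * q.[z]).
    by field; rewrite pz qz.
  rewrite (mulrA z) [cmod (_ / _)]cmodM cmodV ler_pdivrMr //.
  by rewrite cmod_gt0 mulf_neq0.
have : cmod ((count (fun a => (cmod a < r)%R) s)%:R - (count (fun a => (cmod a < r)%R) t)%:R : C) < 1.
  move: D h1 h2; set A := \sum_(a <- s) _; set B := \sum_(a <- t) _.
  set x := (count _ s)%:R; set y := (count _ t)%:R => D h1 h2.
  rewrite (_ : x - y = (A - B) - (A - x) + (B - y)); last by ring.
  have := cmodD (A - B - (A - x)) (B - y); have := cmodB (A - B) (A - x); lra.
have key (m n : nat) : cmod (m%:R - n%:R : C) < 1 -> (m <= n)%N.
  move=> hmn; rewrite leqNgt; apply/negP => nm; move: hmn.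
  by rewrite -natrB ?(ltnW nm) // cmodn -[1]/(1%:R) ltr_nat ltnS leqn0 subn_eq0 leqNgt nm.
move=> H; apply/eqP; rewrite eqn_leq !key // cmodBC //.
Qed.

Lemma wronskian_pencil p q x y z :
  (p + x *: q)^`().[z] * (p + y *: q).[z] - (p + y *: q)^`().[z] * (p + x *: q).[z] =
  (x - y) * (q^`() * p - p^`() * q).[z].
Proof. by rewrite !derivD !derivZ !hornerE; ring. Qed.

(* The pencil q + x (p - q) joins q to p; by [count_close] the number of roots in
   the disc does not change over sufficiently short steps in x. *)
Lemma rouche_poly (r m : R) c d s t : 0 < r -> 0 < m ->
  let p := c *: rootprod s in let q := d *: rootprod t in
  (forall z, cmod z = r -> m <= cmod q.[z] /\
     cmod (p.[z] - q.[z]) <= 2^-1 * cmod q.[z]) ->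
  count (fun a => cmod a < r) s = count (fun a => cmod a < r) t.
Proof.
move=> r0 m0 p q h.
pose dd := p - q; pose W := dd^`() * q - q^`() * dd.
pose B := r * pnorm r W; have B0 : 0 <= B by rewrite mulr_ge0 ?pnorm_ge0 ?ltW.
(* Neighbours in the pencil have Wronskian [W / (L + 1)], up to sign, and on the circle both have
   modulus at least [m / 2]. So [count_close] needs [B / (L + 1) <= (m / 2)^2 / 2 = m^2 / 8]. *)
have [L hL] : exists L : nat, 8 * B / m ^+ 2 <= L.+1%:R :> R.
  exists (Num.trunc (8 * B / m ^+ 2)).
  by rewrite ltW // truncnS_gt.
pose u j : {poly C} := q + (j%:R / L.+1%:R) *: dd.
have u0 : u 0%N = q by rewrite /u mul0r scale0r addr0.
have uL : u L.+1 = p by rewrite /u divff ?pnatr_eq0 // scale1r /dd addrC subrK.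
have ulow j z : (j <= L.+1)%N -> cmod z = r -> m / 2 <= cmod (u j).[z].
  move=> jL zr; have [h1 h2] := h z zr; rewrite /u hornerD [(_ *: dd).[z]]hornerZ.
  have jl : cmod (j%:R / L.+1%:R : C) <= 1.
    by rewrite cmodM cmodV !cmodn ler_pdivrMr ?ltr0n // mul1r ler_nat.
  have := cmodD_ge q.[z] (j%:R / L.+1%:R * dd.[z]); rewrite cmodM.
  rewrite /dd hornerD hornerN.
  have := cmod_ge0 (p.[z] - q.[z]).
  move=> y0 hD; have : cmod (j%:R / L.+1%:R : C) * cmod (p.[z] - q.[z]) <=
    cmod (p.[z] - q.[z]) by rewrite ler_piMl.
  lra.
(* Quantifying over every factorization of [u j] allows the intermediate polynomials to be factored
   inside the induction. *)
have main j : (j <= L.+1)%N -> forall c' s', u j = c' *: rootprod s' ->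
    count (fun a => cmod a < r) s' = count (fun a => cmod a < r) t.
  elim: j => [|j IH] jL c' s' hu.
    apply: (@count_close r c' d) => // z zr; rewrite -hu u0 -/q.
    have q0 : q.[z] != 0 by rewrite -cmod_gt0; have [] := h z zr; lra.
    by split => //; rewrite subrr mulr0 cmod0 mulr_ge0 ?cmod_ge0.
  have [s2 hs2] := closed_field_poly_normal (u j).
  rewrite -(IH (ltnW jL) _ _ hs2).
  apply: (@count_close r c' (lead_coef (u j))) => // z zr.
  rewrite -/(rootprod _) -hu -/(rootprod _) -hs2.
  have l1 := ulow j z (ltnW jL) zr; have l2 := ulow j.+1 z jL zr.
  split; try by rewrite -cmod_gt0; lra.
  have -> : z * ((u j.+1)^`().[z] * (u j).[z] - (u j)^`().[z] * (u j.+1).[z]) =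
     L.+1%:R^-1 * (z * W.[z]).
    rewrite /u wronskian_pencil /W (_ : j.+1%:R = j%:R + 1 :> C).
      by rewrite -mulrBl addrAC subrr add0r mul1r mulrCA.
    by rewrite -addn1 natrD.
  rewrite cmodM cmodV cmodn cmodM zr cmodM.
  have hW : r * cmod W.[z] <= B.
    by apply: ler_wpM2l; [exact: ltW|apply: horner_pnorm; rewrite zr].
  have L0 : 0 < L.+1%:R :> R by rewrite ltr0n.
  rewrite mulrC ler_pdivrMr // (le_trans hW) //.
  move: hL; rewrite ler_pdivrMr ?exprn_gt0 // => hL.
  have : m / 2 * (m / 2) <= cmod (u j.+1).[z] * cmod (u j).[z].
    by apply: ler_pM => //; lra.
  move: (_ * cmod (u j).[z]) => X hX.
  have : L.+1%:R * (m / 2 * (m / 2)) <= L.+1%:R * X by rewrite ler_wpM2l // ltW.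
  rewrite expr2 in hL; lra.
exact: (main L.+1 (leqnn _) c s uL).
Qed.

(** The minimum of [|g|] on the closed disc is attained. The disc is taken as a subset of [R * R],
    where compactness is that of a closed part of a square. *)
Lemma entire_zero_free (g : C -> C) r : 0 <= r -> entire g ->
  (forall z, cmod z <= r -> g z != 0) ->
  exists m, 0 < m /\ forall z, cmod z <= r -> m <= cmod (g z).
Proof.
move=> r0 eg gz.
pose F (x : R * R) : R := cmod (g (Complex x.1 x.2)).
pose A : set (R * R) := (`[- r, r] `*` `[- r, r]) `&`
  [set x | x.1 ^+ 2 + x.2 ^+ 2 <= r ^+ 2].
have cA : compact A.
  apply: compact_closedI.
    by apply: compact_setX; exact: segment_compact.
  apply: (@preimage_closed _ _ (fun x : R * R => x.1 ^+ 2 + x.2 ^+ 2)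
     [set y | y <= r ^+ 2]); last exact: closed_le.
  move=> x _; apply: cvgD; apply: cvgM; by [apply: cvg_fst|apply: cvg_snd].
have cF : continuous F.
  move=> [a b]; apply/cvgrPdist_le => e e0.
  have [d [d0 hd]] := entire_cont (Complex a b) eg e0.
  have d20 : 0 < d / 2 by rewrite divr_gt0.
  exists (ball a (d / 2), ball b (d / 2)) => /=.
    by split; apply: nbhsx_ballx.
  move=> [x y] [/= hx hy]; rewrite /F /=.
  move: hx hy; rewrite /ball /= => hx hy.
  have hxy : cmod (g (Complex x y) - g (Complex a b)) <= e.
    apply: hd; apply: le_trans (cmod_leD _) _; rewrite !ReImE /=.
    by rewrite distrC [`|y - b|]distrC; lra.
  have h1 := cmodB_ge (g (Complex x y)) (g (Complex a b)).
  have h2 := cmodB_ge (g (Complex a b)) (g (Complex x y)).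
  by rewrite cmodBC in h2; rewrite ler_norml; lra.
have A0 : A !=set0.
  exists (0, 0); split => /=; last by rewrite expr0n /= addr0 sqr_ge0.
  by split; rewrite /= in_itv /= oppr_le0 r0.
have [c cinA hc] := compact_EVT_min A0 cA (@continuous_subspaceT _ _ A _ cF).
have inA z : (cmod z <= r) -> A (complex.Re z, complex.Im z).
  move=> zr; split => /=.
    split; rewrite /= in_itv /= -ler_norml (le_trans _ zr) //.
      exact: normr_Re.
    exact: normr_Im.
  by rewrite -sqr_cmod lerXn2r ?nnegrE ?cmod_ge0.
exists (F c); split.
  rewrite /F cmod_gt0; apply: gz.
  move: cinA; rewrite inE => -[_ /= h].
  by rewrite -(@ler_pXn2r _ 2%N) ?nnegrE ?cmod_ge0 // sqr_cmod.
move=> z /inA h; have := hc _ (mem_set h).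
by rewrite /F /=; case: z {h}.
Qed.

Lemma rootprod_entire_bounded s r : exists B, 0 <= B /\
  forall z, cmod z <= r -> cmod (rootprod s).[z] <= B.
Proof.
exists (Num.max 0 (pnorm r (rootprod s))); split; first by rewrite le_max lexx.
by move=> z zr; rewrite le_max (horner_pnorm _ zr) orbT.
Qed.

(** The cofactors [g] and [h] are replaced by polynomials close to them on the disc, and the
    polynomial theorem is applied to the products. Since [h] has no zero in the disc, neither has
    its approximant, so the right-hand count is [size t]; the left-hand count is at least [size s],
    with equality when [g] has no zero either. *)
Lemma rouche_entire (r m : R) (f f0 g h : C -> C) s t : 0 < r -> 0 < m ->
  entire g -> entire h ->
  (forall z, f z = (rootprod s).[z] * g z) ->
  (forall z, f0 z = (rootprod t).[z] * h z) ->
  (forall a, a \in s -> cmod a < r) -> (forall a, a \in t -> cmod a < r) ->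
  (forall z, cmod z <= r -> h z != 0) ->
  (forall z, cmod z = r -> m <= cmod (f0 z) /\
      cmod (f z - f0 z) <= 3^-1 * cmod (f0 z)) ->
  (size s <= size t)%N /\
  ((forall z, cmod z <= r -> g z != 0) -> size s = size t).
Proof.
move=> r0 m0 eg eh fE f0E sr tr hz H.
have [mh [mh0 hmh]] := entire_zero_free (ltW r0) eh hz.
have [BP [BP0 hBP]] := rootprod_entire_bounded s r.
have [BQ [BQ0 hBQ]] := rootprod_entire_bounded t r.
have [pg [pgC pgl]] := eg; have [ph [phC phl]] := eh.
(* [e < mh] keeps the approximant of [h] free of zeros in the disc. The bound [m / 6] spends the
   difference between the 1/3 assumed here and the 1/2 allowed for polynomials. *)
have main e : 0 < e -> e < mh -> (BP + 2 * BQ) * e <= m / 6 ->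
   exists k (u : seq C) (c : C), [/\ forall z, cmod z <= r -> cmod (g z - (pg k).[z]) <= e,
     pg k = c *: rootprod u &
     (size s + count (fun a => (cmod a < r)%R) u)%N = size t].
  move=> e0 emh em.
  have [N1 h1] := entire_unif pgC pgl (ltW r0) e0.
  have [N2 h2] := entire_unif phC phl (ltW r0) e0.
  set k := maxn N1 N2.
  have {}h1 := h1 k (leq_maxl _ _); have {}h2 := h2 k (leq_maxr _ _).
  have [u hu] := closed_field_poly_normal (pg k).
  have [v hv] := closed_field_poly_normal (ph k).
  rewrite -/(rootprod _) in hu hv.
  exists k, u, (lead_coef (pg k)); split => //.
  have v0 : count (fun a => (cmod a < r)%R) v = 0%N.
    apply/eqP; rewrite -leqn0 leqNgt -has_count; apply/hasPn => a av.
    apply/negP => ar; have h3 := h2 _ (ltW ar).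
    have : (ph k).[a] = 0.
      by rewrite hv hornerZ; move: av; rewrite -rootprod_eq0 => /eqP ->; rewrite mulr0.
    move=> e1; move: h3; rewrite e1 subr0; have := hmh _ (ltW ar).
    by move=> a1 a2; have := le_lt_trans (le_trans a1 a2) emh; rewrite ltxx.
  have cs (w : seq C) : (forall a, a \in w -> cmod a < r) -> count (fun a => (cmod a < r)%R) w = size w.
    by move=> wr; apply/eqP; rewrite -all_count; apply/allP.
  rewrite -(cs s) // -count_cat -[RHS](cs t) // -[RHS]addn0 -v0 -count_cat.
  apply: (@rouche_poly r (m / 2) (lead_coef (pg k)) (lead_coef (ph k))) => //.
    by rewrite divr_gt0.
  move=> z zr; have zr' : cmod z <= r by rewrite zr.
  have EP : (lead_coef (pg k) *: rootprod (s ++ u)).[z] = (rootprod s).[z] * (pg k).[z].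
    by rewrite [in RHS]hu /rootprod big_cat /= !hornerZ hornerM; ring.
  have EQ : (lead_coef (ph k) *: rootprod (t ++ v)).[z] = (rootprod t).[z] * (ph k).[z].
    by rewrite [in RHS]hv /rootprod big_cat /= !hornerZ hornerM; ring.
  rewrite EP EQ; have [H1 H2] := H z zr.
  have k1 : cmod (f z - (rootprod s).[z] * (pg k).[z]) <= BP * e.
    by rewrite fE -mulrBr cmodM ler_pM ?cmod_ge0 ?hBP ?h1.
  have k2 : cmod (f0 z - (rootprod t).[z] * (ph k).[z]) <= BQ * e.
    by rewrite f0E -mulrBr cmodM ler_pM ?cmod_ge0 ?hBQ ?h2.
  move: k1 k2; set P := _ * (pg k).[z]; set Q := _ * (ph k).[z] => k1 k2.
  have k3 := cmodB_ge (f0 z) (f0 z - Q).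
  rewrite (_ : f0 z - (f0 z - Q) = Q) in k3; last by ring.
  have be1 : 0 <= BP * e by rewrite mulr_ge0 // ltW.
  have be2 : 0 <= BQ * e by rewrite mulr_ge0 // ltW.
  split; first by lra.
  rewrite (_ : P - Q = (f z - f0 z) - (f z - P) + (f0 z - Q)); last by ring.
  have := cmodD (f z - f0 z - (f z - P)) (f0 z - Q).
  have := cmodB (f z - f0 z) (f z - P); lra.
have D0 : 0 < BP + 2 * BQ + 1 by lra.
have me e' : 0 < e' -> exists e, [/\ 0 < e, e < mh, e <= e' & (BP + 2 * BQ) * e <= m / 6].
  move=> e'0; exists (Num.min (mh / 2) (Num.min e' (m / 6 / (BP + 2 * BQ + 1)))).
  split; rewrite ?lt_min ?gt_min ?ge_min ?lexx ?orbT ?e'0 ?divr_gt0 //=.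
  - by rewrite ltr_pdivrMr // ltr_pMr // ltr1n.
  - apply: (@le_trans _ _ ((BP + 2 * BQ) * (m / 6 / (BP + 2 * BQ + 1)))).
      by rewrite ler_wpM2l ?ge_min ?lexx ?orbT //; lra.
    rewrite mulrCA ler_piMr ?divr_ge0 ?ltW // ltr_pdivrMr //; lra.
split.
  have [e [e0 emh _ em]] := me 1 ltr01.
  by have [k [u [c [_ _ <-]]]] := main e e0 emh em; rewrite leq_addr.
move=> gz; have [mg [mg0 hmg]] := entire_zero_free (ltW r0) eg gz.
have mg20 : 0 < mg / 2 by rewrite divr_gt0.
have [e [e0 emh emg em]] := me _ mg20.
have [k [u [c [hk hu <-]]]] := main e e0 emh em.
suff -> : count (fun a => (cmod a < r)%R) u = 0%N by rewrite addn0.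
apply/eqP; rewrite -leqn0 leqNgt -has_count; apply/hasPn => a au.
apply/negP => ar; have := hk _ (ltW ar).
rewrite hu hornerZ; move: au; rewrite -rootprod_eq0 => /eqP ->; rewrite mulr0 subr0.
have := hmg _ (ltW ar); lra.
Qed.

Lemma enumerates_zeros_take (f : C -> C) mu n : entire f -> enumerates_zeros f mu ->
  exists g, [/\ entire g,
    forall z, f z = (rootprod [seq mu k.+1 | k <- iota 0 n]).[z] * g z &
    enumerates_zeros g (fun k => mu (k + n)%N)].
Proof.
move=> ef hf; elim: n => [|n [g [eg fg hg]]].
  exists f; split => //; first by move=> z; rewrite /rootprod big_nil hornerC mul1r.
  by rewrite (_ : (fun k => _) = mu) //; apply/funext => k; rewrite addn0.
have g0 := enumerates_zeros_root hg (leqnn 1).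
have [h [eh gh]] := entire_div (mu (1 + n)%N) eg.
have gh' z : g z = (z - mu (1 + n)%N) * h z by rewrite -gh g0 subr0.
exists h; split => //.
  move=> z; rewrite fg gh' -[in RHS]addn1 iotaD map_cat /rootprod big_cat big_seq1.
  by rewrite /= hornerM hornerXsubC add0n mulrA.
have := enumerates_zeros_div eh gh' hg.
by rewrite (_ : (fun k => mu (k.+1 + n)%N) = (fun k => mu (k + n.+1)%N)) //;
  apply/funext => k; rewrite addSnnS.
Qed.

Lemma enumerates_zeros_mono (f : C -> C) mu j k : enumerates_zeros f mu ->
  (1 <= j)%N -> (j <= k)%N -> cmod (mu j) <= cmod (mu k).
Proof.
move=> [h _] j1; elim: k => [|k IH]; first by case: j j1.
rewrite leq_eqVlt => /orP[/eqP <- //|]; rewrite ltnS => jk.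
by apply: le_trans (IH jk) (h _ _); apply: leq_trans jk.
Qed.

(** Were [mu (size t).+1] inside the circle, dividing out [(size t).+1] zeros would contradict the
    inequality of [rouche_entire]. Now let [n] be least with [mu n.+1] outside. After division by
    the first [n] zeros the remaining ones have modulus at least that of [mu n.+1], so the quotient
    has no zero in the disc, and the equality case gives [n = size t]. *)
Lemma enumerates_zeros_count (r m : R) (f f0 h : C -> C) mu t : 0 < r -> 0 < m ->
  entire f -> enumerates_zeros f mu -> entire h ->
  (forall z, f0 z = (rootprod t).[z] * h z) ->
  (forall a, a \in t -> cmod a < r) ->
  (forall z, cmod z <= r -> h z != 0) ->
  (forall z, cmod z = r -> m <= cmod (f0 z) /\
      cmod (f z - f0 z) <= 3^-1 * cmod (f0 z)) ->
  (forall k, (1 <= k)%N -> (k <= size t)%N -> cmod (mu k) < r) /\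
  (forall k, (size t < k)%N -> r < cmod (mu k)).
Proof.
move=> r0 m0 ef hf eh f0E tr hz H.
(* At a zero of [f] on the circle, [|f - f0|] would equal [|f0|], against the factor 1/3. *)
have ncirc k : (1 <= k)%N -> cmod (mu k) != r.
  move=> k1; apply/eqP => hk; have [h1 h2] := H _ hk.
  by move: h2; rewrite (enumerates_zeros_root hf k1) sub0r cmodN; lra.
pose s n := [seq mu k.+1 | k <- iota 0 n].
have ss n : size (s n) = n by rewrite size_map size_iota.
have sr n : (forall k, (1 <= k)%N -> (k <= n)%N -> cmod (mu k) < r) ->
    forall a, a \in s n -> cmod a < r.
  by move=> hn a /mapP[k]; rewrite mem_iota => /andP[_ kn] ->; apply: hn.
have up k : (size t < k)%N -> r < cmod (mu k).
  move=> tk; suff : r < cmod (mu (size t).+1).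
    by move/lt_le_trans; apply; apply: (enumerates_zeros_mono hf).
  rewrite lt_def ncirc //= leNgt; apply/negP => lt.
  have hn j : (1 <= j)%N -> (j <= (size t).+1)%N -> cmod (mu j) < r.
    by move=> j1 jt; apply: le_lt_trans lt; apply: (enumerates_zeros_mono hf).
  have [g [eg fg hg]] := enumerates_zeros_take (size t).+1 ef hf.
  have [+ _] := rouche_entire r0 m0 eg eh fg f0E (sr _ hn) tr hz H.
  by rewrite size_map size_iota ltnn.
split => // k k1 kt.
have [n [nt hn1 hn2]] : exists n, [/\ (n <= size t)%N,
    (forall k, (1 <= k)%N -> (k <= n)%N -> cmod (mu k) < r) &
    r < cmod (mu n.+1)].
  have exn : exists n, r < cmod (mu n.+1) by exists (size t); apply: up.
  case: (ex_minnP exn) => n hn hmin; exists n; split => //.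
    by apply: hmin; apply: up.
  move=> [//|j] _ jn; rewrite ltNge le_eqVlt eq_sym (negbTE (ncirc _ _)) //=.
  by apply/negP => /hmin; rewrite leqNgt jn.
have [g [eg fg hg]] := enumerates_zeros_take n ef hf.
have [_] := rouche_entire r0 m0 eg eh fg f0E (sr _ hn1) tr hz H.
rewrite size_map size_iota => nE; apply: hn1 => //; rewrite nE //.
move=> z zr; apply/eqP => gz.
have [j [j1 jz]] := enumerates_zeros_mem hg gz.
have : cmod (mu n.+1) <= cmod (mu (j + n)%N).
  by apply: enumerates_zeros_mono hf _ _ => //; rewrite -addn1 addnC leq_add2r.
rewrite jz => h1; have := lt_le_trans hn2 (le_trans h1 zr).
by rewrite ltxx.
Qed.

End Rouche.

(** * Integrals and convolution *)

Section Reflection.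
Variable R : realType.
Notation mu := (@lebesgue_measure R).
Notation GR := (measurableTypeR R).
Implicit Types (a t x : R) (g m : R -> R).

Definition reflect_at a : R -> measurableTypeR R := fun x => a - x.

Lemma measurable_reflect_at a : measurable_fun [set: R] (reflect_at a).
Proof. exact: measurable_funB. Qed.

HB.instance Definition _ a :=
  isMeasurableFun.Build _ _ _ _ (reflect_at a) (measurable_reflect_at a).

(** Lebesgue measure is determined by its values on half-open intervals, and the reflection turns
    []b, c]] into [[a - c, a - b[], of the same length. *)
Lemma lebesgue_measure_reflect a (A : set R) : measurable A ->
  pushforward mu (reflect_at a) A = mu A.
Proof.
move=> mA; apply/esym/lebesgue_measure_unique => //=.
  exact: measurable_reflect_at.
move=> _ _ [[b c]] _ <-.
rewrite /pushforward (_ : reflect_at a @^-1` _ = `[a - c, a - b[%classic); last first.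
  by apply/seteqP; split => x /=; rewrite !in_itv /= /reflect_at => /andP[? ?];
    apply/andP; split; lra.
rewrite !lebesgue_measure_itv /= !lte_fin.
have -> : (a - c < a - b) = (b < c) by apply/idP/idP; lra.
by case: ifP => // _; rewrite -!EFinB; congr EFin; lra.
Qed.

Local Open Scope ereal_scope.

Lemma integral_reflect a (g : R -> \bar R) : measurable_fun setT g ->
  (forall x, 0 <= g x) -> \int[mu]_x g (a - x)%R = \int[mu]_x g x.
Proof.
move=> mg g0.
transitivity (\int[pushforward mu (reflect_at a)]_x g x).
  by rewrite ge0_integral_pushforward //; exact: measurable_reflect_at.
apply: eq_measure_integral => //=; first exact: measurable_reflect_at.
by move=> _ A mA _; exact: lebesgue_measure_reflect.
Qed.

(** Extended-valued on purpose: for the modulus of the convolution kernel it may be infinite at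
    [t = pi]. By the reflection above it is also the convolution of [m] with 1, that is, the factor
    by which a bound of [u] is multiplied in the convolution term. *)
Definition causal (m : R -> R) t : \bar R :=
  \int[mu]_(s in `]0%R, t[) (m s)%:E.

Lemma integral_conv (m : R -> R) t : measurable_fun setT m ->
  (forall s, 0 <= m s)%R ->
  \int[mu]_(s in `]0%R, t[) (m (t - s)%R)%:E = causal m t.
Proof.
move=> mm m0; rewrite /causal integral_mkcond [RHS]integral_mkcond.
rewrite -(@integral_reflect t ((fun s => (m s)%:E) \_ `]0%R, t[)) //.
- apply: eq_integral => s _; rewrite !patchE.
  by congr (if _ then _ else _); apply/idP/idP; rewrite !inE /= !in_itv /=; lra.
- by apply/(measurable_restrictT _ _).1 => //; apply/measurable_EFinP; exact: measurable_funTS.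
- by move=> s; rewrite patchE; case: ifP => // _; rewrite lee_fin.
Qed.

Lemma causal_ge0 m t : (forall s, 0 <= m s)%R -> 0 <= causal m t.
Proof. by move=> m0; apply: integral_ge0 => s _; rewrite lee_fin. Qed.

Lemma causal_kernel_measurable m : measurable_fun setT m ->
  measurable_fun setT
    (fun x : GR * GR => ((m x.2) * \1_`]0%R, +oo[ x.2 * \1_`]0%R, +oo[ (x.1 - x.2)%R)%:E).
Proof.
move=> mm; apply/measurable_EFinP; apply: measurable_funM; [apply: measurable_funM|].
- exact: measurableT_comp.
- by apply: measurableT_comp => //; exact: measurable_indic.
- have mi : measurable_fun [set: R] (\1_(`]0%R, +oo[%classic : set R) : R -> R).
    exact: measurable_indic.
  apply: (measurableT_comp mi); exact: measurable_funB.
Qed.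

(** Encoding the domain by the conditions [s > 0] and [t - s > 0] exposes a jointly measurable
    kernel on the plane, to which Tonelli's theorem applies. *)
Lemma causalE m t : causal m t = \int[mu]_s
  ((m s) * \1_`]0%R, +oo[ s * \1_`]0%R, +oo[ (t - s)%R)%:E.
Proof.
rewrite /causal integral_mkcond; apply: eq_integral => s _; rewrite patchE.
rewrite !indicE; case: ifP => h.
  have : s \in `]0%R, +oo[%classic /\ (t - s)%R \in `]0%R, +oo[%classic.
    by move: h; rewrite !inE /= !in_itv /= !andbT => /andP[? ?]; split => //; lra.
  by move=> [-> ->]; rewrite !mulr1.
have : ~~ ((s \in `]0%R, +oo[%classic) && ((t - s)%R \in `]0%R, +oo[%classic)).
  apply/negP => /andP[]; move: h => /negP; rewrite !inE /= !in_itv /= !andbT => h.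
  by move=> h1 h2; apply: h; apply/andP; split => //; lra.
by rewrite negb_and => /orP[] /negbTE ->; rewrite ?mulr0 ?mul0r.
Qed.

Lemma measurable_causal m : measurable_fun setT m -> (forall s, 0 <= m s)%R ->
  measurable_fun setT (causal m).
Proof.
move=> mm m0; rewrite (_ : causal m = fubini_F mu
  (fun x : GR * GR => ((m x.2) * \1_`]0%R, +oo[ x.2 * \1_`]0%R, +oo[ (x.1 - x.2)%R)%:E)).
  apply: measurable_fun_fubini_tonelli_F; first exact: causal_kernel_measurable.
  by move=> x; rewrite lee_fin !mulr_ge0.
by apply/funext => t; rewrite causalE.
Qed.

(** Exchange of the order of integration: a given [s] is counted for [t] in []s, x[], whence the
    length [x - s] that will cancel the singular weight. *)
Lemma integral_causal m x : measurable_fun setT m -> (forall s, 0 <= m s)%R ->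
  (0 <= x)%R ->
  \int[mu]_(t in `]0%R, x[) causal m t =
  \int[mu]_(s in `]0%R, x[) (m s * (x - s))%:E.
Proof.
move=> mm m0 x0; rewrite integral_mkcond.
transitivity (\int[mu]_t \int[mu]_s
  ((m s) * \1_`]0%R, +oo[ s * \1_`]0%R, +oo[ (t - s)%R * \1_`]-oo, x[ t)%:E).
  apply: eq_integral => t _; rewrite patchE indicE; case: ifP => h.
    have -> : t \in `]-oo, x[%classic by move: h; rewrite !inE /= !in_itv /= => /andP[].
    by rewrite causalE; apply: eq_integral => s _; rewrite mulr1.
  apply/esym; apply: integral0_eq => s _ /=.
  have [tx|] := boolP (t \in `]-oo, x[%classic); last by rewrite mulr0.
  have t0 : (t <= 0)%R.
    move: h tx => /negP; rewrite !inE /= !in_itv /= => h tx.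
    by rewrite leNgt; apply/negP => t0; apply: h; rewrite t0.
  rewrite !indicE; have [s0|] := boolP (s \in `]0%R, +oo[%classic); last by rewrite mulr0 !mul0r.
  rewrite (_ : _ \in _ = false) ?mulr0 ?mul0r //.
  apply/negP; move: s0; rewrite !inE /= !in_itv /= !andbT; lra.
rewrite (fubini_tonelli (fun p : GR * GR =>
  ((m p.2) * \1_`]0%R, +oo[ p.2 * \1_`]0%R, +oo[ (p.1 - p.2)%R * \1_`]-oo, x[ p.1)%:E)); last first.
- by move=> p; rewrite lee_fin !mulr_ge0.
- apply/measurable_EFinP; apply: measurable_funM.
    by apply/measurable_EFinP; exact: causal_kernel_measurable.
  by apply: measurableT_comp => //; exact: measurable_indic.
rewrite [RHS]integral_mkcond; apply: eq_integral => s _; rewrite patchE /=.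
transitivity (\int[mu]_t ((m s * \1_`]0%R, +oo[ s)%:E * (\1_`]s, x[ t)%:E)).
  apply: eq_integral => t _; rewrite -EFinM -mulrA; congr (_ * _)%:E.
  rewrite !indicE -!natrM !mulnb; congr (nat_of_bool _)%:R.
  apply/idP/idP.
    move=> /andP[]; rewrite !inE /= !in_itv /= !andbT => h1 h2.
    by apply/andP; split; lra.
  rewrite !inE /= !in_itv /= => /andP[h2 h3].
  by apply/andP; split; rewrite inE /= in_itv /= ?andbT; lra.
have mi : measurable_fun setT (fun t => (\1_`]s, x[ t)%:E : \bar R).
  by apply/measurable_EFinP; exact: measurable_indic.
have i0 t : setT t -> 0 <= (\1_`]s, x[ t)%:E :> \bar R by rewrite lee_fin.
rewrite (ge0_integralZl_EFin mu measurableT i0 mi) ?mulr_ge0 //.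
have -> : \int[mu]_t (\1_`]s, x[ t)%:E = if (s < x)%R then (x - s)%:E else 0.
  rewrite integral_indic // setIT; have := @lebesgue_measure_itv R `]s, x[.
  by rewrite /= lte_fin => ->.
rewrite indicE.
have [s0|] := boolP (s \in `]0%R, +oo[%classic); last first.
  move=> s0; rewrite mulr0 mul0e (_ : _ \in _ = false) //.
  apply/negP; move: s0 => /negP; rewrite !inE /= !in_itv /= andbT => h /andP[h1 h2].
  exact: h.
rewrite mulr1; case: ltP => sx.
  rewrite (_ : s \in _ = true) ?EFinM ?EFinB //.
  by apply/mem_set; move: s0; rewrite !inE /= !in_itv /= andbT => ->.
rewrite mule0 (_ : _ \in _ = false) //.
by apply/negP; rewrite !inE /= !in_itv /= => /andP[_]; rewrite ltNge sx.
Qed.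

End Reflection.

(** * Integration by parts against an absolutely continuous function *)

Section RealIntegrals.
Variable R : realType.
Notation mu := (@lebesgue_measure R).
Implicit Types (f g h : R -> R) (a b x s t : R).

Lemma continuous_itv_bounded f a b : continuous f ->
  exists2 L, 0 <= L & forall t, a <= t <= b -> `|f t| <= L.
Proof.
move=> cf; case: (leP a b) => ab; last first.
  by exists 0 => // t /andP[h1 h2]; have := le_trans h1 h2; rewrite leNgt ab.
have cn : {within `[a, b], continuous (fun t => `|f t|)}.
  by apply: continuous_subspaceT => t; apply: cvg_norm; exact: cf.
have [c _ hc] := EVT_max ab cn.
by exists `|f c| => // t tab; apply: hc; rewrite in_itv.
Qed.

Lemma continuous_itv_integrable f (i : interval R) a b : continuous f ->
  [set` i] `<=` `[a, b] -> mu.-integrable [set` i] (EFin \o f).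
Proof.
move=> cf iab; have fi : mu.-integrable `[a, b] (EFin \o f).
  apply: continuous_compact_integrable; first exact: segment_compact.
  exact: continuous_subspaceT.
by apply: integrableS fi.
Qed.

Lemma Rintegral_FTC g dg a b : a <= b -> (forall t, is_derive t 1 g (dg t)) ->
  continuous dg -> \int[mu]_(t in `[a, b]) dg t = g b - g a.
Proof.
rewrite le_eqVlt => /predU1P[<- _ _|ab dgP cdg].
  by rewrite set_itv1 Rintegral_set1 subrr.
have cg : continuous g.
  by move=> t; apply/differentiable_continuous/derivable1_diffP; case: (dgP t).
rewrite /Rintegral (@continuous_FTC2 _ dg g a b ab) //.
- exact: continuous_subspaceT.
- split; [by move=> t _; case: (dgP t)| |].
    exact/cvg_at_right_filter/cg.
  exact/cvg_at_left_filter/cg.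
- by move=> t _; rewrite derive1E derive_val.
Qed.

(* Telescoping over finer and finer subdivisions: V is not assumed continuous. *)
Lemma const_of_increments (D V : R -> R) x c : 0 <= x ->
  (forall s t, 0 <= s -> s <= t -> t <= x ->
     `|D t - D s| <= c * (t - s) * (V t - V s)) -> D x = D 0.
Proof.
move=> x0 H.
have step n : `|D x - D 0| <= c * (V x - V 0) * x / n.+1%:R.
  pose u k : R := k%:R * x / n.+1%:R.
  have n0 : 0 < n.+1%:R :> R by rewrite ltr0n.
  have u0 : u 0%N = 0 by rewrite /u mul0r mul0r.
  have un : u n.+1 = x by rewrite /u mulrAC divff ?mul1r // gt_eqF.
  have uS k : u k.+1 - u k = x / n.+1%:R.
    by rewrite /u -mulrBl -mulrBl -natrB // subSnn mul1r.
  have umono k l : (k <= l)%N -> u k <= u l.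
    by move=> kl; rewrite /u ler_wpM2r ?invr_ge0 ?ler0n // ler_wpM2r // ler_nat.
  have : forall k, (k <= n.+1)%N ->
      `|D (u k) - D 0| <= c * (x / n.+1%:R) * (V (u k) - V 0).
    elim=> [|k IH] kn; first by rewrite u0 !subrr normr0 mulr0.
    have h := H (u k) (u k.+1); rewrite uS in h.
    have uk0 : 0 <= u k by rewrite -u0 umono.
    have ukx : u k.+1 <= x by rewrite -un umono.
    have {}h := h uk0 (umono _ _ (leqnSn k)) ukx.
    rewrite (_ : D _ - D 0 = (D (u k.+1) - D (u k)) + (D (u k) - D 0)); last by ring.
    rewrite (le_trans (ler_normD _ _)) //.
    have := lerD h (IH (ltnW kn)); rewrite -mulrDr addrA subrK; exact.
  move=> /(_ n.+1 (leqnn _)); rewrite un => /le_trans; apply.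
  rewrite le_eqVlt; apply/orP; left; apply/eqP.
  by move: (n.+1%:R^-1) (V x - V 0) => i v; ring.
apply/eqP; rewrite -subr_eq0 -normr_le0; apply/ler_addgt0Pl => e e0; rewrite addr0.
set K := c * (V x - V 0) * x in step.
have [n hn] : exists n : nat, K / e <= n.+1%:R.
  exists (Num.trunc (K / e)); exact/ltW/truncnS_gt.
apply: le_trans (step n) _; rewrite ler_pdivrMr ?ltr0n // mulrC.
by rewrite -ler_pdivrMr.
Qed.

Lemma Rintegral_incr f x s t : mu.-integrable `[0, x] (EFin \o f) ->
  0 <= s -> s <= t -> t <= x ->
  \int[mu]_(u in `[0, t]) f u - \int[mu]_(u in `[0, s]) f u =
  \int[mu]_(u in `]s, t]) f u.
Proof.
move=> fi s0 st tx; apply: Rintegral_itvB; rewrite ?bnd_simp //.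
by apply: integrableS fi => //; apply: subset_itvl; rewrite bnd_simp.
Qed.

Lemma integrable_primitive_cont h x : 0 <= x -> mu.-integrable `[0, x] (EFin \o h) ->
  {within `[0, x], continuous (fun t => \int[mu]_(u in `[0, t]) h u)}.
Proof. by move=> x0 hi; apply: parameterized_integral_continuous. Qed.

Lemma primitive_measurable h x : 0 <= x -> mu.-integrable `[0, x] (EFin \o h) ->
  measurable_fun `[0, x] (fun t => \int[mu]_(u in `[0, t]) h u).
Proof.
move=> x0 hi; apply: subspace_continuous_measurable_fun => //.
exact: integrable_primitive_cont.
Qed.

Lemma primitive_le h x t : 0 <= t -> t <= x -> mu.-integrable `[0, x] (EFin \o h) ->
  `|\int[mu]_(u in `[0, t]) h u| <= \int[mu]_(u in `[0, x]) `|h u|.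
Proof.
move=> t0 tx hi.
have hit : mu.-integrable `[0, t] (EFin \o h).
  by apply: integrableS hi => //; apply: subset_itvl; rewrite bnd_simp.
apply: le_trans (le_normr_Rintegral _ hit) _ => //.
have nh : mu.-integrable `[0, x] (EFin \o (fun u => `|h u|)) by exact: integrable_norm.
have := @Rintegral_incr (fun u => `|h u|) x t x nh t0 tx (lexx _).
move=> /eqP; rewrite subr_eq => /eqP ->; rewrite lerDr.
exact: Rintegral_ge0.
Qed.

Lemma integrable_bounded_mul f h (D : set R) L : measurable D ->
  measurable_fun D f -> (forall t, D t -> `|f t| <= L) ->
  mu.-integrable D (EFin \o h) -> mu.-integrable D (EFin \o (fun t => f t * h t)).
Proof.
move=> mD mf fL hi.
have -> : EFin \o (fun t => f t * h t) = ((EFin \o f) \* (EFin \o h))%E.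
  by apply/funext => t /=; rewrite EFinM.
apply: integrableMr => //; exists L; split; first exact: num_real.
by move=> M LM t Dt; apply: le_trans (fL _ Dt) (ltW LM).
Qed.

(** [H] is only a primitive of an integrable function, so the product cannot be differentiated
    pointwise. Instead, [g H] minus the indefinite integral of [dg H + g h] has increments over
    [[s, t]] bounded by [2 L (t - s)] times the integral of [|h|] there, which forces it to be
    constant. *)
Lemma Rintegration_by_parts_prim g dg h H H0 x : 0 <= x ->
  (forall t, is_derive t 1 g (dg t)) -> continuous dg ->
  mu.-integrable `[0, x] (EFin \o h) ->
  (forall t, 0 <= t <= x -> H t = H0 + \int[mu]_(u in `[0, t]) h u) ->
  mu.-integrable `[0, x] (EFin \o (fun t => dg t * H t + g t * h t)) /\
  \int[mu]_(t in `[0, x]) (dg t * H t + g t * h t) = g x * H x - g 0 * H 0.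
Proof.
move=> x0 dgP cdg hi HE.
have cg : continuous g.
  by move=> t; apply/differentiable_continuous/derivable1_diffP; case: (dgP t).
have mg : measurable_fun `[0, x] g.
  by apply: subspace_continuous_measurable_fun => //; exact: continuous_subspaceT.
have mdg : measurable_fun `[0, x] dg.
  by apply: subspace_continuous_measurable_fun => //; exact: continuous_subspaceT.
have [L L0 hL] := @continuous_itv_bounded dg 0 x cdg.
have [Lg Lg0 hLg] := @continuous_itv_bounded g 0 x cg.
have mH : measurable_fun `[0, x] H.
  apply: (@eq_measurable_fun _ _ _ _ _ (fun t => H0 + \int[mu]_(u in `[0, t]) h u)).
    by move=> t; rewrite inE /= in_itv /= => tx; rewrite HE.
  apply: measurable_funD; first exact: measurable_cst.
  exact: primitive_measurable.
pose N := \int[mu]_(u in `[0, x]) `|h u|.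
have bH t : 0 <= t <= x -> `|H t| <= `|H0| + N.
  move=> tx; rewrite HE //; apply: le_trans (ler_normD _ _) _; rewrite lerD2l.
  by case/andP: tx => t0 tx; exact: primitive_le.
have iH : mu.-integrable `[0, x] (EFin \o H).
  apply: measurable_bounded_integrable => //.
    by have := @lebesgue_measure_itv R `[0, x]; rewrite /= => ->; case: ifP => // _; rewrite -EFinB ltry.
  exists (`|H0| + N); split; first exact: num_real.
  move=> M NM t; rewrite /= in_itv /= => /bH /le_trans; apply; exact: ltW.
have i1 : mu.-integrable `[0, x] (EFin \o (fun t => dg t * H t)).
  by apply: integrable_bounded_mul iH => // t; rewrite /= in_itv; exact: hL.
have i2 : mu.-integrable `[0, x] (EFin \o (fun t => g t * h t)).
  by apply: integrable_bounded_mul hi => // t; rewrite /= in_itv; exact: hLg.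
have i12 : mu.-integrable `[0, x] (EFin \o (fun t => dg t * H t + g t * h t)).
  exact: integrableD i1 i2.
split => //.
pose D t := g t * H t - \int[mu]_(u in `[0, t]) (dg u * H u + g u * h u).
pose V t := \int[mu]_(u in `[0, t]) `|h u|.
suff : D x = D 0.
  rewrite /D set_itv1 Rintegral_set1 subr0 => <-; ring.
apply: (@const_of_increments D V x (2 * L)) => // s t s0 st tx.
have ihn : mu.-integrable `[0, x] (EFin \o (fun u => `|h u|)) by exact: integrable_norm.
have sub : `]s, t] `<=` `[0, x].
  by apply: subset_itv; rewrite bnd_simp.
have res f : mu.-integrable `[0, x] (EFin \o f) -> mu.-integrable `]s, t] (EFin \o f).
  by move=> fi; apply: integrableS fi.
have Vst : V t - V s = \int[mu]_(u in `]s, t]) `|h u| by exact: Rintegral_incr ihn _ _ _.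
have Hst : H t - H s = \int[mu]_(u in `]s, t]) h u.
  rewrite -(Rintegral_incr hi) // !HE; last 2 first.
  - by rewrite s0 (le_trans st).
  - by rewrite (le_trans s0 st).
  ring.
have icst c : mu.-integrable `]s, t] (EFin \o (fun=> c)).
  exact: (@continuous_itv_integrable _ `]s, t] s t (@cst_continuous _ _ c) (@subset_itv_oc_cc _ _ _ _)).
have idg : mu.-integrable `[0, x] (EFin \o dg).
  exact: (@continuous_itv_integrable _ _ 0 x cdg (@subset_refl _ _)).
have gst u : s <= u -> u <= t -> g t - g u = \int[mu]_(v in `]u, t]) dg v.
  move=> su ut; rewrite -(@Rintegral_FTC g dg u t) // Rintegral_itv_obnd_cbnd //.
  by apply: (@continuous_itv_integrable _ _ u t) => //; exact: subset_itv_oc_cc.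
have Lint u : s <= u -> u <= t -> \int[mu]_(v in `]u, t]) L = L * (t - u).
  move=> su ut; rewrite Rintegral_cst //; congr (_ * _).
  have := @lebesgue_measure_itv R `]u, t]; rewrite /= => ->; rewrite lte_fin.
  case: ltP => //= tu; apply/eqP; rewrite eq_sym subr_eq0.
  by rewrite eq_le tu ut.
have glip u : s <= u -> u <= t -> `|g t - g u| <= L * (t - u).
  move=> su ut; have sub' : `]u, t] `<=` `]s, t] by apply: subset_itvr; rewrite bnd_simp.
  have idg' : mu.-integrable `]u, t] (EFin \o dg).
    by apply: integrableS (res _ idg).
  rewrite gst // -(Lint u su ut); apply: le_trans (le_normr_Rintegral _ idg') _ => //.
  apply: le_Rintegral => //; first exact: integrable_norm.
    by apply: integrableS (icst L).
  move=> v; rewrite /= in_itv /= => /andP[uv vt]; apply: hL.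
  by rewrite (le_trans vt tx) andbT (le_trans s0) // (le_trans su) // ltW.
(* From [g t H t - g s H s = (g t - g s) H s + g t (H t - H s)]. Each of the two remainders is at
   most [L (t - s)] times the increment of [V]. *)
have split_eq : D t - D s = \int[mu]_(u in `]s, t]) (dg u * (H s - H u)) +
    \int[mu]_(u in `]s, t]) ((g t - g u) * h u).
  rewrite /D.
  have -> : \int[mu]_(u in `]s, t]) (dg u * (H s - H u)) =
      (g t - g s) * H s - \int[mu]_(u in `]s, t]) (dg u * H u).
    rewrite (gst s) // -RintegralZr //; last exact: res.
    rewrite -RintegralB //; last 2 first.
    - apply: (@integrable_bounded_mul dg (fun=> H s) _ L); rewrite //.
      + exact: measurable_funS mdg.
      + by move=> u /sub; rewrite /= in_itv; exact: hL.
    - exact: res.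
    by apply: eq_Rintegral => u _; ring.
  have -> : \int[mu]_(u in `]s, t]) ((g t - g u) * h u) =
      g t * (H t - H s) - \int[mu]_(u in `]s, t]) (g u * h u).
    rewrite Hst -RintegralZl //; last exact: res.
    rewrite -RintegralB //; last 2 first.
    - have := @integrableZl _ _ _ mu _ _ (g t) _ (res _ hi).
      by apply; exact: measurable_itv.
    - exact: res.
    by apply: eq_Rintegral => u _; ring.
  have := @Rintegral_incr _ x s t i12 s0 st tx.
  rewrite (RintegralD _ (res _ i1) (res _ i2)) //.
  move=> e; rewrite -(subrK (\int[mu]_(u in `[0, s]) (dg u * H u + g u * h u)) (\int[mu]_(u in `[0, t]) (dg u * H u + g u * h u))) e; ring.
have dV0 : 0 <= V t - V s by rewrite Vst; exact: Rintegral_ge0.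
have HsHu u : s <= u -> u <= t -> `|H s - H u| <= V t - V s.
  move=> su ut; have hiu : mu.-integrable `]s, u] (EFin \o h).
    by apply: integrableS (res _ hi) => //; apply: subset_itvl; rewrite bnd_simp.
  have -> : H s - H u = - \int[mu]_(u in `]s, u]) h u.
    rewrite -(Rintegral_incr hi s0 su) ?(le_trans ut tx) // !HE; first ring.
      by rewrite (le_trans s0 su) (le_trans ut tx).
    by rewrite s0 (le_trans st tx).
  rewrite normrN; apply: le_trans (le_normr_Rintegral _ hiu) _ => //.
  rewrite -(Rintegral_incr ihn s0 su) ?(le_trans ut tx) // lerD2r /V.
  have := @Rintegral_incr _ x u t ihn (le_trans s0 su) ut tx.
  move=> /eqP; rewrite subr_eq => /eqP ->; rewrite lerDr.
  exact: Rintegral_ge0.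
have imH : measurable_fun `]s, t] (fun u => H s - H u).
  apply: measurable_funB; first exact: measurable_cst.
  exact: measurable_funS mH.
have j1 : mu.-integrable `]s, t] (EFin \o (fun u => (H s - H u) * dg u)).
  apply: (@integrable_bounded_mul _ _ _ (V t - V s)) => //; last exact: res.
  by move=> u; rewrite /= in_itv /= => /andP[su ut]; rewrite HsHu // ltW.
have img : measurable_fun `]s, t] (fun u => g t - g u).
  apply: measurable_funB; first exact: measurable_cst.
  exact: measurable_funS mg.
have gb u : `]s, t]%classic u -> `|g t - g u| <= L * (t - s).
  rewrite /= in_itv /= => /andP[su ut]; apply: le_trans (glip _ (ltW su) ut) _.
  by rewrite ler_wpM2l // lerD2l lerN2 ltW.
have j2 : mu.-integrable `]s, t] (EFin \o (fun u => (g t - g u) * h u)).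
  by apply: (@integrable_bounded_mul _ _ _ (L * (t - s))) => //; exact: res.
have j1' : mu.-integrable `]s, t] (EFin \o (fun u => dg u * (H s - H u))).
  by apply: eq_integrable j1 => // u _ /=; rewrite mulrC.
rewrite split_eq; apply: le_trans (ler_normD _ _) _.
have b1 : `|\int[mu]_(u in `]s, t]) (dg u * (H s - H u))| <= L * (V t - V s) * (t - s).
  apply: le_trans (le_normr_Rintegral _ j1') _ => //.
  have -> : L * (V t - V s) * (t - s) = \int[mu]_(u in `]s, t]) (L * (V t - V s)).
    rewrite Rintegral_cst //; congr (_ * _).
    have := @lebesgue_measure_itv R `]s, t]; rewrite /= => ->; rewrite lte_fin.
    by case: ltP => //= ts; apply/eqP; rewrite subr_eq0 eq_le ts st.
  apply: le_Rintegral => //; first exact: integrable_norm.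
  move=> u ust; have := sub _ ust; rewrite /= in_itv /= => /hL h1.
  move: ust; rewrite /= in_itv /= => /andP[su ut].
  by rewrite normrM ler_pM // HsHu // ltW.
have b2 : `|\int[mu]_(u in `]s, t]) ((g t - g u) * h u)| <= L * (t - s) * (V t - V s).
  apply: le_trans (le_normr_Rintegral _ j2) _ => //.
  rewrite Vst -RintegralZl //; last exact: res.
  apply: le_Rintegral => //; first exact: integrable_norm.
    have := @integrableZl _ _ _ mu _ _ (L * (t - s)) _ (res _ ihn).
    by apply; exact: measurable_itv.
  by move=> u ust; rewrite normrM ler_wpM2r // gb.
have := lerD b1 b2; rewrite (_ : L * (V t - V s) * (t - s) + _ = 2 * L * (t - s) * (V t - V s)) //.
ring.
Qed.

End RealIntegrals.

(** * Integrals of complex-valued functions *)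

Section ComplexIntegrals.
Variable R : realType.
Notation mu := (@lebesgue_measure R).
Notation C := (Cplx R).
Notation gmeas D := (@measurable _ (measurableTypeR R) D).
Implicit Types (f g h : R -> C) (a b x s t : R) (D : set R).

Definition cmeas D f := measurable_fun D (fun x => complex.Re (f x)) /\
  measurable_fun D (fun x => complex.Im (f x)).

Lemma cmeasS D E f : gmeas E -> D `<=` E -> cmeas E f -> cmeas D f.
Proof. by move=> mE DE [m1 m2]; split; apply: measurable_funS _ DE _. Qed.

Lemma cmeasD D f g : cmeas D f -> cmeas D g -> cmeas D (fun x => f x + g x).
Proof.
move=> [f1 f2] [g1 g2]; split.
  under eq_fun do rewrite ReD; exact: measurable_funD.
by under eq_fun do rewrite ImD; exact: measurable_funD.
Qed.

Lemma cmeasM D f g : cmeas D f -> cmeas D g -> cmeas D (fun x => f x * g x).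
Proof.
move=> [f1 f2] [g1 g2]; split.
  under eq_fun do rewrite ReM; apply: measurable_funB; exact: measurable_funM.
by under eq_fun do rewrite ImM; apply: measurable_funD; exact: measurable_funM.
Qed.

Lemma cmeas_cst D (c : C) : cmeas D (fun=> c).
Proof. by split; exact: measurable_cst. Qed.

Lemma cmeas_cmod D f : cmeas D f -> measurable_fun D (fun x => cmod (f x)).
Proof.
move=> [f1 f2]; under eq_fun do rewrite cmod_def.
have ms : measurable_fun [set: R] (@Num.sqrt R).
  by apply: continuous_measurable_fun; exact: sqrt_continuous.
by apply: (measurableT_comp ms); apply: measurable_funD; apply: measurable_funX.
Qed.

Lemma cintegrable_cmeas D f : cintegrable D f -> cmeas D f.
Proof. by move=> [h1 h2]; split; apply/measurable_EFinP; [case/integrableP: h1|case/integrableP: h2]. Qed.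

Lemma cintegrable_le D f (g : R -> R) : gmeas D -> cmeas D f ->
  mu.-integrable D (EFin \o g) -> (forall x, D x -> cmod (f x) <= g x) ->
  cintegrable D f.
Proof.
move=> mD [f1 f2] gi fg; split; apply: le_integrable gi => //.
- exact/measurable_EFinP.
- move=> x Dx; rewrite /= lee_fin (le_trans (normr_Re _)) // (le_trans (fg _ Dx)) //.
  exact: ler_norm.
- exact/measurable_EFinP.
- move=> x Dx; rewrite /= lee_fin (le_trans (normr_Im _)) // (le_trans (fg _ Dx)) //.
  exact: ler_norm.
Qed.

Lemma cintegrable_cmod D f : gmeas D -> cintegrable D f ->
  mu.-integrable D (EFin \o (fun x => cmod (f x))).
Proof.
move=> mD fi; have fm := cintegrable_cmeas fi; have [f1 f2] := fi.
have gi : mu.-integrable D (EFin \o (fun x => `|complex.Re (f x)| + `|complex.Im (f x)|)).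
  have i1 : mu.-integrable D (EFin \o (fun x => `|complex.Re (f x)|)).
    exact: integrable_norm f1.
  have i2 : mu.-integrable D (EFin \o (fun x => `|complex.Im (f x)|)).
    exact: integrable_norm f2.
  exact: integrableD i1 i2.
apply: le_integrable gi => //.
  by apply/measurable_EFinP; exact: cmeas_cmod.
move=> x Dx; rewrite /= lee_fin (ger0_norm (cmod_ge0 _)) (le_trans (cmod_leD _)) //.
exact: ler_norm.
Qed.

Lemma cintegrableS D E f : gmeas D -> gmeas E -> D `<=` E ->
  cintegrable E f -> cintegrable D f.
Proof. by move=> mD mE DE [f1 f2]; split; [apply: integrableS f1|apply: integrableS f2]. Qed.

Lemma eq_cintegrable D f g : gmeas D -> (forall x, D x -> f x = g x) ->
  cintegrable D f -> cintegrable D g.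
Proof.
move=> mD fg [f1 f2]; split; [apply: eq_integrable f1|apply: eq_integrable f2] => //;
  by move=> x; rewrite inE => /fg ->.
Qed.

Lemma eq_cintegral D f g : (forall x, D x -> f x = g x) ->
  cintegral D f = cintegral D g.
Proof.
by move=> fg; rewrite /cintegral; congr Complex; apply: eq_Rintegral => x;
  rewrite inE => /fg ->.
Qed.

Lemma cintegrableD D f g : gmeas D -> cintegrable D f -> cintegrable D g ->
  cintegrable D (fun x => f x + g x).
Proof.
move=> mD fi gi.
apply: (@cintegrable_le D _ (fun x => cmod (f x) + cmod (g x))) => //.
- by apply: cmeasD; exact: cintegrable_cmeas.
- exact: integrableD (cintegrable_cmod mD fi) (cintegrable_cmod mD gi).
- by move=> x _; exact: cmodD.
Qed.

Lemma cintegrable_bounded_mul D f g (L : R) : gmeas D -> cmeas D g ->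
  (forall x, D x -> cmod (g x) <= L) -> cintegrable D f ->
  cintegrable D (fun x => g x * f x).
Proof.
move=> mD gm gL fi.
apply: (@cintegrable_le D _ (fun x => cmod (g x) * cmod (f x))) => //.
- by apply: cmeasM => //; exact: cintegrable_cmeas.
- apply: (@integrable_bounded_mul _ _ _ _ L) => //; first exact: cmeas_cmod.
    by move=> t Dt; rewrite ger0_norm ?cmod_ge0 // gL.
  exact: cintegrable_cmod.
- by move=> x _; rewrite cmodM.
Qed.

Lemma cintegrableZ D f (c : C) : gmeas D -> cintegrable D f ->
  cintegrable D (fun x => c * f x).
Proof.
move=> mD fi; apply: (@cintegrable_bounded_mul _ _ (fun=> c) (cmod c)) => //.
Qed.

Lemma cintegralD D f g : gmeas D -> cintegrable D f -> cintegrable D g ->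
  cintegral D (fun x => f x + g x) = cintegral D f + cintegral D g.
Proof.
move=> mD [f1 f2] [g1 g2]; apply: CplxP; rewrite ?ReD ?ImD /=.
  rewrite -(RintegralD mD f1 g1); apply: eq_Rintegral => x _; exact: ReD.
rewrite -(RintegralD mD f2 g2); apply: eq_Rintegral => x _; exact: ImD.
Qed.

Lemma cintegralZ D f (c : C) : gmeas D -> cintegrable D f ->
  cintegral D (fun x => c * f x) = c * cintegral D f.
Proof.
move=> mD [f1 f2].
have Zi (k : R) (h : R -> R) : mu.-integrable D (EFin \o h) ->
  mu.-integrable D (EFin \o (fun x => k * h x)).
  by move=> hi; have := @integrableZl _ _ _ mu D mD k _ hi.
apply: CplxP; rewrite ?ReM ?ImM /=.
  rewrite -(RintegralZl _ mD f1) -(RintegralZl _ mD f2) -RintegralB //; try exact: Zi.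
  by apply: eq_Rintegral => x _; rewrite ReM.
rewrite -(RintegralZl _ mD f1) -(RintegralZl _ mD f2) -RintegralD //; try exact: Zi.
by apply: eq_Rintegral => x _; rewrite ImM.
Qed.

Lemma cintegralB D f g : gmeas D -> cintegrable D f -> cintegrable D g ->
  cintegral D (fun x => f x - g x) = cintegral D f - cintegral D g.
Proof.
move=> mD fi gi; rewrite -(mulN1r (cintegral D g)) -cintegralZ // -cintegralD //.
  by apply: eq_cintegral => x _; rewrite mulN1r.
exact: cintegrableZ.
Qed.

Lemma cintegral_set1 a f : cintegral [set a] f = 0.
Proof. by rewrite /cintegral !Rintegral_set1. Qed.

Lemma unit_rotation (z : C) : z != 0 ->
  exists2 c : C, cmod c = 1 & complex.Re (c * z) = cmod z.
Proof.
move=> z0; have r0 : cmod z != 0 by rewrite cmod_eq0.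
exists ((complex.Re z / cmod z) +i* - (complex.Im z / cmod z))%C.
  apply/eqP; rewrite -(@eqrXn2 _ 2) ?cmod_ge0 // sqr_cmod /= sqrrN !expr_div_n.
  by rewrite -mulrDl -sqr_cmod expr1n divff // expf_neq0.
rewrite ReM /=; apply: (mulfI r0); rewrite -expr2 sqr_cmod; field.
exact: r0.
Qed.

(** Rotating the integral onto the positive real axis gives the constant 1. Estimating real and
    imaginary parts separately would lose a factor, and with it the threshold [1 / sqrt pi]. *)
Lemma cmod_cintegral_le D f : gmeas D -> cintegrable D f ->
  cmod (cintegral D f) <= \int[mu]_(x in D) cmod (f x).
Proof.
move=> mD fi; set I := cintegral D f.
have [->|I0] := eqVneq I 0.
  by rewrite cmod0; apply: Rintegral_ge0 => x _; exact: cmod_ge0.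
have [c c1 cI] := unit_rotation I0.
rewrite -cI -cintegralZ //= .
have cfi := cintegrableZ c mD fi.
apply: le_Rintegral => //; first by case: cfi.
  exact: cintegrable_cmod.
move=> x _; apply: le_trans (ler_norm _) _; apply: le_trans (normr_Re _) _.
by rewrite cmodM c1 mul1r.
Qed.

(** If the right-hand side is infinite there is nothing to show; otherwise [f] is integrable and the
    previous bound applies. *)
Lemma cmod_cintegral_le_ereal D f : gmeas D -> cmeas D f ->
  ((cmod (cintegral D f))%:E <= \int[mu]_(x in D) (cmod (f x))%:E)%E.
Proof.
move=> mD fm; have I0 : (0 <= \int[mu]_(x in D) (cmod (f x))%:E)%E.
  by apply: integral_ge0 => x _; rewrite lee_fin cmod_ge0.
have := leey (\int[mu]_(x in D) (cmod (f x))%:E)%E; rewrite le_eqVlt => /predU1P[->|fin].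
  exact: leey.
have fi : mu.-integrable D (EFin \o (fun x => cmod (f x))).
  apply/integrableP; split; first by apply/measurable_EFinP; exact: cmeas_cmod.
  have -> : (\int[mu]_(x in D) `|(EFin \o (fun x => cmod (f x))) x| =
     \int[mu]_(x in D) (cmod (f x))%:E)%E; last by [].
  by apply: eq_integral => x _ /=; rewrite ger0_norm ?cmod_ge0.
have cfi : cintegrable D f by apply: cintegrable_le fi _.
have := cmod_cintegral_le mD cfi; rewrite -lee_fin => /le_trans; apply.
by rewrite /Rintegral fineK // ge0_fin_numE.
Qed.

Definition cderiv g dg := forall t : R,
  is_derive t (1 : R) (fun x => complex.Re (g x)) (complex.Re (dg t)) /\
  is_derive t (1 : R) (fun x => complex.Im (g x)) (complex.Im (dg t)).

Definition ccont g := continuous (fun x : R => complex.Re (g x)) /\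
  continuous (fun x : R => complex.Im (g x)).

Lemma cderiv_ccont g dg : cderiv g dg -> ccont g.
Proof.
move=> H; split => t; apply/differentiable_continuous/derivable1_diffP.
  by have [[]] := H t.
by have [_ []] := H t.
Qed.

Lemma ccont_cmeas g D : gmeas D -> ccont g -> cmeas D g.
Proof.
by move=> mD [g1 g2]; split; apply: measurable_funS (continuous_measurable_fun _) => //.
Qed.

Lemma cFTC g dg a b : a <= b -> cderiv g dg -> ccont dg ->
  cintegral `[a, b] dg = g b - g a.
Proof.
move=> ab H [c1 c2]; apply: CplxP; rewrite ?ReD ?ImD ?ReN ?ImN /=.
  by apply: (@Rintegral_FTC _ (fun x => complex.Re (g x))) => // t; have [] := H t.
by apply: (@Rintegral_FTC _ (fun x => complex.Im (g x))) => // t; have [] := H t.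
Qed.

Lemma ccont_integrable g a b : ccont g -> cintegrable `[a, b] g.
Proof.
move=> [g1 g2]; split.
  exact: (@continuous_itv_integrable _ _ `[a, b] a b g1 (@subset_refl _ _)).
exact: (@continuous_itv_integrable _ _ `[a, b] a b g2 (@subset_refl _ _)).
Qed.

Lemma cintegration_by_parts_prim g dg h H (H0 : C) x : 0 <= x ->
  cderiv g dg -> ccont dg -> cintegrable `[0, x] h ->
  (forall t, 0 <= t <= x -> H t = H0 + cintegral `[0, t] h) ->
  cintegrable `[0, x] (fun t => dg t * H t + g t * h t) /\
  cintegral `[0, x] (fun t => dg t * H t + g t * h t) = g x * H x - g 0 * H 0.
Proof.
move=> x0 gd [cd1 cd2] [h1 h2] HE.
have HR t : 0 <= t <= x -> complex.Re (H t) =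
    complex.Re H0 + \int[mu]_(u in `[0, t]) complex.Re (h u).
  by move=> /HE ->; rewrite ReD.
have HI t : 0 <= t <= x -> complex.Im (H t) =
    complex.Im H0 + \int[mu]_(u in `[0, t]) complex.Im (h u).
  by move=> /HE ->; rewrite ImD.
have gR t : is_derive t (1 : R) (fun x => complex.Re (g x)) (complex.Re (dg t)) by have [] := gd t.
have gI t : is_derive t (1 : R) (fun x => complex.Im (g x)) (complex.Im (dg t)) by have [] := gd t.
have [i1 e1] := Rintegration_by_parts_prim x0 gR cd1 h1 HR.
have [i2 e2] := Rintegration_by_parts_prim x0 gI cd2 h2 HI.
have [i3 e3] := Rintegration_by_parts_prim x0 gR cd1 h2 HI.
have [i4 e4] := Rintegration_by_parts_prim x0 gI cd2 h1 HR.
have mx : gmeas (`[0, x]%classic : set R) by [].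
split; first split.
- apply: eq_integrable (integrableB mx i1 i2) => //= u _.
  by rewrite -EFinB; congr EFin; rewrite !ReImE; ring.
- apply: eq_integrable (integrableD mx i3 i4) => //= u _.
  by rewrite -EFinD; congr EFin; rewrite !ReImE; ring.
apply: CplxP; rewrite !ReImE /=.
  transitivity ((\int[mu]_(t in `[0, x]) (complex.Re (dg t) * complex.Re (H t) + complex.Re (g t) * complex.Re (h t))) - (\int[mu]_(t in `[0, x]) (complex.Im (dg t) * complex.Im (H t) + complex.Im (g t) * complex.Im (h t)))).
    by rewrite -RintegralB //; apply: eq_Rintegral => u _; rewrite !ReImE; ring.
  by rewrite e1 e2; ring.
transitivity ((\int[mu]_(t in `[0, x]) (complex.Re (dg t) * complex.Im (H t) + complex.Re (g t) * complex.Im (h t))) + (\int[mu]_(t in `[0, x]) (complex.Im (dg t) * complex.Re (H t) + complex.Im (g t) * complex.Re (h t)))).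
  by rewrite -RintegralD //; apply: eq_Rintegral => u _; rewrite !ReImE; ring.
by rewrite e3 e4; ring.
Qed.

Lemma cprimitive_regular F f (F0 : C) x : 0 <= x -> cintegrable `[0, x] f ->
  (forall t, 0 <= t <= x -> F t = F0 + cintegral `[0, t] f) ->
  [/\ cmeas `[0, x] F, exists2 B, 0 <= B & forall t, 0 <= t <= x -> cmod (F t) <= B &
      cintegrable `[0, x] F].
Proof.
move=> x0 fi FE; have [f1 f2] := fi.
have Fm : cmeas `[0, x] F.
  split.
    apply: (@eq_measurable_fun _ _ _ _ _ (fun t => complex.Re F0 + \int[mu]_(u in `[0, t]) complex.Re (f u))).
      by move=> t; rewrite inE /= in_itv /= => /FE ->; rewrite ReD.
    apply: measurable_funD; first exact: measurable_cst.
    exact: primitive_measurable.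
  apply: (@eq_measurable_fun _ _ _ _ _ (fun t => complex.Im F0 + \int[mu]_(u in `[0, t]) complex.Im (f u))).
    by move=> t; rewrite inE /= in_itv /= => /FE ->; rewrite ImD.
  apply: measurable_funD; first exact: measurable_cst.
  exact: primitive_measurable.
pose B := cmod F0 + (\int[mu]_(u in `[0, x]) `|complex.Re (f u)| + \int[mu]_(u in `[0, x]) `|complex.Im (f u)|).
have FB t : 0 <= t <= x -> cmod (F t) <= B.
  move=> tx; rewrite FE //; apply: le_trans (cmodD _ _) _; rewrite lerD2l.
  apply: le_trans (cmod_leD _) _; case/andP: tx => t0 tx.
  by apply: lerD; exact: primitive_le.
have B0 : 0 <= B.
  by apply: le_trans (FB 0 _); rewrite ?cmod_ge0 // lexx x0.
split => //; first by exists B.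
apply: (@cintegrable_le _ _ (fun=> B)) => //.
  exact: (@continuous_itv_integrable _ _ `[0, x] 0 x (@cst_continuous _ _ B) (@subset_refl _ _)).
Qed.

End ComplexIntegrals.

(** * A priori estimate of the solutions *)

Section MildSolutions.
Variable R : realType.
Notation mu := (@lebesgue_measure R).
Notation C := (Cplx R).
Notation gmeas D := (@measurable _ (measurableTypeR R) D).
Implicit Types (u v : R -> C) (A B V w b x t : R).

Lemma ae_imp (P Q : R -> Prop) : (forall x, P x -> Q x) ->
  {ae mu, forall x, P x} -> {ae mu, forall x, Q x}.
Proof. by move=> PQ; apply: negligibleS => x /= h px; apply: h; exact: PQ. Qed.

Lemma ae_imp2 (P1 P2 Q : R -> Prop) : (forall x, P1 x -> P2 x -> Q x) ->
  {ae mu, forall x, P1 x} -> {ae mu, forall x, P2 x} -> {ae mu, forall x, Q x}.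
Proof.
move=> PQ h1 h2; apply: negligibleS (negligibleU h1 h2) => x /= h.
have [p1|np1] := pselect (P1 x); last by left.
by right => p2; apply: h; exact: PQ.
Qed.

Section Conv.
Variables (M0 : R -> C).
Hypothesis mM0 : cmeas `]0, pi[ M0.
Hypothesis iM0 : (\int[mu]_(s in `]0%R, pi[) (cmod (M0 s))%:E < +oo)%E.

(** Modulus of the kernel [M], extended by 0 off []0, pi[] so that it is measurable on the whole
    line, as the lemmas on [causal] require. *)
Definition kabs : R -> R := (fun s => cmod (M0 s) / (pi - s)) \_ `]0, pi[.

Lemma measurable_weight : measurable_fun `]0, pi[ (fun s : R => (pi - s)^-1).
Proof.
apply: open_continuous_measurable_fun => //.
move=> s; rewrite inE /= in_itv /= => /andP[s0 spi].
apply: cvgV; first by rewrite subr_eq0 gt_eqF.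
by apply: cvgB; [exact: cvg_cst|exact: cvg_id].
Qed.

Lemma kabs_ge0 s : 0 <= kabs s.
Proof.
rewrite /kabs patchE; case: ifP => // h; rewrite divr_ge0 ?cmod_ge0 //.
by move: h; rewrite inE /= in_itv /= subr_ge0 => /andP[_ /ltW].
Qed.

Lemma measurable_kabs : measurable_fun setT kabs.
Proof.
apply/(measurable_restrictT _ _).1 => //.
by apply: measurable_funM; [exact: cmeas_cmod|exact: measurable_weight].
Qed.

Lemma kabsE s : 0 < s < pi -> kabs s = cmod (M0 s) / (pi - s).
Proof. by move=> h; rewrite /kabs patchE mem_set //= in_itv. Qed.

Lemma cmod_kernel_of s : 0 < s < pi -> cmod (kernel_of M0 s) = kabs s.
Proof.
move=> h; rewrite kabsE // /kernel_of cmodM cmodRC mulrC ger0_norm //.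
by rewrite invr_ge0 subr_ge0; case/andP: h => _ /ltW.
Qed.

(** On []0, t[] the weight is at most [1 / (pi - t)]. This breaks down at [t = pi], so pointwise
    bounds of the convolution are confined to [t < pi] and only their integral is taken up to
    [pi]. *)
Lemma causal_fin t : 0 <= t -> t < pi -> causal kabs t \is a fin_num.
Proof.
move=> t0 tpi; rewrite ge0_fin_numE; last by apply: causal_ge0 => s; exact: kabs_ge0.
have mM : measurable_fun `]0, pi[ (fun s => (cmod (M0 s))%:E : \bar R).
  by apply/measurable_EFinP; exact: cmeas_cmod.
have sub : (`]0, t[ : set R) `<=` (`]0, pi[ : set R).
  by apply: subset_itvl; rewrite bnd_simp ltW.
apply: (@le_lt_trans _ _ ((pi - t)^-1%:E * \int[mu]_(s in `]0%R, t[) (cmod (M0 s))%:E)%E).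
  rewrite -ge0_integralZl_EFin //; last 3 first.
  - by move=> s _; rewrite lee_fin cmod_ge0.
  - exact: measurable_funS mM.
  - by rewrite invr_ge0 subr_ge0 ltW.
  apply: ge0_le_integral => //.
  - by move=> s _; rewrite lee_fin kabs_ge0.
  - by apply/measurable_EFinP; apply: measurable_funTS; exact: measurable_kabs.
  - by apply: measurable_funeM; exact: measurable_funS mM.
  - move=> s /=; rewrite in_itv /= => /andP[s0 st].
    rewrite -EFinM lee_fin kabsE ?s0 ?(lt_trans st) // mulrC ler_wpM2r ?cmod_ge0 //.
    by rewrite lef_pV2 ?posrE ?subr_gt0 ?(lt_trans st) // lerD2l lerN2 ltW.
rewrite lte_mul_pinfty // ?lee_fin ?invr_ge0 ?subr_ge0 ?(ltW tpi) //.
apply: le_lt_trans iM0; apply: ge0_subset_integral => //.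
by move=> s _; rewrite lee_fin cmod_ge0.
Qed.

Lemma conv_integrand_cmeas u t : 0 < t < pi -> cmeas `]0, t[ u ->
  cmeas `]0, t[ (fun s => kernel_of M0 (t - s) * u s).
Proof.
move=> /andP[t0 tpi] mu_; apply: cmeasM => //.
have mk : cmeas `]0, pi[ (kernel_of M0).
  apply: cmeasM => //; split; first exact: measurable_weight.
  exact: measurable_cst.
have sub : (fun s : R => t - s) @` `]0, t[ `<=` `]0, pi[.
  move=> _ [s /= + <-]; rewrite !in_itv /= => /andP[s0 st]; apply/andP; split; lra.
have mr : measurable_fun `]0, t[ (fun s : R => t - s) by exact: measurable_funB.
case: mk => m1 m2; split.
  exact: (measurable_comp _ sub m1 mr).
exact: (measurable_comp _ sub m2 mr).
Qed.

Lemma conv_integrand_le u t B : 0 < t < pi ->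
  (forall s, 0 < s < t -> cmod (u s) <= B) ->
  forall s, 0 < s < t -> cmod (kernel_of M0 (t - s) * u s) <= B * kabs (t - s).
Proof.
move=> /andP[t0 tpi] uB s /andP[s0 st]; rewrite cmodM cmod_kernel_of; last first.
  by apply/andP; split; lra.
by rewrite mulrC ler_wpM2r ?kabs_ge0 // uB // s0.
Qed.

Lemma conv_integrable u t B : 0 < t < pi -> cmeas `]0, t[ u ->
  (forall s, 0 < s < t -> cmod (u s) <= B) ->
  cintegrable `]0, t[ (fun s => kernel_of M0 (t - s) * u s).
Proof.
move=> tpi um uB; have /andP[t0 tp] := tpi.
have mr : measurable_fun `]0, t[ (fun s => kabs (t - s)).
  apply: measurable_funTS; apply: (measurableT_comp measurable_kabs).
  exact: measurable_funB.
have ki : mu.-integrable `]0, t[ (EFin \o (fun s => kabs (t - s))).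
  apply/integrableP; split; first exact/measurable_EFinP.
  have -> : (\int[mu]_(x in `]0%R, t[) `|(EFin \o (fun s => kabs (t - s))) x| = causal kabs t)%E.
    rewrite -integral_conv; [|exact: measurable_kabs|exact: kabs_ge0].
    by apply: eq_integral => s _ /=; rewrite ger0_norm ?kabs_ge0.
  by rewrite ltey_eq causal_fin // ltW.
apply: (@cintegrable_le _ _ _ (fun s => B * kabs (t - s))) => //.
- exact: conv_integrand_cmeas.
- have := @integrableZl _ _ _ mu _ _ B _ ki; apply; exact: measurable_itv.
- by move=> s; rewrite /= in_itv /=; exact: conv_integrand_le.
Qed.

Definition conv u t : C := cintegral `]0, t[ (fun s => kernel_of M0 (t - s) * u s).

Lemma cmod_conv_le u t B : 0 < t < pi -> cmeas `]0, t[ u ->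
  (forall s, 0 < s < t -> cmod (u s) <= B) -> 0 <= B ->
  cmod (conv u t) <= B * fine (causal kabs t).
Proof.
move=> tpi um uB B0; have /andP[t0 tp] := tpi.
have mr : measurable_fun `]0, t[ (fun s => (kabs (t - s))%:E : \bar R).
  apply/measurable_EFinP; apply: measurable_funTS.
  apply: (measurableT_comp measurable_kabs); exact: measurable_funB.
rewrite -lee_fin EFinM fineK ?causal_fin ?(ltW t0) //.
rewrite -integral_conv; [|exact: measurable_kabs|exact: kabs_ge0].
apply: le_trans (cmod_cintegral_le_ereal _ (conv_integrand_cmeas tpi um)) _ => //.
rewrite -ge0_integralZl_EFin //; last by move=> s _; rewrite lee_fin kabs_ge0.
apply: ge0_le_integral => //.
- by move=> s _; rewrite lee_fin cmod_ge0.
- by apply/measurable_EFinP; apply: cmeas_cmod; exact: conv_integrand_cmeas.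
- exact: measurable_funeM.
- by move=> s; rewrite /= in_itv /= => st; rewrite -EFinM lee_fin conv_integrand_le.
Qed.

Lemma convZD u1 u2 (a : C) t B1 B2 : 0 < t < pi ->
  cmeas `]0, t[ u1 -> cmeas `]0, t[ u2 ->
  (forall s, 0 < s < t -> cmod (u1 s) <= B1) ->
  (forall s, 0 < s < t -> cmod (u2 s) <= B2) ->
  conv (fun s => a * (u1 s - u2 s)) t = a * (conv u1 t - conv u2 t).
Proof.
move=> tpi m1 m2 b1 b2.
have i1 := conv_integrable tpi m1 b1; have i2 := conv_integrable tpi m2 b2.
rewrite /conv -cintegralB // -cintegralZ //; last first.
  have i3 : cintegrable `]0, t[ (fun s => (-1) * (kernel_of M0 (t - s) * u2 s)).
    exact: cintegrableZ.
  apply: eq_cintegrable (cintegrableD _ i1 i3) => // s _; ring.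
by apply: eq_cintegral => s _; ring.
Qed.

End Conv.

(* The sine equation at z = rho^2 with a source v on the right-hand side and
   initial values u(0) = 0, u'(0) = c0. *)
Definition fsol (q M0 : R -> C) (z : C) v (c0 : C) u du := exists ddu : R -> C,
  [/\ cintegrable `[0, pi] ddu,
      forall x, 0 <= x <= pi -> u x = cintegral `[0, x] du,
      forall x, 0 <= x <= pi -> du x = c0 + cintegral `[0, x] ddu &
      {ae mu, forall x, 0 < x < pi ->
         - ddu x + q x * u x + conv M0 u x = z * u x + v x}].

Lemma sine_solution_fsol (q M0 : R -> C) rho y dy : sine_solution q M0 rho y dy ->
  fsol q M0 (rho ^+ 2) (fun=> 0) 1 y dy.
Proof.
move=> [ddy [h1 h2 h3 h4]]; exists ddy; split => //.
by apply: ae_imp h4 => x h xpi; rewrite addr0 -h.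
Qed.

Lemma fsol_regular q M0 z v c0 u du : fsol q M0 z v c0 u du ->
  [/\ cmeas `[0, pi] u, cmeas `[0, pi] du, cintegrable `[0, pi] du &
      exists2 B, 0 <= B & forall t, 0 <= t <= pi -> cmod (u t) <= B].
Proof.
move=> [ddu [h1 h2 h3 _]].
have [m1 _ i1] := cprimitive_regular (pi_ge0 R) h1 h3.
have h2' t : 0 <= t <= pi -> u t = 0 + cintegral `[0, t] du.
  by move=> /h2 ->; rewrite add0r.
by have [m2 b2 i2] := cprimitive_regular (pi_ge0 R) i1 h2'.
Qed.

(** Since [z1 u1 - z2 u2 = z1 (u1 - u2) + (z1 - z2) u2], a change of the parameter becomes a source
    term. With [a = (z1 - z2)^-1] this is the equation of the divided difference. *)
Lemma fsolZB (q M0 : R -> C) z1 z2 v1 v2 c1 c2 u1 u2 du1 du2 (a : C) :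
  cmeas `]0, pi[ M0 -> (\int[mu]_(s in `]0%R, pi[) (cmod (M0 s))%:E < +oo)%E ->
  fsol q M0 z1 v1 c1 u1 du1 -> fsol q M0 z2 v2 c2 u2 du2 ->
  fsol q M0 z1 (fun x => a * (v1 x - v2 x + (z1 - z2) * u2 x)) (a * (c1 - c2))
    (fun x => a * (u1 x - u2 x)) (fun x => a * (du1 x - du2 x)).
Proof.
move=> mM iM s1 s2.
have [mu1 mdu1 idu1 [B1 B10 b1]] := fsol_regular s1.
have [mu2 mdu2 idu2 [B2 B20 b2]] := fsol_regular s2.
case: s1 => dd1 [i1 h1 k1 e1]; case: s2 => dd2 [i2 h2 k2 e2].
have lin (f1 f2 : R -> C) x : 0 <= x <= pi -> cintegrable `[0, pi] f1 ->
  cintegrable `[0, pi] f2 -> a * (cintegral `[0, x] f1 - cintegral `[0, x] f2) =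
  cintegral `[0, x] (fun x => a * (f1 x - f2 x)).
  move=> /andP[x0 xpi] j1 j2.
  have sub : (`[0, x] : set R) `<=` `[0, pi] by apply: subset_itvl; rewrite bnd_simp.
  have {}j1 : cintegrable `[0, x] f1 by apply: cintegrableS j1.
  have {}j2 : cintegrable `[0, x] f2 by apply: cintegrableS j2.
  rewrite -cintegralB // -cintegralZ //.
  have j3 : cintegrable `[0, x] (fun s => (-1) * f2 s) by exact: cintegrableZ.
  by apply: eq_cintegrable (cintegrableD _ j1 j3) => // s _; rewrite mulN1r.
exists (fun x => a * (dd1 x - dd2 x)); split.
- apply: cintegrableZ => //.
  have j3 : cintegrable `[0, pi] (fun s => (-1) * dd2 s) by exact: cintegrableZ.
  by apply: eq_cintegrable (cintegrableD _ i1 j3) => // s _; rewrite mulN1r.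
- by move=> x xpi; rewrite h1 // h2 // lin.
- by move=> x xpi; rewrite k1 // k2 // -lin //; ring.
have sub t : 0 < t < pi -> (`]0, t[ : set R) `<=` `[0, pi].
  move=> /andP[_ tpi] x /=; rewrite !in_itv /= => /andP[x0 xt].
  by rewrite ltW //= ltW // (lt_trans xt).
have sub' t s : 0 < t < pi -> 0 < s < t -> 0 <= s <= pi.
  by move=> /andP[_ tpi] /andP[x0 xt]; rewrite ltW //= ltW // (lt_trans xt).
apply: ae_imp2 e1 e2 => x E1 E2 xpi; have {}E1 := E1 xpi; have {}E2 := E2 xpi.
rewrite (@convZD M0 mM iM u1 u2 a x B1 B2) //; last 4 first.
- by apply: cmeasS mu1 => //; exact: sub.
- by apply: cmeasS mu2 => //; exact: sub.
- by move=> s /(sub' _ _ xpi); exact: b1.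
- by move=> s /(sub' _ _ xpi); exact: b2.
transitivity (a * ((- dd1 x + q x * u1 x + conv M0 u1 x) - (- dd2 x + q x * u2 x + conv M0 u2 x))).
  ring.
by rewrite E1 E2; ring.
Qed.

End MildSolutions.

(** * Fundamental pairs and variation of constants *)

Section Kernels.
Variable R : realType.
Notation C := (Cplx R).
Implicit Types (s c g dg : R -> C).

(* A fundamental pair of s'' = - r2 s, with r2 not necessarily the spectral
   parameter z: the difference (r2 - z) u is treated as part of the forcing. *)
Definition kpair (r2 : C) s c (b w : R) := [/\ cderiv s c,
  cderiv c (fun x => - r2 * s x), s 0 = 0, c 0 = 1 &
  forall x, 0 <= x <= pi ->
    cmod (s x) <= b * expR (w * x) /\ cmod (c x) <= expR (w * x)].

Lemma cderivZ (a : C) g dg : cderiv g dg ->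
  cderiv (fun t => a * g t) (fun t => a * dg t).
Proof.
move=> H t; have [h1 h2] := H t; split.
  under eq_fun do rewrite ReM; rewrite ReM.
  exact: (is_deriveB (is_deriveZ (complex.Re a) h1) (is_deriveZ (complex.Im a) h2)).
under eq_fun do rewrite ImM; rewrite ImM.
exact: (is_deriveD (is_deriveZ (complex.Re a) h2) (is_deriveZ (complex.Im a) h1)).
Qed.

Lemma is_derive_reflect (f : R -> R) (x t d : R) : is_derive (x - t) 1 f d ->
  is_derive t 1 (fun t => f (x - t)) (- d).
Proof.
move=> fd; have gd : is_derive t (1 : R) (fun t : R => x - t) (- 1).
  have -> : (- 1 : R) = 0 - 1 by rewrite sub0r.
  apply: is_deriveB.
have := @is_derive1_comp _ f (fun t => x - t) t d (- 1) fd gd.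
by rewrite mulrN1.
Qed.

Lemma cderiv_reflect g dg x : cderiv g dg ->
  cderiv (fun t => g (x - t)) (fun t => (-1) * dg (x - t)).
Proof.
move=> H t; have [h1 h2] := H (x - t); split; rewrite mulN1r ?ReN ?ImN.
  exact: is_derive_reflect.
exact: is_derive_reflect.
Qed.

End Kernels.

Section Step.
Variable R : realType.
Notation mu := (@lebesgue_measure R).
Notation C := (Cplx R).
Implicit Types (u v du : R -> C) (A B V w b x t : R).
Variables (q M0 : R -> C) (K : R).
Hypothesis mq : cmeas `]0, pi[ q.
Hypothesis mM0 : cmeas `]0, pi[ M0.
Hypothesis hK : (\int[mu]_(s in `]0%R, pi[) (cmod (q s))%:E +
   \int[mu]_(s in `]0%R, pi[) (cmod (M0 s))%:E <= K%:E)%E.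

Let iq0 : (0 <= \int[mu]_(s in `]0%R, pi[) (cmod (q s))%:E)%E.
Proof. by apply: integral_ge0 => s _; rewrite lee_fin cmod_ge0. Qed.
Let iM00 : (0 <= \int[mu]_(s in `]0%R, pi[) (cmod (M0 s))%:E)%E.
Proof. by apply: integral_ge0 => s _; rewrite lee_fin cmod_ge0. Qed.

Lemma kernel_L1_fin : (\int[mu]_(s in `]0%R, pi[) (cmod (M0 s))%:E < +oo)%E.
Proof.
apply: (@le_lt_trans _ _ K%:E); last exact: ltry.
by apply: le_trans hK; rewrite leeDr.
Qed.

Lemma K_ge0 : 0 <= K.
Proof. by rewrite -lee_fin; apply: le_trans hK; exact: adde_ge0. Qed.

Lemma forcing_integral_le x : 0 <= x -> x <= pi ->
  (\int[mu]_(t in `]0%R, x[) ((cmod (q t))%:E + causal (kabs M0) t) <= K%:E)%E.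
Proof.
move=> x0 xpi.
have mk := measurable_kabs mM0; have k0 := @kabs_ge0 _ M0.
have sub : (`]0, x[ : set R) `<=` `]0, pi[ by apply: subset_itvl; rewrite bnd_simp.
have mqE : measurable_fun `]0, pi[ (fun s => (cmod (q s))%:E : \bar R).
  by apply/measurable_EFinP; exact: cmeas_cmod.
have mME : measurable_fun `]0, pi[ (fun s => (cmod (M0 s))%:E : \bar R).
  by apply/measurable_EFinP; exact: cmeas_cmod.
have mqx : measurable_fun `]0, x[ (fun s => (cmod (q s))%:E : \bar R).
  exact: measurable_funS mqE.
have mMx : measurable_fun `]0, x[ (fun s => (cmod (M0 s))%:E : \bar R).
  exact: measurable_funS mME.
rewrite ge0_integralD //; last 3 first.
- by move=> t _; rewrite lee_fin cmod_ge0.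
- by move=> t _; exact: causal_ge0.
- by apply: measurable_funTS; exact: measurable_causal.
apply: le_trans hK; apply: leeD.
  apply: ge0_subset_integral => //.
  by move=> s _; rewrite lee_fin cmod_ge0.
rewrite integral_causal //.
apply: (@le_trans _ _ (\int[mu]_(s in `]0%R, x[) (cmod (M0 s))%:E)%E); last first.
  apply: ge0_subset_integral => //.
  by move=> s _; rewrite lee_fin cmod_ge0.
apply: ge0_le_integral => //.
- move=> s /=; rewrite in_itv /= => /andP[s0 sx].
  by rewrite lee_fin mulr_ge0 // subr_ge0 ltW.
- apply/measurable_EFinP; apply: measurable_funM; first exact: measurable_funTS.
  exact: measurable_funB.
- move=> s /=; rewrite in_itv /= => /andP[s0 sx].
  have spi : s < pi by rewrite (lt_le_trans sx).
  rewrite lee_fin kabsE ?s0 // -mulrA ler_piMr ?cmod_ge0 //.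
  by rewrite mulrC ler_pdivrMr ?subr_gt0 // mul1r lerD2r.
Qed.

(** By the equation, [ddu + r2 u = q u + M * u + (r2 - z) u - v] almost everywhere. The growth
    [exp (w (x - t))] of [g] and [exp (w t)] of [u] and [v] multiply to [exp (w x)], which leaves
    the integral; for the convolution, [exp (w s) <= exp (w t)] when [s < t]. What remains is [A K]
    by [forcing_integral_le] and a constant times the length of the interval. *)
Lemma forcing_bound (z r2 : C) v u ddu (g : R -> C) A V w be x :
  cintegrable `[0, pi] ddu -> cmeas `[0, pi] u ->
  {ae mu, forall x, 0 < x < pi ->
     - ddu x + q x * u x + conv M0 u x = z * u x + v x} ->
  0 <= x <= pi -> cmeas `[0, x] g -> 0 <= A -> 0 <= V -> 0 <= w -> 0 <= be ->
  (forall t, 0 <= t <= x -> cmod (g t) <= be * expR (w * (x - t))) ->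
  (forall t, 0 <= t <= pi -> cmod (u t) <= A * expR (w * t)) ->
  (forall t, 0 <= t <= pi -> cmod (v t) <= V * expR (w * t)) ->
  cmod (cintegral `[0, x] (fun t => g t * (ddu t + r2 * u t))) <=
    be * expR (w * x) * (A * K + (cmod (r2 - z) * A + V) * pi).
Proof.
move=> iddu um eqn /andP[x0 xpi] gm A0 V0 w0 be0 gb ub vb.
have sub : (`[0, x] : set R) `<=` `[0, pi] by apply: subset_itvl; rewrite bnd_simp.
have subo : (`]0, x[ : set R) `<=` `[0, x] by exact: subset_itv_oo_cc.
have k0 := @kabs_ge0 _ M0.
set F := fun t => _.
have Fm : cmeas `[0, x] F.
  apply: cmeasM => //; apply: cmeasD.
    by apply: cmeasS (cintegrable_cmeas iddu).
  apply: cmeasM; first exact: cmeas_cst.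
  by apply: cmeasS um.
rewrite -lee_fin; apply: le_trans (cmod_cintegral_le_ereal _ Fm) _ => //.
have mFo : measurable_fun `]0, x[ (fun t => (cmod (F t))%:E : \bar R).
  by apply/measurable_EFinP; apply: cmeas_cmod; apply: cmeasS Fm.
(* Dropping the end points keeps [t < pi], where [causal] is finite. *)
rewrite integral_itv_bndoo //.
pose ze := cmod (r2 - z).
have ze0 : 0 <= ze := cmod_ge0 _.
pose P t : \bar R := (A%:E * ((cmod (q t))%:E + causal (kabs M0) t) + (ze * A + V)%:E)%E.
have c0 t : (0 <= causal (kabs M0) t)%E by exact: causal_ge0.
have mP0 : measurable_fun `]0, x[ (fun t => (cmod (q t))%:E + causal (kabs M0) t)%E.
  apply: emeasurable_funD.
    apply/measurable_EFinP; apply: cmeas_cmod; apply: cmeasS mq => //.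
    by apply: subset_itvl; rewrite bnd_simp.
  by apply: measurable_funTS; apply: measurable_causal => //; exact: measurable_kabs.
have mP : measurable_fun `]0, x[ P.
  by apply: emeasurable_funD => //; exact: measurable_funeM.
have q0 t : (0 <= (cmod (q t))%:E + causal (kabs M0) t)%E.
  by rewrite adde_ge0 ?lee_fin ?cmod_ge0.
have zAV0 : 0 <= ze * A + V by rewrite addr_ge0 ?mulr_ge0.
have P0 t : (0 <= P t)%E.
  by rewrite adde_ge0 // ?lee_fin // mule_ge0 // lee_fin.
have bx0 : 0 <= be * expR (w * x) by rewrite mulr_ge0 ?expR_ge0.
apply: (@le_trans _ _ (\int[mu]_(t in `]0%R, x[) ((be * expR (w * x))%:E * P t))%E).
  apply: ae_ge0_le_integral => //.
  - by move=> t _; rewrite lee_fin cmod_ge0.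
  - by move=> t _; rewrite mule_ge0 // lee_fin.
  - exact: measurable_funeM.
  apply: ae_imp eqn => t eqt; rewrite /= in_itv /= => /andP[t0 tx].
  have tpi : 0 < t < pi by rewrite t0 (lt_le_trans tx).
  have tpi' : 0 <= t <= pi by case/andP: tpi => *; rewrite !ltW.
  have {}eqt := eqt tpi.
  have cf : causal (kabs M0) t \is a fin_num.
    by case/andP: tpi => ? ?; apply: causal_fin => //; [exact: kernel_L1_fin|exact: ltW].
  have PE : P t = (A * (cmod (q t) + fine (causal (kabs M0) t)) + (ze * A + V))%:E.
    by rewrite /P -{1}(fineK cf).
  rewrite PE -EFinM lee_fin.
  have cb : cmod (conv M0 u t) <= A * expR (w * t) * fine (causal (kabs M0) t).
    apply: cmod_conv_le => //.
    - exact: kernel_L1_fin.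
    - apply: cmeasS um => // s; rewrite /= !in_itv /= => /andP[s0 st].
      by rewrite ltW //= ltW // (lt_trans st); case/andP: tpi.
    - move=> s /andP[s0 st]; have spi : 0 <= s <= pi.
        by rewrite ltW //= ltW // (lt_trans st); case/andP: tpi.
      apply: le_trans (ub _ spi) _; rewrite ler_wpM2l // ler_expR ler_wpM2l //.
      exact: ltW.
    - by rewrite mulr_ge0 ?expR_ge0.
  have FE : F t = g t * (q t * u t + conv M0 u t + (r2 - z) * u t - v t).
    rewrite /F; congr (_ * _).
    have -> : v t = (- ddu t + q t * u t + conv M0 u t) - z * u t by rewrite eqt; ring.
    ring.
  rewrite FE cmodM.
  have gt : cmod (g t) <= be * expR (w * (x - t)) by apply: gb; rewrite !ltW.
  have e1 : expR (w * x) = expR (w * (x - t)) * expR (w * t).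
    by rewrite -expRD; congr expR; ring.
  have ut := ub _ tpi'; have vt := vb _ tpi'.
  have cq := cmod_ge0 (q t); have fc : 0 <= fine (causal (kabs M0) t) by rewrite fine_ge0.
  have in_le : cmod (q t * u t + conv M0 u t + (r2 - z) * u t - v t) <=
     expR (w * t) * (A * (cmod (q t) + fine (causal (kabs M0) t)) + (ze * A + V)).
    apply: le_trans (cmodB _ _) _; apply: le_trans (lerD (cmodD _ _) (lexx _)) _.
    apply: le_trans (lerD (lerD (cmodD _ _) (lexx _)) (lexx _)) _.
    rewrite !cmodM -/ze.
    have m1 := ler_wpM2l cq ut; have m2 := ler_wpM2l ze0 ut.
    lra.
  have hm := ler_pM (cmod_ge0 _) (cmod_ge0 _) gt in_le.
  by apply: le_trans hm _; rewrite e1 le_eqVlt; apply/orP; left; apply/eqP; ring.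
rewrite ge0_integralZl_EFin //.
rewrite [leRHS]EFinM; apply: lee_wpmul2l; first by rewrite lee_fin.
rewrite /P ge0_integralD //; last 2 first.
- by move=> t _; rewrite mule_ge0 // lee_fin.
- exact: measurable_funeM.
rewrite ge0_integralZl_EFin // [leRHS]EFinD; apply: leeD.
  by rewrite EFinM; apply: lee_wpmul2l; rewrite ?lee_fin // forcing_integral_le.
rewrite integral_cst // [leRHS]EFinM; apply: lee_wpmul2l; first by rewrite lee_fin.
have := @lebesgue_measure_itv R `]0, x[; rewrite /= => ->; rewrite lte_fin.
by case: ltP => _; rewrite -?EFinB lee_fin ?subr0 // pi_ge0.
Qed.

(** Both formulas integrate an exact derivative in [t]: that of [s (x - t) u' + c (x - t) u] is
    [s (x - t) (u'' + r2 u)], and that of [c (x - t) u' - r2 s (x - t) u] is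
    [c (x - t) (u'' + r2 u)]. *)
Lemma variation (r2 : C) s c b w u du ddu (c0 : C) x :
  kpair r2 s c b w -> 0 <= x <= pi ->
  cintegrable `[0, pi] ddu ->
  (forall x, 0 <= x <= pi -> u x = cintegral `[0, x] du) ->
  (forall x, 0 <= x <= pi -> du x = c0 + cintegral `[0, x] ddu) ->
  cintegrable `[0, pi] du ->
  u x = c0 * s x + cintegral `[0, x] (fun t => s (x - t) * (ddu t + r2 * u t)) /\
  du x = c0 * c x + cintegral `[0, x] (fun t => c (x - t) * (ddu t + r2 * u t)).
Proof.
move=> [sd cd s0 c0E _] /andP[x0 xpi] iddu uE duE idu.
have sub : (`[0, x] : set R) `<=` `[0, pi] by apply: subset_itvl; rewrite bnd_simp.
have iddx : cintegrable `[0, x] ddu by apply: cintegrableS iddu.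
have idx : cintegrable `[0, x] du by apply: cintegrableS idu.
have uE' t : 0 <= t <= x -> u t = 0 + cintegral `[0, t] du.
  by move=> /andP[t0 tx]; rewrite add0r uE // t0 (le_trans tx).
have duE' t : 0 <= t <= x -> du t = c0 + cintegral `[0, t] ddu.
  by move=> /andP[t0 tx]; rewrite duE // t0 (le_trans tx).
have u0 : u 0 = 0 by rewrite uE ?lexx ?pi_ge0 // set_itv1 cintegral_set1.
have du0 : du 0 = c0 by rewrite duE ?lexx ?pi_ge0 // set_itv1 cintegral_set1 addr0.
pose sg t := s (x - t); pose ch t := c (x - t).
have sgd : cderiv sg (fun t => (-1) * ch t) by exact: cderiv_reflect.
have chd : cderiv ch (fun t => r2 * sg t).
  have -> : (fun t => r2 * sg t) = (fun t => (-1) * (- r2 * sg t)).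
    by apply/funext => t; ring.
  exact: (cderiv_reflect x cd).
have csg : ccont (fun t => r2 * sg t) by exact: cderiv_ccont (cderivZ r2 sgd).
have cch : ccont (fun t => (-1) * ch t) by exact: cderiv_ccont (cderivZ (-1) chd).
have sg2d : cderiv (fun t => - r2 * sg t) (fun t => r2 * ch t).
  have -> : (fun t => r2 * ch t) = (fun t => (- r2) * ((-1) * ch t)).
    by apply/funext => t; ring.
  exact: cderivZ.
have cch2 : ccont (fun t => r2 * ch t) by exact: cderiv_ccont (cderivZ r2 chd).
have sgx : sg x = 0 by rewrite /sg subrr.
have chx : ch x = 1 by rewrite /ch subrr.
have sg0 : sg 0 = s x by rewrite /sg subr0.
have ch0 : ch 0 = c x by rewrite /ch subr0.
have [i1 e1] := cintegration_by_parts_prim x0 sgd cch iddx duE'.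
have [i2 e2] := cintegration_by_parts_prim x0 chd csg idx uE'.
have [i3 e3] := cintegration_by_parts_prim x0 chd csg iddx duE'.
have [i4 e4] := cintegration_by_parts_prim x0 sg2d cch2 idx uE'.
split.
  have -> : cintegral `[0, x] (fun t => sg t * (ddu t + r2 * u t)) =
     cintegral `[0, x] (fun t => (-1 * ch t * du t + sg t * ddu t) + (r2 * sg t * u t + ch t * du t)).
    by apply: eq_cintegral => t _; ring.
  by rewrite cintegralD // e1 e2 u0 du0 sgx chx sg0 ch0; ring.
have -> : cintegral `[0, x] (fun t => ch t * (ddu t + r2 * u t)) =
   cintegral `[0, x] (fun t => (r2 * sg t * du t + ch t * ddu t) + (r2 * ch t * u t + - r2 * sg t * du t)).
  by apply: eq_cintegral => t _; ring.
by rewrite cintegralD // e3 e4 u0 du0 sgx chx sg0 ch0; ring.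
Qed.

Lemma fsol_step (z r2 : C) v c0 u du s c A V b w : fsol q M0 z v c0 u du ->
  kpair r2 s c b w -> 0 <= A -> 0 <= V -> 0 <= w -> 0 <= b ->
  (forall t, 0 <= t <= pi -> cmod (u t) <= A * expR (w * t)) ->
  (forall t, 0 <= t <= pi -> cmod (v t) <= V * expR (w * t)) ->
  let E := A * K + (cmod (r2 - z) * A + V) * pi in
  forall x, 0 <= x <= pi ->
    cmod (u x - c0 * s x) <= b * expR (w * x) * E /\
    cmod (du x - c0 * c x) <= expR (w * x) * E.
Proof.
move=> fs kp A0 V0 w0 b0 ub vb E x xpi.
have [um _ idu _] := fsol_regular fs.
case: fs => ddu [i1 h1 h2 ae].
have [e1 e2] := variation kp xpi i1 h1 h2 idu.
case: kp => sd cd _ _ bd.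
have /andP[x0 xp] := xpi.
have bd' t : 0 <= t <= x -> 0 <= x - t <= pi by move=> /andP[? ?]; apply/andP; split; lra.
have cmg (g dg : R -> C) : cderiv g dg -> cmeas `[0, x] (fun t => g (x - t)).
  by move=> gd; apply: ccont_cmeas => //; exact: cderiv_ccont (cderiv_reflect x gd).
split.
  rewrite e1 addrAC subrr add0r.
  apply: (@forcing_bound z r2 v u ddu (fun t => s (x - t)) A V w b x i1 um ae xpi) => //;
    first exact: cmg sd.
  by move=> t /bd' /bd [].
rewrite e2 addrAC subrr add0r -[expR _]mul1r.
apply: (@forcing_bound z r2 v u ddu (fun t => c (x - t)) A V w 1 x i1 um ae xpi) => //;
  first exact: cmg cd.
by move=> t /bd' /bd []; rewrite mul1r.
Qed.

(** The improvement is applied to the supremum of [f] itself. The crude bound [B] does not enter the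
    conclusion; it ensures that the supremum is finite. *)
Lemma contraction_bound (D : set R) (f : R -> R) a k B : D !=set0 -> k < 1 ->
  (forall x, D x -> 0 <= f x <= B) ->
  (forall A, 0 <= A -> (forall x, D x -> f x <= A) -> forall x, D x -> f x <= a + k * A) ->
  forall x, D x -> f x <= a / (1 - k).
Proof.
move=> [x0 Dx0] k1 fB H x Dx.
have ne : (f @` D) !=set0 by exists (f x0), x0.
have hs : has_sup (f @` D).
  by split => //; exists B => _ [y Dy <-]; case/andP: (fB _ Dy).
have ub y : D y -> f y <= sup (f @` D) by move=> Dy; apply: sup_upper_bound => //; exists y.
have s0 : 0 <= sup (f @` D).
  by apply: le_trans (ub _ Dx0); case/andP: (fB _ Dx0).
have : sup (f @` D) <= a + k * sup (f @` D).
  by apply: ge_sup => // _ [y Dy <-]; exact: H.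
move=> h; apply: le_trans (ub _ Dx) _.
by rewrite ler_pdivlMr ?subr_gt0 // mulrBr mulr1 mulrC lerBlDr.
Qed.

(** Contraction for the supremum of [|u| exp (- w x)]; the resulting [A] is then fed back into
    [fsol_step]. The estimate is used with the trigonometric pair ([r2 = z], [b = 1 / |rho|]) for
    asymptotics, with the pair [x, 1] and [b = 1 / w] for entireness, and with that pair, [w = 0]
    and [b = pi], near [rho = 0]. *)
Lemma fsol_apriori (z r2 : C) v c0 u du s c V b w : fsol q M0 z v c0 u du ->
  kpair r2 s c b w -> 0 <= V -> 0 <= w -> 0 <= b ->
  (forall t, 0 <= t <= pi -> cmod (v t) <= V * expR (w * t)) ->
  b * (K + cmod (r2 - z) * pi) < 1 ->
  let A := (cmod c0 * b + b * V * pi) / (1 - b * (K + cmod (r2 - z) * pi)) in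
  let E := A * K + (cmod (r2 - z) * A + V) * pi in
  0 <= A /\ forall x, 0 <= x <= pi ->
    [/\ cmod (u x) <= A * expR (w * x),
        cmod (u x - c0 * s x) <= b * expR (w * x) * E &
        cmod (du x - c0 * c x) <= expR (w * x) * E].
Proof.
move=> fs kp V0 w0 b0 vb k1 A E.
have A0 : 0 <= A.
  rewrite divr_ge0 ?subr_ge0 ?(ltW k1) // addr_ge0 ?mulr_ge0 ?cmod_ge0 ?pi_ge0 //.
have ub x : 0 <= x <= pi -> cmod (u x) <= A * expR (w * x).
  have [_ _ _ [B B0 hB]] := fsol_regular fs.
  move=> xpi; rewrite -ler_pdivrMr ?expR_gt0 //.
  apply: (@contraction_bound [set x | 0 <= x <= pi] (fun x => cmod (u x) / expR (w * x))
     (cmod c0 * b + b * V * pi) (b * (K + cmod (r2 - z) * pi)) B) => //.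
  - by exists x.
  - move=> y /= ypi; rewrite divr_ge0 ?cmod_ge0 ?expR_ge0 //=.
    rewrite ler_pdivrMr ?expR_gt0 // (le_trans (hB _ ypi)) // ler_peMr //.
    apply: le_trans (expR_ge1Dx _); rewrite lerDl mulr_ge0 //.
    by case/andP: ypi.
  move=> A' A'0 h y /= ypi.
  have h' t : 0 <= t <= pi -> cmod (u t) <= A' * expR (w * t).
    by move=> /h; rewrite ler_pdivrMr ?expR_gt0.
  have [h1 _] := fsol_step fs kp A'0 V0 w0 b0 h' vb ypi.
  have [h2 _] : cmod (s y) <= b * expR (w * y) /\ cmod (c y) <= expR (w * y).
    by case: kp => _ _ _ _; exact.
  rewrite ler_pdivrMr ?expR_gt0 //.
  rewrite -(subrK (c0 * s y) (u y)); apply: le_trans (cmodD _ _) _.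
  rewrite [cmod (c0 * _)]cmodM; have := ler_wpM2l (cmod_ge0 c0) h2.
  by move: h1; move: (cmod (u y - _)) (cmod (c0) * _) => X Y h1 h3; lra.
split => // x xpi; have [h1 h2] := fsol_step fs kp A0 V0 w0 b0 ub vb xpi.
by split => //; exact: ub.
Qed.

End Step.

(** * The solutions are entire in the spectral parameter *)

Section Newton.
Variable R : realType.
Notation C := (Cplx R).
Implicit Types (z : C) (r : R).

(* The divided differences of the solutions at these nodes solve the same equation
   with the previous difference as source, which makes Newton's interpolation
   series converge locally uniformly. *)
Definition node (j : nat) : C := (j.+1%:R)^-1.

Lemma node_inj : injective node.
Proof. by move=> i j /invr_inj /eqP; rewrite eqr_nat eqSS => /eqP. Qed.

Lemma cmod_node j : cmod (node j) <= 1.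
Proof. by rewrite cmodV cmodn invf_le1 ?ltr0n // ler1n. Qed.

(** Excludes the nodes already used, where the quotient loses its meaning through [0^-1 = 0]. *)
Definition fresh n z := forall j, (j < n)%N -> z != node j.

Lemma fresh_node n : fresh n (node n).
Proof. by move=> j jn; apply/eqP => /node_inj h; rewrite h ltnn in jn. Qed.

Definition newton (d : nat -> C -> C) n : {poly C} :=
  \sum_(j < n) d j (node j) *: rootprod [seq node i | i <- iota 0 j].

Lemma rootprod_iotaS n : rootprod [seq node i | i <- iota 0 n.+1] =
  rootprod [seq node i | i <- iota 0 n] * ('X - (node n)%:P).
Proof. by rewrite -addn1 iotaD map_cat /rootprod big_cat /= big_seq1 add0n. Qed.

Lemma pnorm_rootprod r n : 0 <= r ->
  pnorm r (rootprod [seq node i | i <- iota 0 n]) <= (r + 1) ^+ n.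
Proof.
move=> r0; elim: n => [|n IH].
  by rewrite /rootprod big_nil /pnorm size_poly1 big_ord1 coef1 /= cmod1 !expr0 mulr1.
rewrite rootprod_iotaS exprSr (le_trans (pnormMX _ _ r0)) // ler_pM ?pnorm_ge0 //.
  by rewrite addr_ge0 ?cmod_ge0.
by rewrite lerD2l cmod_node.
Qed.

(** All nodes lie in the unit disc, so the n-th Newton basis polynomial has [pnorm r] at most
    [(r + 1)^n]. Divided differences that decay faster than every geometric sequence therefore make
    the series converge, and the same bound sends the remainder to 0. *)
Lemma entire_newton (f : C -> C) (d : nat -> C -> C) : (forall z, d 0%N z = f z) ->
  (forall n z, d n.+1 z = (z - node n)^-1 * (d n z - d n (node n))) ->
  (forall r th, 1 <= r -> 0 < th -> exists B, 0 <= B /\ forall n z, (0 < n)%N ->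
     cmod z <= r -> fresh n z -> cmod (d n z) <= B * th ^+ n) ->
  entire f.
Proof.
move=> d0 dS dB.
have rem n z : fresh n z ->
    f z = (newton d n).[z] + d n z * (rootprod [seq node i | i <- iota 0 n]).[z].
  elim: n => [|n IH] fz.
    by rewrite /newton big_ord0 horner0 add0r /rootprod big_nil hornerC mulr1 d0.
  have fz' : fresh n z by move=> j jn; apply: fz; exact: ltnW.
  rewrite (IH fz') /newton big_ord_recr /= hornerD hornerZ rootprod_iotaS hornerM hornerXsubC.
  rewrite dS; have zn : z - node n != 0 by rewrite subr_eq0 fz.
  by field.
have at_node n k : (k < n)%N -> f (node k) = (newton d n).[node k].
  elim: n => // n IH; rewrite ltnS leq_eqVlt => /predU1P[->|kn].
    rewrite {1}(rem n (node n)); last exact: fresh_node.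
    by rewrite /newton big_ord_recr /= hornerD hornerZ.
  rewrite (IH kn) /newton big_ord_recr /= hornerD hornerZ.
  have -> : (rootprod [seq node i | i <- iota 0 n]).[node k] = 0.
    apply/eqP; rewrite rootprod_eq0; apply/mapP; exists k => //.
    by rewrite mem_iota.
  by rewrite mulr0 addr0.
have small r : 0 <= r -> exists B, 0 <= B /\ forall n z, (0 < n)%N -> cmod z <= r + 1 ->
    fresh n z -> cmod (d n z) * (r + 1) ^+ n <= B * 2^-1 ^+ n.
  move=> r0; have r1 : 0 < r + 1 by rewrite ltr_wpDl.
  (* With this ratio the n-th term of the Newton series is at most [B / 2^n] on the disc. *)
  have th0 : 0 < (2 * (r + 1))^-1 by rewrite invr_gt0 mulr_gt0.
  have [|B [B0 hB]] := dB (r + 1) _ _ th0; first by rewrite lerDr.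
  exists B; split => // n z n0 zr fz.
  have := hB n z n0 zr fz; rewrite -(ler_pM2r (exprn_gt0 n r1)) => /le_trans; apply.
  rewrite -mulrA -exprMn (_ : (2 * (r + 1))^-1 * (r + 1) = 2^-1) //.
  by field; rewrite gt_eqF.
have half e : 0 < e -> exists m0, (0 < m0)%N /\ forall n, (m0 <= n)%N -> 2^-1 ^+ n <= e :> R.
  move=> e0; have [||N0 hN] := @small_pow R 2^-1 e _ _ e0; rewrite ?invr_ge0 //.
    by rewrite invf_lt1 // ltr1n.
  exists N0.+1; split => // n hn; apply: hN; exact: ltnW.
exists (newton d); split.
  move=> r e r0 e0; have [B [B0 hB]] := small r r0.
  have e10 : 0 < e / (4 * (B + 1)) by rewrite divr_gt0 // mulr_gt0 // ltr_wpDl.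
  have [m0 [m00 hm]] := half _ e10.
  have diff n k : (0 < n)%N ->
      pnorm r (newton d (n + k) - newton d n) <= B * (2 * (2^-1 ^+ n - 2^-1 ^+ (n + k))).
    move=> n0; elim: k => [|k IH].
      by rewrite addn0 !subrr mulr0 mulr0 /pnorm size_poly0 big_ord0.
    rewrite addnS {1}/newton big_ord_recr /= -/(newton d (n + k)) addrAC.
    apply: le_trans (pnormD _ _ r0) _; rewrite pnormZ.
    have := hB (n + k)%N (node (n + k)) _ _ (@fresh_node _).
    rewrite ltn_addr // (le_trans (cmod_node _)) ?lerDr // => /(_ isT isT) h.
    have h2 := ler_wpM2l (cmod_ge0 (d (n + k)%N (node (n + k)))) (pnorm_rootprod (n + k) r0).
    rewrite exprS; have := le_trans h2 h; lra.
  have two m l : (m0 <= m)%N -> (m <= l)%N -> pnorm r (newton d l - newton d m) <= e.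
    move=> hm0 ml; have := diff m (l - m)%N (leq_trans m00 hm0); rewrite subnKC // => h.
    apply: le_trans h _; have := hm m hm0; rewrite ler_pdivlMr ?mulr_gt0 ?ltr_wpDl //.
    have p0 : 0 <= 2^-1 ^+ l :> R by rewrite exprn_ge0 ?invr_ge0.
    have p1 : 0 <= 2^-1 ^+ m :> R by rewrite exprn_ge0 ?invr_ge0.
    move: (_ ^+ l) (_ ^+ m) p0 p1 => x y x0 y0 h.
    have : 0 <= B * x by rewrite mulr_ge0.
    lra.
  exists m0 => m l hm0 hl0; case: (leqP m l) => [ml|/ltnW lm]; last exact: two.
  rewrite -opprB -scaleN1r pnormZ cmodN cmod1 mul1r; exact: two.
move=> z e e0.
(* At a node the remainder formula fails, but there the interpolants are eventually equal to [f]. *)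
have [[k /eqP ->]|nz] := pselect (exists k, z == node k).
  by exists k.+1 => m km; rewrite (at_node m k km) subrr cmod0 ltW.
have fz n : fresh n z by move=> j _; apply/negP => h; apply: nz; exists j.
have [B [B0 hB]] := small _ (cmod_ge0 z).
have e10 : 0 < e / (B + 1) by rewrite divr_gt0 // ltr_wpDl.
have [m0 [m00 hm]] := half _ e10.
exists m0 => n hn; rewrite (rem n z (fz n)) addrAC subrr add0r cmodM.
have n0 : (0 < n)%N := leq_trans m00 hn.
have zz : cmod z <= cmod z + 1 by rewrite lerDl.
have h1 := hB n z n0 zz (fz n).
have h2 := ler_wpM2l (cmod_ge0 (d n z))
  (le_trans (horner_pnorm (rootprod [seq node i | i <- iota 0 n]) (lexx (cmod z)))
            (pnorm_rootprod n (cmod_ge0 z))).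
apply: le_trans h2 (le_trans h1 _).
have := hm n hn; rewrite ler_pdivlMr ?ltr_wpDl // => h3.
have p1 : 0 <= 2^-1 ^+ n :> R by rewrite exprn_ge0 ?invr_ge0.
lra.
Qed.

End Newton.

Section SolutionsEntire.
Variable R : realType.
Notation mu := (@lebesgue_measure R).
Notation C := (Cplx R).
Implicit Types (z : C) (r w x : R).

Lemma kpair_free (w b : R) : 0 <= w ->
  (forall x, 0 <= x <= pi -> x <= b * expR (w * x)) ->
  kpair (0 : C) (fun x : R => (x%:C)%C) (fun=> 1) b w.
Proof.
move=> w0 hb; split => //.
- by move=> t; split; [exact: is_derive_id|exact: is_derive_cst].
- by move=> t; rewrite oppr0 mul0r; split; exact: is_derive_cst.
move=> x xpi; have /andP[x0 _] := xpi; split.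
  by rewrite cmodRC ger0_norm // hb.
by rewrite cmod1; apply: le_trans (expR_ge1Dx _); rewrite lerDl mulr_ge0.
Qed.

(** From [w x <= exp (w x)]: a heavier weight makes the factor [b = 1 / w] as small as desired. *)
Lemma kpair_free_exp w : 0 < w ->
  kpair (0 : C) (fun x : R => (x%:C)%C) (fun=> 1) w^-1 w.
Proof.
move=> w0; apply: kpair_free; first exact: ltW.
move=> x _; rewrite mulrC ler_pdivlMr // mulrC.
by apply: le_trans (expR_ge1Dx _); rewrite lerDr.
Qed.

Fixpoint ddiff (Y : C -> R -> C) n z : R -> C :=
  if n is m.+1 then
    fun x => (z - node R m)^-1 * (ddiff Y m z x - ddiff Y m (node R m) x)
  else Y z.

Variables (q M0 : R -> C) (K : R).
Hypothesis mq : cmeas `]0, pi[ q.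
Hypothesis mM0 : cmeas `]0, pi[ M0.
Hypothesis hK : (\int[mu]_(s in `]0%R, pi[) (cmod (q s))%:E +
   \int[mu]_(s in `]0%R, pi[) (cmod (M0 s))%:E <= K%:E)%E.
Variables (Y dY : C -> R -> C).
Hypothesis hY : forall z, fsol q M0 z (fun=> 0) 1 (Y z) (dY z).

Definition dsource n : R -> C := if n is m.+1 then ddiff Y m (node R m) else (fun=> 0).

Lemma fsol_ext z v v' c c' u u' du du' : (forall x : R, v x = v' x) -> c = c' ->
  (forall x, u x = u' x) -> (forall x, du x = du' x) ->
  fsol q M0 z v c u du -> fsol q M0 z v' c' u' du'.
Proof. by move=> /funext <- <- /funext <- /funext <-. Qed.

(** In [fsolZB] the differences at [z] and at [node n] carry the same source, which cancels, while
    [(z - node n) u] survives with its factor removed by the division. The initial slope 1 of the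
    solutions disappears after the first difference. *)
Lemma fsol_ddiff n z : fresh n z ->
  fsol q M0 z (dsource n) (n == 0%N)%:R (ddiff Y n z) (ddiff dY n z).
Proof.
elim: n z => [|n IH] z fz; first exact: hY.
have fz' : fresh n z by move=> j jn; apply: fz; exact: ltnW.
have zn : z - node R n != 0 by rewrite subr_eq0 fz.
have := fsolZB (z - node R n)^-1 mM0 (kernel_L1_fin hK) (IH z fz') (IH _ (@fresh_node R n)).
apply: fsol_ext => //.
  by move=> x; rewrite subrr add0r /= mulKf.
by rewrite subrr mulr0.
Qed.

Lemma ddiff_bound r th : 1 <= r -> 0 < th -> exists B, 0 <= B /\
  forall n z, (0 < n)%N -> cmod z <= r -> fresh n z ->
    cmod (ddiff Y n z pi) <= B * th ^+ n /\ cmod (ddiff dY n z pi) <= B * th ^+ n.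
Proof.
move=> r1 th0; have K0 := K_ge0 hK; have pi0 := pi_gt0 R.
have r0 : 0 <= r by apply: le_trans r1.
(* The first summand keeps the contraction factor [(K + r pi) / w] below 1/2, the second keeps
   [pi / w] below [th / 2]. Together they give [A <= th V], a gain of [th] per difference. *)
pose w := 2 * (K + r * pi) + 2 * pi / th.
have w20 : 0 < 2 * pi / th by rewrite divr_gt0 // mulr_gt0.
have Krpi0 : 0 <= K + r * pi by rewrite addr_ge0 // mulr_ge0 // ltW.
have w0 : 0 < w by rewrite ltr_wpDl // mulr_ge0.
have b0 : 0 < w^-1 by rewrite invr_gt0.
have [_ _ _ [B0 B00 hB0]] := fsol_regular (hY (node R 0)).
have kp := kpair_free_exp w0.
have main n z V : cmod z <= r -> 0 <= V -> fresh n.+1 z ->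
    (forall x, 0 <= x <= pi -> cmod (dsource n.+1 x) <= V * expR (w * x)) ->
    forall x, 0 <= x <= pi -> cmod (ddiff Y n.+1 z x) <= (th * V) * expR (w * x) /\
      cmod (ddiff dY n.+1 z x) <= expR (w * x) * (th * V * (K + r * pi) + V * pi).
  move=> zr V0 fz vb x xpi.
  have zz : cmod (0 - z) <= r by rewrite sub0r cmodN.
  have kz : K + cmod (0 - z) * pi <= K + r * pi by rewrite lerD2l ler_wpM2r // ltW.
  have k2 : w^-1 * (K + cmod (0 - z) * pi) <= 2^-1.
    rewrite mulrC ler_pdivrMr // (le_trans kz) // /w; lra.
  have k1 : w^-1 * (K + cmod (0 - z) * pi) < 1 by lra.
  have := fsol_apriori mq mM0 hK (fsol_ddiff fz) kp V0 (ltW w0) (ltW b0) vb k1.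
  rewrite /= mulr0n cmod0 mul0r add0r.
  set A := _ / _; set E := A * K + _ => -[A0 /(_ x xpi) [h1 _ h3]].
  have hA : A <= th * V.
    rewrite /A ler_pdivrMr ?subr_gt0 //.
    have e1 : w^-1 * V * pi <= th / 2 * V.
      rewrite -mulrA mulrC ler_pdivrMr // mulrC.
      have : pi <= th / 2 * w.
        have : th / 2 * (2 * pi / th) = pi by field; rewrite gt_eqF.
        have : 0 <= th / 2 * (2 * (K + r * pi)) by rewrite mulr_ge0 // ?divr_ge0 ?mulr_ge0 // ltW.
        by rewrite /w mulrDr; lra.
      by move=> h; have := ler_wpM2l V0 h; lra.
    have : 0 <= th * V by rewrite mulr_ge0 // ltW.
    move: (w^-1 * V * pi) e1 (w^-1 * _) k2 => X e1 Y0 k2 h.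
    have := ler_wpM2l h k2; lra.
  split; first by apply: le_trans h1 _; rewrite ler_wpM2r ?expR_ge0.
  rewrite mul0r subr0 in h3; apply: le_trans h3 _; rewrite ler_wpM2l ?expR_ge0 //.
  have -> : E = A * (K + cmod (0 - z) * pi) + V * pi by rewrite /E; ring.
  rewrite lerD2r; apply: ler_pM => //.
  by rewrite addr_ge0 // mulr_ge0 ?cmod_ge0 // ltW.
have ind : forall n, (forall z, (0 < n)%N -> cmod z <= r -> fresh n z -> forall x, 0 <= x <= pi ->
    cmod (ddiff Y n z x) <= th ^+ n * B0 * expR (w * x)) /\
    (forall x, 0 <= x <= pi -> cmod (dsource n.+1 x) <= th ^+ n * B0 * expR (w * x)).
  elim=> [|m [_ IH2]].
    split; first by [].
    move=> y ypi; rewrite expr0 mul1r; apply: le_trans (hB0 _ ypi) _.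
    rewrite ler_peMr //; apply: le_trans (expR_ge1Dx _); rewrite lerDl.
    by case/andP: ypi => y0 _; rewrite mulr_ge0 // ltW.
  have tB : 0 <= th ^+ m * B0 by rewrite mulr_ge0 // exprn_ge0 // ltW.
  have H z : cmod z <= r -> fresh m.+1 z -> forall x, 0 <= x <= pi ->
    cmod (ddiff Y m.+1 z x) <= th ^+ m.+1 * B0 * expR (w * x).
    move=> zr fz x xpi; have [h _] := main m z _ zr tB fz IH2 x xpi.
    by rewrite exprS -(mulrA th).
  split; first by move=> z _; exact: H.
  move=> x xpi; apply: H => //; last exact: fresh_node.
  exact: le_trans (cmod_node _ _) r1.
have pip : (0 <= (pi : R) <= pi)%R by apply/andP; split; [exact: pi_ge0|exact: lexx].
(* The estimate of the derivative contains a term with one power of [th] fewer, compensated by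
   [pi / th]. *)
pose B := B0 * expR (w * pi) * (1 + (K + r * pi) + pi / th).
have pt0 : 0 <= pi / th by rewrite divr_ge0 // ltW.
have e0 := expR_ge0 (w * pi).
have Be : 0 <= B0 * expR (w * pi) by rewrite mulr_ge0.
exists B; split; first by apply: mulr_ge0 => //; lra.
move=> [//|n] z _ zr fz.
have tB : 0 <= th ^+ n * B0 by rewrite mulr_ge0 // exprn_ge0 // ltW.
have [h1 h2] := main n z _ zr tB fz (ind n).2 pi pip.
have t0 : 0 <= th ^+ n.+1 by rewrite exprn_ge0 // ltW.
split.
  apply: le_trans h1 _; rewrite exprS.
  have -> : th * (th ^+ n * B0) * expR (w * pi) = B0 * expR (w * pi) * (th * th ^+ n) by ring.
  rewrite -exprS ler_wpM2r // /B ler_peMr //; lra.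
apply: le_trans h2 _.
have -> : expR (w * pi) * (th * (th ^+ n * B0) * (K + r * pi) + th ^+ n * B0 * pi) =
   B0 * expR (w * pi) * ((K + r * pi) + pi / th) * th ^+ n.+1.
  by rewrite exprS; field; rewrite gt_eqF.
rewrite ler_wpM2r // /B ler_wpM2l //; lra.
Qed.

Lemma entire_solution : entire (fun z => Y z pi) /\ entire (fun z => dY z pi).
Proof.
split.
  apply: (@entire_newton R _ (fun n z => ddiff Y n z pi)) => // r th r1 th0.
  have [B [B0 hB]] := ddiff_bound r1 th0; exists B; split => // n z n0 zr fz.
  by have [] := hB n z n0 zr fz.
apply: (@entire_newton R _ (fun n z => ddiff dY n z pi)) => // r th r1 th0.
have [B [B0 hB]] := ddiff_bound r1 th0; exists B; split => // n z n0 zr fz.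
by have [] := hB n z n0 zr fz.
Qed.

End SolutionsEntire.

(** * The free problem *)

Section RealTrig.
Variable R : realType.
Implicit Types (x y t u : R).

Definition ch x : R := (expR x + expR (- x)) / 2.
Definition sh x : R := (expR x - expR (- x)) / 2.

Lemma ch2 x : ch x ^+ 2 = 1 + sh x ^+ 2.
Proof.
have e : expR x * expR (- x) = 1 by rewrite -expRD subrr expR0.
rewrite /ch /sh !expr2; move: (expR x) (expR (- x)) e => a b e.
transitivity (a * b + (a - b) / 2 * ((a - b) / 2)); first by field.
by rewrite e.
Qed.

Lemma ch_le_exp x : ch x <= expR `|x|.
Proof.
have h1 : expR x <= expR `|x| by rewrite ler_expR ler_norm.
have h2 : expR (- x) <= expR `|x| by rewrite ler_expR -normrN ler_norm.
rewrite /ch; lra.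
Qed.

Lemma ch_ge0 x : 0 <= ch x.
Proof. by rewrite divr_ge0 // addr_ge0 ?expR_ge0. Qed.

Lemma shN x : sh (- x) = - sh x.
Proof. by rewrite /sh opprK; lra. Qed.

Lemma sh2_norm x : sh x ^+ 2 = sh `|x| ^+ 2.
Proof. by case: (ger0P x) => // _; rewrite shN sqrrN. Qed.

Lemma is_derive_ch x : is_derive x 1 ch (sh x).
Proof. by apply: is_derive_eq; rewrite /sh /GRing.scale /=; ring. Qed.

Lemma is_derive_sh x : is_derive x 1 sh (ch x).
Proof. by apply: is_derive_eq; rewrite /ch /GRing.scale /=; ring. Qed.

Lemma cos_ge_1B x : 0 <= x -> 1 - x <= cos x.
Proof.
rewrite le_eqVlt => /predU1P[<-|x0]; first by rewrite cos0 subr0.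
have [|c _] := @MVT_segment R cos (fun x => - sin x) 0 x (ltW x0).
  exact/continuous_subspaceT/continuous_cos.
rewrite cos0 subr0 => e; have := sin_le1 c; rewrite lerBlDr.
have := ltW x0; nra.
Qed.

Lemma sin_ge_quad x : 0 <= x -> x * (1 - x) <= sin x.
Proof.
rewrite le_eqVlt => /predU1P[<-|x0]; first by rewrite sin0 mul0r.
have [|c cx] := @MVT_segment R sin cos 0 x (ltW x0).
  exact/continuous_subspaceT/continuous_sin.
move: cx; rewrite in_itv /= => /andP[c0 cx].
rewrite sin0 !subr0 => ->; rewrite mulrC; apply: ler_wpM2r; first exact: ltW.
by apply: le_trans (cos_ge_1B c0); rewrite lerD2l lerN2.
Qed.

Lemma sh_ge_quad x : 0 <= x -> x * (1 - x) <= sh x.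
Proof.
move=> x0; rewrite /sh expRN; have := expR_ge1Dx x.
have e0 := expR_gt0 x; move: (expR x) e0 => e e0 h.
have ie : e^-1 <= (1 + x)^-1 by rewrite lef_pV2 ?posrE // ltr_pwDl.
have x10 : 0 < 1 + x by rewrite ltr_pwDl.
have : (1 + x)^-1 <= 1 - x + x ^+ 2.
  rewrite -[_^-1]mul1r ler_pdivrMr //.
  have : 0 <= x ^+ 3 by rewrite exprn_ge0.
  by rewrite !exprS expr0; lra.
have : 0 <= x ^+ 2 by rewrite exprn_ge0.
rewrite expr2; lra.
Qed.

(** Multiplying the hypothesis by [2 exp t] gives [exp (2 t) (1 - 2 et) <= 1]: a relative bound on
    the hyperbolic sine confines [t] itself, so the exponential is close to 1. *)
Lemma sh_small (et t : R) : 0 <= t -> 0 <= et -> et <= 16^-1 ->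
  sh t <= et * expR t -> t <= 2 * et /\ expR t ^+ 2 <= 1 + 4 * et.
Proof.
move=> t0 e0 e1; rewrite /sh => h.
have ee : expR t * expR (- t) = 1 by rewrite -expRD subrr expR0.
have E0 := expR_gt0 t; have F0 := expR_gt0 (- t).
have e2 : expR t ^+ 2 <= 1 + 4 * et.
  have : expR t * (expR t - expR (- t)) <= expR t * (2 * (et * expR t)).
    by apply: ler_wpM2l; [exact: ltW|lra].
  rewrite mulrBr ee expr2; set x := expR t * expR t.
  have -> : expR t * (2 * (et * expR t)) = 2 * et * x by rewrite /x; ring.
  move=> hx; have x1 : x * (1 - 2 * et) <= 1 by lra.
  have x0 : 0 <= x by rewrite mulr_ge0 // ltW.
  have : (1 + 4 * et) * (x * (1 - 2 * et)) <= (1 + 4 * et) * 1 by rewrite ler_wpM2l //; lra.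
  have : 1 <= (1 + 4 * et) * (1 - 2 * et).
    have := ler_wpM2l e0 e1; lra.
  move=> h1 h2; have := ler_wpM2l x0 h1; lra.
split => //.
have : 1 + 2 * t <= expR t ^+ 2.
  by rewrite expr2 -expRD; apply: le_trans (expR_ge1Dx _); lra.
lra.
Qed.

(** Inversion of [sin] and [sinh] near 0 with a controlled error: both are at least [x (1 - x)], and
    once [u] and [t] are at most [4 et] this is at least [x (1 - 4 et)]. *)
Lemma sqrt_small_sum (u t et : R) : 0 <= u -> 0 <= t -> 0 <= et -> et <= 16^-1 ->
  u <= 2^-1 * pi -> (sin u) ^+ 2 + sh t ^+ 2 <= et ^+ 2 * expR t ^+ 2 ->
  Num.sqrt (u ^+ 2 + t ^+ 2) <= et * (1 + 11 * et).
Proof.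
move=> u0 t0 e0 e1 upi h.
have s0 : 0 <= sh t.
  have : expR (- t) <= expR t by rewrite ler_expR; lra.
  rewrite /sh; lra.
have E0 := expR_gt0 t.
have hs : sh t <= et * expR t.
  have : sh t ^+ 2 <= (et * expR t) ^+ 2.
    by rewrite [(et * _) ^+ 2]exprMn; apply: le_trans h; rewrite lerDr sqr_ge0.
  by rewrite ler_pXn2r // nnegrE // mulr_ge0 // expR_ge0.
have [t2 E2] := sh_small t0 e0 e1 hs.
have h' : sin u ^+ 2 + sh t ^+ 2 <= et ^+ 2 * (1 + 4 * et).
  by apply: le_trans h _; rewrite ler_wpM2l ?sqr_ge0.
have pi2 := pi_ge2 R.
have su0 : 0 <= sin u by apply: sin_ge0_pi; apply/andP; split => //; lra.
have su : sin u <= 2 * et.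
  rewrite -(@ler_pXn2r _ 2) ?nnegrE ?mulr_ge0 // exprMn.
  have : sin u ^+ 2 <= et ^+ 2 * (1 + 4 * et).
    by apply: le_trans h'; rewrite lerDl sqr_ge0.
  move=> /le_trans; apply; rewrite mulrC ler_wpM2r ?sqr_ge0 //; lra.
(* A value of [u] in the upper part of the range is impossible: [sin] increases there and
   [sin (1/2) >= 1/4], whereas [sin u <= 2 et <= 1/8]. *)
have u12 : u <= 2^-1.
  rewrite leNgt; apply/negP => u12.
  have : sin (2^-1) < sin u.
    rewrite ltr_sin // in_itv /=; apply/andP; split; lra.
  have := @sin_ge_quad 2^-1; rewrite invr_ge0 ler0n => /(_ isT); lra.
have u4 : u <= 4 * et.
  have := sin_ge_quad u0; nra.
have a1 : u * (1 - 4 * et) <= sin u.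
  apply: le_trans (sin_ge_quad u0); rewrite ler_wpM2l //; lra.
have a2 : t * (1 - 4 * et) <= sh t.
  apply: le_trans (sh_ge_quad t0); rewrite ler_wpM2l //; lra.
have d0 : 0 < 1 - 4 * et by lra.
have d0W : 0 <= 1 - 4 * et by lra.
have b1 : (u * (1 - 4 * et)) ^+ 2 <= sin u ^+ 2.
  by rewrite !expr2; apply: ler_pM => //; apply: mulr_ge0.
have b2 : (t * (1 - 4 * et)) ^+ 2 <= sh t ^+ 2.
  by rewrite !expr2; apply: ler_pM => //; apply: mulr_ge0.
have S0 : 0 <= u ^+ 2 + t ^+ 2 by rewrite addr_ge0 ?sqr_ge0.
rewrite -(@ler_pXn2r _ 2) ?nnegrE ?sqrtr_ge0 //; last first.
  by rewrite mulr_ge0 //; lra.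
rewrite sqr_sqrtr // -(ler_pM2r (exprn_gt0 2 d0)).
have -> : (u ^+ 2 + t ^+ 2) * (1 - 4 * et) ^+ 2 =
  (u * (1 - 4 * et)) ^+ 2 + (t * (1 - 4 * et)) ^+ 2 by ring.
apply: le_trans (lerD b1 b2) (le_trans h' _).
have -> : (et * (1 + 11 * et)) ^+ 2 * (1 - 4 * et) ^+ 2 =
  et ^+ 2 * ((1 + 11 * et) * (1 - 4 * et)) ^+ 2 by ring.
apply: ler_wpM2l; first exact: sqr_ge0.
(* The product equals [1 + 7 et - 44 et^2], and [44 et^2 <= 3 et] because [et <= 1/16]; this is
   where 11 comes from. *)
have c1 : 1 + 4 * et <= (1 + 11 * et) * (1 - 4 * et).
  have := ler_wpM2l e0 e1; lra.
have c0 : 1 <= 1 + 4 * et by lra.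
have x1 := le_trans c0 c1; apply: le_trans c1 _.
by rewrite expr2 ler_peMl // (le_trans ler01 x1).
Qed.

End RealTrig.

Section ComplexTrig.
Variable R : realType.
Notation C := (Cplx R).
Notation mu := (@lebesgue_measure R).
Implicit Types (rho z : C) (x : R).

(** Sine of [rho x] for real [x], expanded by [sin (a + i b) = sin a cosh b + i cos a sinh b];
    [ccos] is the cosine in the same form. *)
Definition csin rho x : C := Complex (sin (complex.Re rho * x) * ch (complex.Im rho * x))
  (cos (complex.Re rho * x) * sh (complex.Im rho * x)).
Definition ccos rho x : C := Complex (cos (complex.Re rho * x) * ch (complex.Im rho * x))
  (- (sin (complex.Re rho * x) * sh (complex.Im rho * x))).

Lemma sqr_cmod_csin rho x : cmod (csin rho x) ^+ 2 =
  sin (complex.Re rho * x) ^+ 2 + sh (complex.Im rho * x) ^+ 2.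
Proof.
rewrite sqr_cmod /= (exprMn 2 (sin _)) (exprMn 2 (cos _)) ch2.
have := cos2Dsin2 (complex.Re rho * x).
move: (cos _) (sin _) (sh _) => c s h e.
transitivity (s ^+ 2 + (c ^+ 2 + s ^+ 2) * h ^+ 2); first by ring.
by rewrite e mul1r.
Qed.

Lemma sqr_cmod_ccos rho x : cmod (ccos rho x) ^+ 2 =
  cos (complex.Re rho * x) ^+ 2 + sh (complex.Im rho * x) ^+ 2.
Proof.
rewrite sqr_cmod /= sqrrN (exprMn 2 (sin _)) (exprMn 2 (cos _)) ch2.
have := cos2Dsin2 (complex.Re rho * x).
move: (cos _) (sin _) (sh _) => c s h e.
transitivity (c ^+ 2 + (c ^+ 2 + s ^+ 2) * h ^+ 2); first by ring.
by rewrite e mul1r.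
Qed.

Lemma sh_exp_bound (a b x : R) : 0 <= x -> a ^+ 2 <= 1 ->
  a ^+ 2 + sh (b * x) ^+ 2 <= expR (`|b| * x) ^+ 2.
Proof.
move=> x0 a1; apply: (@le_trans _ _ (ch (b * x) ^+ 2)); first by rewrite ch2 lerD2r.
rewrite lerXn2r ?nnegrE ?ch_ge0 ?expR_ge0 //.
by apply: le_trans (ch_le_exp _) _; rewrite normrM (ger0_norm x0).
Qed.

Lemma sqr_le1 (a b : R) : a ^+ 2 + b ^+ 2 = 1 -> a ^+ 2 <= 1.
Proof. by move=> <-; rewrite lerDl sqr_ge0. Qed.

Lemma cmod_csin_le rho x : 0 <= x -> cmod (csin rho x) <= expR (`|complex.Im rho| * x).
Proof.
move=> x0; rewrite -(@ler_pXn2r _ 2) ?nnegrE ?cmod_ge0 ?expR_ge0 // sqr_cmod_csin.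
by apply: sh_exp_bound => //; apply: (@sqr_le1 _ (cos (complex.Re rho * x))); rewrite addrC cos2Dsin2.
Qed.

Lemma cmod_ccos_le rho x : 0 <= x -> cmod (ccos rho x) <= expR (`|complex.Im rho| * x).
Proof.
move=> x0; rewrite -(@ler_pXn2r _ 2) ?nnegrE ?cmod_ge0 ?expR_ge0 // sqr_cmod_ccos.
by apply: sh_exp_bound => //; apply: (@sqr_le1 _ (sin (complex.Re rho * x))); rewrite cos2Dsin2.
Qed.

Lemma is_derive_scale (f : R -> R) (a t d : R) : is_derive (a * t) 1 f d ->
  is_derive t 1 (fun t => f (a * t)) (a * d).
Proof.
move=> fd; have gd : is_derive t (1 : R) (fun t : R => a * t) a.
  by apply: is_derive_eq; rewrite /GRing.scale /=; ring.
have := @is_derive1_comp _ f (fun t => a * t) t d a fd gd.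
by rewrite mulrC.
Qed.

Lemma is_derive_prod (f g : R -> R) (t df dg : R) : is_derive t 1 f df ->
  is_derive t 1 g dg -> is_derive t 1 (fun t => f t * g t) (f t * dg + g t * df).
Proof. by move=> h1 h2; exact: (is_deriveM h1 h2). Qed.

Lemma cderiv_csin rho : cderiv (csin rho) (fun x => rho * ccos rho x).
Proof.
move=> t; rewrite ReM ImM /=.
have ds := @is_derive_scale _ (complex.Re rho) t _ (is_derive_sin (complex.Re rho * t)).
have dc := @is_derive_scale _ (complex.Re rho) t _ (is_derive_cos (complex.Re rho * t)).
have dch := @is_derive_scale _ (complex.Im rho) t _ (is_derive_ch (complex.Im rho * t)).
have dsh := @is_derive_scale _ (complex.Im rho) t _ (is_derive_sh (complex.Im rho * t)).
split.
  by apply: is_derive_eq (is_derive_prod ds dch) _; ring.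
by apply: is_derive_eq (is_derive_prod dc dsh) _; ring.
Qed.

Lemma cderiv_ccos rho : cderiv (ccos rho) (fun x => - rho * csin rho x).
Proof.
move=> t; rewrite ReM ImM ReN ImN /=.
have ds := @is_derive_scale _ (complex.Re rho) t _ (is_derive_sin (complex.Re rho * t)).
have dc := @is_derive_scale _ (complex.Re rho) t _ (is_derive_cos (complex.Re rho * t)).
have dch := @is_derive_scale _ (complex.Im rho) t _ (is_derive_ch (complex.Im rho * t)).
have dsh := @is_derive_scale _ (complex.Im rho) t _ (is_derive_sh (complex.Im rho * t)).
split.
  by apply: is_derive_eq (is_derive_prod dc dch) _; ring.
by apply: is_derive_eq (is_deriveN (is_derive_prod ds dsh)) _; ring.
Qed.

Lemma csin0 rho : csin rho 0 = 0.
Proof. by rewrite /csin !mulr0 sin0 /sh oppr0 subrr mul0r mul0r mulr0. Qed.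

Lemma ccos0 rho : ccos rho 0 = 1.
Proof. by rewrite /ccos !mulr0 sin0 cos0 /ch oppr0 expR0 mul0r oppr0 mul1r -mulr2n -mulr_natr mul1r divff. Qed.

Lemma kpair_trig rho : rho != 0 -> kpair (rho ^+ 2) (fun x => rho^-1 * csin rho x)
  (ccos rho) (cmod rho)^-1 `|complex.Im rho|.
Proof.
move=> r0; split.
- have := cderivZ rho^-1 (cderiv_csin rho).
  by rewrite (_ : (fun t => _ * (rho * _)) = ccos rho) //; apply/funext => t; rewrite mulKf.
- have := cderiv_ccos rho.
  rewrite (_ : (fun t => - rho * _) = (fun x => - rho ^+ 2 * (rho^-1 * csin rho x))) //.
  by apply/funext => t; field.
- by rewrite csin0 mulr0.
- exact: ccos0.
move=> x /andP[x0 _]; split; last exact: cmod_ccos_le.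
by rewrite cmodM cmodV ler_wpM2l ?invr_ge0 ?cmod_ge0 // cmod_csin_le.
Qed.

Lemma ccos_shift rho : ccos rho pi = csin (rho + 2^-1) pi.
Proof.
have half : (2^-1 : C) = ((2^-1 : R)%:C)%C by rewrite RCV RCn.
rewrite /ccos /csin half ReD ImD /= addr0 mulrDl (mulrC 2^-1 pi).
by rewrite sinDpihalf cosDpihalf mulNr.
Qed.

Lemma sin_add_natpi (x : R) n : `|sin (x + n%:R * pi)| = `|sin x|.
Proof.
elim: n => [|n IH]; first by rewrite mul0r addr0.
by rewrite -natr1 mulrDl mul1r addrA sinDpi normrN.
Qed.

(* From |sin (pi rho)|^2 = sin^2 (pi Re rho) + sinh^2 (pi Im rho). *)
Lemma near_integer rho et : 0 <= complex.Re rho -> 0 <= et -> et <= 16^-1 ->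
  cmod (csin rho pi) <= et * expR (`|complex.Im rho| * pi) ->
  exists n : nat, pi * cmod (rho - n%:R) <= et * (1 + 11 * et).
Proof.
move=> a0 e0 e1 h; have pi0 := pi_ge0 R; have pip := pi_gt0 R.
set a := complex.Re rho in a0 *; set b := complex.Im rho in h *.
(* The integer nearest to [a]; truncation rounds correctly because [a >= 0]. *)
pose n := Num.trunc (a + 2^-1); exists n.
have a20 : 0 <= a + 2^-1 by rewrite addr_ge0 // invr_ge0.
have /andP[n1 n2] := truncn_itv a20; rewrite -/n in n1 n2.
have n3 : n.+1%:R = n%:R + 1 :> R by rewrite -addn1 natrD.
rewrite n3 in n2.
have fa : `|a - n%:R| <= 2^-1 by rewrite ler_norml; apply/andP; split; lra.
have -> : pi * cmod (rho - n%:R) = Num.sqrt ((pi * `|a - n%:R|) ^+ 2 + (`|b| * pi) ^+ 2).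
  rewrite -[LHS]ger0_norm ?mulr_ge0 ?cmod_ge0 // -[`|pi * _|]sqrtr_sqr.
  apply: (congr1 (@Num.sqrt R)); rewrite exprMn sqr_cmod -RCn !ReImE /= oppr0 addr0 -/a -/b.
  by rewrite !exprMn !real_normK ?num_real //; ring.
apply: sqrt_small_sum => //; rewrite ?mulr_ge0 //.
  by rewrite mulrC ler_wpM2r.
have : cmod (csin rho pi) ^+ 2 <= (et * expR (`|b| * pi)) ^+ 2.
  by rewrite lerXn2r ?nnegrE ?cmod_ge0 // mulr_ge0 ?expR_ge0.
rewrite exprMn sqr_cmod_csin -/a -/b => /le_trans {h}h; rewrite (sh2_norm (b * pi)) normrM (ger0_norm pi0) in h *.
apply: le_trans (h _ (lexx _)); rewrite lerD2r.
have -> : a * pi = (a - n%:R) * pi + n%:R * pi by ring.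
rewrite -[leRHS]real_normK ?num_real // sin_add_natpi real_normK ?num_real //.
rewrite mulrC; case: (ger0P (a - n%:R)) => // _.
by rewrite mulNr sinN sqrrN.
Qed.

(* Unlike [sqrtC], this branch has a nonnegative real part. *)
Definition csq (z : C) : C := if 0 <= complex.Re (sqrtC z) then sqrtC z else - sqrtC z.

Lemma csqK z : csq z ^+ 2 = z.
Proof. by rewrite /csq; case: ifP => _; rewrite ?sqrrN sqrtCK. Qed.

Lemma Re_csq_ge0 z : 0 <= complex.Re (csq z).
Proof.
by rewrite /csq; case: ifP => // /negbT; rewrite -ltNge ReN oppr_ge0 => /ltW.
Qed.

Lemma cmod_csq z : cmod (csq z) ^+ 2 = cmod z.
Proof. by rewrite -cmodX csqK. Qed.

Lemma csq_sqr rho : 0 < complex.Re rho -> csq (rho ^+ 2) = rho.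
Proof.
move=> r0; have := csqK (rho ^+ 2) => /eqP; rewrite eqf_sqr => /orP[/eqP //|/eqP e].
by have := Re_csq_ge0 (rho ^+ 2); rewrite e ReN oppr_ge0 leNgt r0.
Qed.

Lemma csq_eq0 z : (csq z == 0) = (z == 0).
Proof. by rewrite -[in RHS](csqK z) expf_eq0. Qed.

(** This is [sin (x sqrt z) / sqrt z]. Its limit [x] at [z = 0] is inserted by hand, since
    [0^-1 = 0] would make the formula vanish there. *)
Definition free_s z : R -> C := if z == 0 then fun x => (x%:C)%C
  else fun x => (csq z)^-1 * csin (csq z) x.
Definition free_c z : R -> C := if z == 0 then fun=> 1 else ccos (csq z).

Lemma cderiv_free z : cderiv (free_s z) (free_c z) /\
  cderiv (free_c z) (fun x => - z * free_s z x).
Proof.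
rewrite /free_s /free_c; case: eqVneq => [->|z0].
  split; first by move=> t; split; [exact: is_derive_id|exact: is_derive_cst].
  by move=> t; rewrite oppr0 mul0r; split; exact: is_derive_cst.
have := @kpair_trig (csq z); rewrite csq_eq0 csqK => /(_ z0) [h1 h2 _ _ _].
by split.
Qed.

Lemma free_s0 z : free_s z 0 = 0.
Proof. by rewrite /free_s; case: eqVneq => // _; rewrite csin0 mulr0. Qed.

Lemma free_c0 z : free_c z 0 = 1.
Proof. by rewrite /free_c; case: eqVneq => // _; rewrite ccos0. Qed.

Lemma fsol_free z : fsol (fun=> 0) (fun=> 0) z (fun=> 0) 1 (free_s z) (free_c z).
Proof.
have [sd cd] := cderiv_free z.
have cc := cderiv_ccont cd; have cs := cderiv_ccont sd.
have czs := cderiv_ccont (cderivZ (- z) sd).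
exists (fun x => - z * free_s z x); split.
- exact: ccont_integrable.
- by move=> x /andP[x0 _]; rewrite (cFTC x0 sd cc) free_s0 subr0.
- by move=> x /andP[x0 _]; rewrite (cFTC x0 cd czs) free_c0 addrC subrK.
apply: aeW => x _; rewrite (_ : conv _ _ _ = 0).
  by rewrite mul0r !addr0 mulNr opprK.
rewrite /conv /kernel_of /cintegral; apply: CplxP => /=;
  by rewrite (@eq_Rintegral _ _ _ mu _ (fun=> 0)) ?Rintegral_cst ?mul0r // => s _; rewrite mulr0 mul0r.
Qed.

End ComplexTrig.

(** * Zeros and factorization of the free characteristic functions *)

Section FreeProblem.
Variable R : realType.
Notation C := (Cplx R).
Notation mu := (@lebesgue_measure R).
Implicit Types (rho z w : C) (x t r : R) (dn : bool) (n k N : nat).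

(* [dn] selects the Dirichlet-Neumann problem ([true]) or the Dirichlet one
   ([false]); cos (pi rho) = sin (pi (rho + 1/2)) lets both share one sine. *)
Definition theta dn : R := if dn then 2^-1 else 0.
Definition freq dn n : R := n%:R - theta dn.
Definition pref dn rho : C := if dn then 1 else rho^-1.
Definition trig dn rho : C := csin (rho + ((theta dn)%:C)%C) pi.
Definition free dn z : C := if dn then free_c z pi else free_s z pi.
(** The midpoint of the N-th and the next free frequency; in the [z]-plane its square is used. For
    the Dirichlet-Neumann problem it degenerates to 0 at [N = 0]. *)
Definition radius dn N : R := freq dn N.+1 - 2^-1.

Lemma theta_ge0 dn : 0 <= theta dn. Proof. by case: dn; rewrite //= invr_ge0. Qed.
Lemma theta_le dn : theta dn <= 2^-1. Proof. by case: dn; rewrite //= invr_ge0. Qed.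

Lemma freqS dn n : freq dn n.+1 = freq dn n + 1.
Proof. by rewrite /freq -addn1 natrD addrAC. Qed.

Lemma freq_ge_half dn n : (0 < n)%N -> 2^-1 <= freq dn n.
Proof.
move=> n0; have : 1 <= n%:R :> R by rewrite ler1n.
have := theta_le dn; rewrite /freq; lra.
Qed.

Lemma trig_pref dn rho : rho != 0 ->
  pref dn rho * trig dn rho = if dn then ccos rho pi else rho^-1 * csin rho pi.
Proof.
move=> r0; rewrite /pref /trig /theta; case: dn; last by rewrite addr0.
by rewrite ccos_shift mul1r RCV RCn.
Qed.

Lemma freeE dn z : z != 0 -> free dn z = pref dn (csq z) * trig dn (csq z).
Proof.
move=> z0; rewrite trig_pref ?csq_eq0 // /free /free_c /free_s (negbTE z0).
by case: dn.
Qed.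

Lemma free_at0 dn : free dn 0 != 0.
Proof.
rewrite /free /free_c /free_s eqxx; case: dn; first exact: oner_neq0.
by rewrite -cmod_eq0 cmodRC normr_eq0 gt_eqF ?pi_gt0.
Qed.

Lemma near_freq dn rho et : 0 <= complex.Re rho -> 0 <= et -> et <= 16^-1 ->
  cmod (trig dn rho) <= et * expR (`|complex.Im rho| * pi) ->
  exists n, 0 <= freq dn n /\ pi * cmod (rho - ((freq dn n)%:C)%C) <= et * (1 + 11 * et).
Proof.
move=> r0 e0 e1 h; have th0 := theta_ge0 dn.
have [||n hn] := @near_integer R (rho + ((theta dn)%:C)%C) et _ e0 e1.
- by rewrite ReD /= addr_ge0.
- by rewrite ImD /= addr0.
have hn' : pi * cmod (rho - ((freq dn n)%:C)%C) <= et * (1 + 11 * et).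
  apply: le_trans hn; rewrite /freq RCD RCN RCn opprD opprK addrA addrAC lexx //.
exists n; split => //.
case: n {hn} hn' => [|n] hn'; last first.
  by apply: le_trans (freq_ge_half dn (ltn0Sn n)); rewrite invr_ge0.
rewrite /freq /theta sub0r oppr_ge0; case: dn h th0 hn' => // h th0 hn'.
(* For the Dirichlet-Neumann problem [n = 0] means the frequency -1/2, at distance at least 1/2 from
   [rho] because [Re rho >= 0]. Then [pi] times the distance is at least 1, more than
   [et (1 + 11 et)]. *)
exfalso; have := normr_Re (rho - ((freq true 0)%:C)%C).
rewrite !ReImE /freq /theta sub0r opprK ger0_norm; last by rewrite addr_ge0 // invr_ge0.
move=> h2; have pi2 := pi_ge2 R.
have h3 : 2 * 2^-1 <= pi * cmod (rho - ((freq true 0)%:C)%C).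
  apply: ler_pM => //; rewrite ?invr_ge0 //.
  by move: h2; rewrite /freq /theta sub0r; lra.
have := le_trans h3 hn'; have := ler_wpM2l e0 e1; lra.
Qed.

Lemma csin_nat n : csin (n%:R : C) pi = 0.
Proof.
apply/eqP; rewrite -cmod_eq0 -sqrf_eq0 sqr_cmod_csin -RCn /= mul0r.
have : `|sin (n%:R * pi)| = 0 :> R.
  by rewrite -[_ * pi]add0r sin_add_natpi sin0 normr0.
by move=> /normr0_eq0 ->; rewrite /sh oppr0 subrr mul0r expr0n /= addr0.
Qed.

Lemma freqC dn n : ((freq dn n)%:C)%C + ((theta dn)%:C)%C = n%:R :> C.
Proof. by rewrite -RCD /freq subrK RCn. Qed.

Lemma csq_freq dn n t : (0 < n)%N -> 0 <= t ->
  csq (((freq dn n + t)%:C)%C ^+ 2) = ((freq dn n + t)%:C)%C :> C.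
Proof.
move=> n0 t0; apply: csq_sqr => /=; have := freq_ge_half dn n0.
have : 0 < 2^-1 :> R by rewrite invr_gt0.
lra.
Qed.

Lemma freq_neq0 dn n t : (0 < n)%N -> 0 <= t -> ((freq dn n + t)%:C)%C != 0 :> C.
Proof.
move=> n0 t0; rewrite -cmod_eq0 cmodRC normr_eq0 gt_eqF //.
have := freq_ge_half dn n0; have : 0 < 2^-1 :> R by rewrite invr_gt0.
lra.
Qed.

Lemma free_at_freq dn n : (0 < n)%N -> free dn (((freq dn n)%:C)%C ^+ 2) = 0.
Proof.
move=> n0; have e := csq_freq dn n0 (lexx 0); have nz := freq_neq0 dn n0 (lexx 0).
rewrite addr0 in e nz.
by rewrite freeE ?expf_neq0 // e /trig freqC csin_nat mulr0.
Qed.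

(** The quantitative [near_freq], taken with error 0, locates the zeros exactly. The index 0 is
    ruled out by the sign of the frequency or by [z != 0]. *)
Lemma free_zero dn z : free dn z = 0 -> exists n, (0 < n)%N /\ z = ((freq dn n)%:C)%C ^+ 2.
Proof.
move=> fz; have z0 : z != 0.
  by apply: contraTneq isT => e; move: fz; rewrite e => /eqP; rewrite (negbTE (free_at0 dn)).
move: fz; rewrite freeE // => /eqP; rewrite mulf_eq0 => /orP[/eqP|/eqP t0].
  rewrite /pref; case: dn => /eqP; first by rewrite oner_eq0.
  by rewrite invr_eq0 csq_eq0 (negbTE z0).
have [||n [n0 hn]] := @near_freq dn (csq z) 0 (Re_csq_ge0 z) (lexx 0).
- by rewrite invr_ge0.
- by rewrite t0 cmod0 mul0r.
have e : csq z = ((freq dn n)%:C)%C.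
  apply/eqP; rewrite -subr_eq0 -cmod_eq0; apply/eqP/le_anti; rewrite cmod_ge0 andbT.
  by move: hn; rewrite mul0r pmulr_rle0 ?pi_gt0.
exists n; split; last by rewrite -e csqK.
case: n e n0 {hn} => // e; rewrite /freq /theta sub0r; case: dn t0 e => t0 e.
  by rewrite oppr_ge0 leNgt invr_gt0 ltr0n.
move=> _; exfalso; move: z0; rewrite -csq_eq0 e /freq /theta subr0.
by rewrite -cmod_eq0 cmodRC normr0 eqxx.
Qed.

Lemma sin_pi_lower t : 0 <= t -> t <= 8^-1 -> t <= sin (t * pi) :> R.
Proof.
move=> t0 t1; have pi2 := pi_ge2 R; have /andP[_ pi4] := pihalf_02 R.
have pi0 : 0 <= pi :> R := pi_ge0 R.
have tp : 0 <= t * pi by rewrite mulr_ge0.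
apply: le_trans (sin_ge_quad tp).
have h1 : t * pi <= 2^-1.
  have : t * pi <= 8^-1 * 4 by apply: ler_pM => //; lra.
  lra.
have h2 : t * 2 <= t * pi by rewrite ler_wpM2l.
have := ler_wpM2l tp h1; lra.
Qed.

(* The zeros of the free characteristic function are simple: it grows at least
   linearly away from them. *)
Lemma free_lower dn n t : (0 < n)%N -> 0 < t -> t <= 8^-1 ->
  t / n.+1%:R <= cmod (free dn (((freq dn n + t)%:C)%C ^+ 2)).
Proof.
move=> n0 t0 t1; have t0' := ltW t0; have nz := freq_neq0 dn n0 t0'.
rewrite freeE ?expf_neq0 // csq_freq // cmodM mulrC.
have h1 : t <= cmod (trig dn ((freq dn n + t)%:C)%C).
  rewrite /trig RCD addrAC freqC -RCn -RCD.
  rewrite -(@ler_pXn2r _ 2) ?nnegrE ?cmod_ge0 // sqr_cmod_csin /=.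
  apply: (@le_trans _ _ (sin ((n%:R + t) * pi) ^+ 2)); last by rewrite lerDl sqr_ge0.
  rewrite mulrDl addrC -[leRHS]real_normK ?num_real // sin_add_natpi.
  have ts := sin_pi_lower t0' t1.
  by rewrite real_normK ?num_real // lerXn2r ?nnegrE // (le_trans t0').
have h2 : n.+1%:R^-1 <= cmod (pref dn ((freq dn n + t)%:C)%C).
  rewrite /pref; case: dn nz {h1} => nz.
    by rewrite cmod1 invf_le1 ?ltr0n // ler1n.
  rewrite cmodV lef_pV2 ?posrE ?ltr0n ?cmod_gt0 // cmodRC.
  rewrite /freq /theta subr0 ger0_norm ?addr_ge0 // -addn1 natrD lerD2l; lra.
by apply: ler_pM; rewrite // invr_ge0.
Qed.

Lemma L1_zero : (\int[mu]_(s in `]0%R, pi[) (cmod ((fun=> 0 : C) s))%:E +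
   \int[mu]_(s in `]0%R, pi[) (cmod ((fun=> 0 : C) s))%:E <= 0%:E)%E.
Proof. by rewrite integral0_eq ?adde0 // => s _; rewrite cmod0. Qed.

(** The free functions solve the equation with zero coefficients, so they are covered by the general
    entireness result with [K = 0]. *)
Lemma entire_free dn : entire (free dn).
Proof.
have [h1 h2] := entire_solution (cmeas_cst _ 0) (cmeas_cst _ 0) L1_zero (@fsol_free R).
by case: dn.
Qed.

Definition zeros dn N : seq C := [seq ((freq dn j.+1)%:C)%C ^+ 2 | j <- iota 0 N].

Lemma size_zeros dn N : size (zeros dn N) = N.
Proof. by rewrite size_map size_iota. Qed.

Lemma zerosP dn N n : (0 < n)%N -> (n <= N)%N -> ((freq dn n)%:C)%C ^+ 2 \in zeros dn N.
Proof.
case: n => // n _ nN; apply/mapP; exists n => //.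
by rewrite mem_iota add0n.
Qed.

Lemma freq_sq_inj dn i j : (0 < i)%N -> (0 < j)%N ->
  ((freq dn i)%:C)%C ^+ 2 = ((freq dn j)%:C)%C ^+ 2 :> C -> i = j.
Proof.
move=> i0 j0 e; have := csq_freq dn i0 (lexx 0); have := csq_freq dn j0 (lexx 0).
rewrite !addr0 e => -> /RC_inj; rewrite /freq => /addIr /eqP.
by rewrite eqr_nat => /eqP.
Qed.

Lemma uniq_zeros dn N : uniq (zeros dn N).
Proof.
by rewrite map_inj_in_uniq ?iota_uniq // => i j _ _ /freq_sq_inj => /(_ isT isT) [].
Qed.

Lemma entire_factor (f : C -> C) (s : seq C) : entire f -> uniq s ->
  (forall a, a \in s -> f a = 0) ->
  exists h, entire h /\ forall z, f z = (rootprod s).[z] * h z.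
Proof.
elim: s f => [|a s IH] f ef us fs.
  by exists f; split => // z; rewrite /rootprod big_nil hornerC mul1r.
move: us => /= /andP[nas us].
have [g [eg fg]] := entire_div a ef.
have fg' z : f z = (z - a) * g z by rewrite -fg (fs a) ?mem_head // subr0.
have [|h [eh gh]] := IH g eg us.
  move=> b bs; have := fs b; rewrite inE bs orbT => /(_ isT); rewrite fg' => /eqP.
  rewrite mulf_eq0 subr_eq0 => /orP[/eqP e|/eqP //].
  by move: nas; rewrite -e bs.
exists h; split => // z.
by rewrite fg' gh /rootprod big_cons hornerM hornerXsubC mulrA.
Qed.

Lemma radius_freq dn N n : freq dn n <= radius dn N -> (n <= N)%N.
Proof.
rewrite /radius /freq => h; rewrite leqNgt; apply/negP => Nn.
have : N.+1%:R <= n%:R :> R by rewrite ler_nat.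
have : 0 < 2^-1 :> R by rewrite invr_gt0.
lra.
Qed.

Lemma radius_ge0 dn N : 0 <= radius dn N.
Proof. by rewrite /radius subr_ge0 freq_ge_half. Qed.

(** A zero of the cofactor in the disc would be a zero of [free], hence one of the listed squares,
    hence a double zero. Then [free] would be [O(t^2)] at distance of order [t], against the linear
    lower bound [free_lower]. *)
Lemma free_factor dn N : exists h, [/\ entire h,
  forall z, free dn z = (rootprod (zeros dn N)).[z] * h z &
  forall z, cmod z <= radius dn N ^+ 2 -> h z != 0].
Proof.
have [|h [eh fh]] := entire_factor (@entire_free dn) (uniq_zeros dn N).
  by move=> a /mapP[j _ ->]; exact: free_at_freq.
exists h; split => // z zr; apply/eqP => hz.
have fz : free dn z = 0 by rewrite fh hz mulr0.
have [n [n0 zE]] := free_zero fz.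
have fn0 : 0 <= freq dn n by apply: le_trans (freq_ge_half dn n0); rewrite invr_ge0.
have nN : (n <= N)%N.
  apply: (@radius_freq dn); rewrite -(@ler_pXn2r _ 2) ?nnegrE ?radius_ge0 //.
  by move: zr; rewrite zE cmodX cmodRC (ger0_norm fn0).
have [k [ek hk]] := entire_div z eh.
have : root (rootprod (zeros dn N)) z by rewrite root_prod_XsubC zE zerosP.
move=> /factor_theorem [p pE].
have fE w : free dn w = (w - z) ^+ 2 * (p.[w] * k w).
  have hw : h w = (w - z) * k w by rewrite -hk hz subr0.
  by rewrite fh pE hornerM hornerXsubC hw; ring.
have r0 : 0 <= (freq dn n + 1) ^+ 2 by rewrite sqr_ge0.
have [B [B0 hB]] := entire_bounded r0 ek.
set P := pnorm ((freq dn n + 1) ^+ 2) p.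
have P0 : 0 <= P by rewrite pnorm_ge0.
pose D := (2 * freq dn n + 1) ^+ 2 * (P * B).
have D0 : 0 <= D by rewrite mulr_ge0 ?sqr_ge0 // mulr_ge0.
(* Small enough for the lower bound to apply and for [t^2 D] to stay below [t / (n + 1)]. *)
pose t : R := Num.min (8^-1) ((2 * n.+1%:R * (D + 1))^-1).
have n10 : 0 < n.+1%:R :> R by rewrite ltr0n.
have D10 : 0 < D + 1 by rewrite ltr_wpDl.
have t0 : 0 < t by rewrite lt_min !invr_gt0 ltr0n /= !mulr_gt0.
have t1 : t <= 8^-1 by rewrite ge_min lexx.
have t2 : t <= (2 * n.+1%:R * (D + 1))^-1 by rewrite ge_min lexx orbT.
have e8 : 8^-1 <= 1 :> R by rewrite invf_le1 ?ltr0n // ler1n.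
have lo := free_lower dn n0 t0 t1.
move: lo; set w := _ ^+ 2; rewrite (fE w) => lo.
have wz : cmod (w - z) = t * (2 * freq dn n + t).
  have -> : w - z = ((t * (2 * freq dn n + t))%:C)%C.
    have -> : t * (2 * freq dn n + t) = (freq dn n + t) ^+ 2 - freq dn n ^+ 2 by ring.
    rewrite zE /w !expr2 [RHS]RCD [X in _ = _ + X]RCN.
    by congr (_ - _); symmetry; exact: RCM.
  by rewrite cmodRC ger0_norm // mulr_ge0 ?addr_ge0 ?mulr_ge0 // ltW.
have wr : cmod w <= (freq dn n + 1) ^+ 2.
  have ft : 0 <= freq dn n + t by rewrite addr_ge0 // ltW.
  rewrite /w cmodX cmodRC ger0_norm //.
  by apply: lerXn2r; rewrite ?nnegrE; lra.
have up : cmod ((w - z) ^+ 2 * (p.[w] * k w)) <= t ^+ 2 * D.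
  rewrite cmodM cmodX wz exprMn -mulrA ler_wpM2l ?sqr_ge0 // /D.
  apply: ler_pM; rewrite ?sqr_ge0 ?cmod_ge0 //.
    by apply: lerXn2r; rewrite ?nnegrE; lra.
  by rewrite cmodM; apply: ler_pM; rewrite ?cmod_ge0 ?(hB _ wr) ?(horner_pnorm _ wr).
have := le_trans lo up; rewrite ler_pdivrMr // expr2 => bad.
have : t * (t * D) * n.+1%:R <= t / 2.
  have : t * (2 * n.+1%:R * (D + 1)) <= 1.
    have := ler_wpM2r (ltW (mulr_gt0 (mulr_gt0 (ltr0Sn R 1) n10) D10)) t2.
    by rewrite mulVf // gt_eqF // !mulr_gt0.
  move=> /(ler_wpM2l (ltW t0)).
  have : 0 <= t * (t * n.+1%:R) by rewrite !mulr_ge0 // ltW.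
  lra.
lra.
Qed.

End FreeProblem.

(** * Localisation of the eigenvalues *)

Section Perturbed.
Variable R : realType.
Notation C := (Cplx R).
Notation mu := (@lebesgue_measure R).
Notation freq := (freq R).
Notation radius := (radius R).
Notation zeros := (zeros R).
Implicit Types (rho z w : C) (x t r : R) (dn : bool) (n k N : nat).
Variables (q M0 : R -> C) (K : R).
Hypothesis mq : cmeas `]0, pi[ q.
Hypothesis mM0 : cmeas `]0, pi[ M0.
Hypothesis hK : (\int[mu]_(s in `]0%R, pi[) (cmod (q s))%:E +
  \int[mu]_(s in `]0%R, pi[) (cmod (M0 s))%:E <= K%:E)%E.
Variables (Y dY : C -> R -> C).
Hypothesis hY : forall z, fsol q M0 z (fun=> 0) 1 (Y z) (dY z).

Definition charf dn z : C := if dn then dY z pi else Y z pi.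

Lemma entire_charf dn : entire (charf dn).
Proof. by have [h1 h2] := entire_solution mq mM0 hK hY; case: dn. Qed.

Let K0 : 0 <= K := K_ge0 hK.

(** For the trigonometric pair [r2 = z], so only [K] remains in the a priori estimate:
    [A = b / (1 - b K)] with [b = 1 / |rho|], and the error is [A K = kappa / (1 - kappa)], with one
    more factor [b] in the Dirichlet case, matching [pref]. *)
Lemma charf_pert dn rho : rho != 0 -> K / cmod rho < 1 ->
  cmod (charf dn (rho ^+ 2) - pref dn rho * trig dn rho) <=
  cmod (pref dn rho) * (expR (`|complex.Im rho| * pi) *
    (K / cmod rho / (1 - K / cmod rho))).
Proof.
move=> r0 kap1; have b0 : 0 <= (cmod rho)^-1 by rewrite invr_ge0 cmod_ge0.
have [|||||_] := fsol_apriori mq mM0 hK (hY (rho ^+ 2)) (kpair_trig r0) (V := 0) (w := `|complex.Im rho|).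
- exact: lexx.
- exact: normr_ge0.
- exact: b0.
- by move=> t _; rewrite cmod0 mul0r.
- by rewrite subrr cmod0 mul0r addr0 mulrC.
move=> /(_ pi); rewrite pi_ge0 lexx => /(_ isT) [_ hu hdu].
rewrite trig_pref // /charf /pref; move: hu hdu.
rewrite subrr cmod0 cmod1 !(mul0r, mul1r, addr0, mulr0) -!mulrA.
have -> : (cmod rho)^-1 * K = K * (cmod rho)^-1 by rewrite mulrC.
case: dn => hu hdu.
  by rewrite cmod1 mul1r; apply: le_trans hdu _; rewrite ler_wpM2l ?expR_ge0 // [leRHS]mulrCA ler_wpM2l // [leLHS]mulrC.
rewrite cmodV; apply: le_trans hu _; rewrite ler_wpM2l // ler_wpM2l ?expR_ge0 //.
by rewrite [leRHS]mulrCA ler_wpM2l // [leLHS]mulrC.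
Qed.

(** The radius is at least [(N + 1) / 2], so [kappa <= 1/100] on the circle and the error is at most
    1/99 of the exponential, while the free function keeps at least 1/16 of it; [16/99 < 1/3] is
    what Rouche's theorem asks for. The condition [N > 0] excludes the degenerate Dirichlet-Neumann
    circle. *)
Lemma charf_count dn N nu : (dn -> (0 < N)%N) -> K <= 200^-1 * N.+1%:R ->
  enumerates_zeros (charf dn) nu ->
  (forall k, (1 <= k)%N -> (k <= N)%N -> cmod (nu k) < radius dn N ^+ 2) /\
  (forall k, (N < k)%N -> radius dn N ^+ 2 < cmod (nu k)).
Proof.
move=> dnN hKN en.
have Ng : N.+1%:R / 2 <= radius dn N.
  rewrite /radius /freq /theta; have : N.+1%:R = N%:R + 1 :> R by rewrite -addn1 natrD.
  case: dn dnN {en} => [/(_ isT)|_]; last by have := ler0n R N; lra.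
  by rewrite -(ler1n R); lra.
have N1 : 1 <= N.+1%:R :> R by rewrite ler1n.
have rp : 0 < radius dn N by lra.
have [h [eh fh hnz]] := free_factor R dn N.
pose m := (if dn then 1 else (radius dn N)^-1) / 16.
have m0 : 0 < m by rewrite /m divr_gt0 ?ltr0n //; case: ifP => // _; rewrite invr_gt0.
have [|||||||||] := @enumerates_zeros_count R (radius dn N ^+ 2) m (charf dn) (free dn) h nu (zeros dn N).
- by rewrite exprn_gt0.
- exact: m0.
- exact: entire_charf.
- exact: en.
- exact: eh.
- exact: fh.
- move=> a /mapP[j]; rewrite mem_iota add0n => jN ->.
  rewrite cmodX cmodRC; have f0 := freq_ge_half R dn (ltn0Sn j).
  have : freq dn j.+1 < radius dn N.
    rewrite /radius (freqS R dn N); have : freq dn j.+1 <= freq dn N.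
      by rewrite /freq lerD2r ler_nat.
    lra.
  by move=> h1; rewrite ger0_norm; [apply: ltrXn2r; rewrite ?nnegrE|]; lra.
- exact: hnz.
- move=> z zr; pose rho := csq z.
  have zE : z = rho ^+ 2 by rewrite csqK.
  have nr : cmod rho = radius dn N.
    apply/eqP; rewrite -(@eqrXn2 _ 2) ?cmod_ge0 ?(ltW rp) //.
    by rewrite cmod_csq zr.
  have r0 : rho != 0 by rewrite -cmod_eq0 nr gt_eqF.
  have z0 : z != 0 by rewrite zE expf_neq0.
  have kap : K / cmod rho <= 100^-1.
    by rewrite nr ler_pdivrMr //; lra.
  have kap0 : 0 <= K / cmod rho by rewrite divr_ge0 ?cmod_ge0.
  have eta : K / cmod rho / (1 - K / cmod rho) <= 99^-1.
    by rewrite ler_pdivrMr; lra.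
  have e1 : 1 <= expR (`|complex.Im rho| * pi).
    apply: le_trans (expR_ge1Dx _); rewrite lerDl mulr_ge0 ?pi_ge0 //.
  (* A smaller value would, by [near_freq], bring [rho] within 0.06 of a free frequency, but the
     circle stays 1/2 away from all of them. *)
  have tl : 16^-1 * expR (`|complex.Im rho| * pi) <= cmod (trig dn rho).
    rewrite leNgt; apply/negP => /ltW tl.
    have [|||n [n0 hn]] := near_freq _ _ _ tl; rewrite ?Re_csq_ge0 // ?invr_ge0 //.
    have pi2 := pi_ge2 R.
    have h3 : 2 * cmod (rho - ((freq dn n)%:C)%C) <= pi * cmod (rho - ((freq dn n)%:C)%C).
      by rewrite ler_wpM2r ?cmod_ge0.
    have h1 := cmodB_ge rho ((freq dn n)%:C)%C.
    have h2 := cmodB_ge ((freq dn n)%:C)%C rho.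
    move: h1 h2; rewrite (cmodBC _ rho) nr cmodRC ger0_norm // => h1 h2.
    have [nN|Nn] := leqP n N.
      have : freq dn n <= freq dn N by rewrite /freq lerD2r ler_nat.
      by move: h1; rewrite /radius freqS; lra.
    have : freq dn N.+1 <= freq dn n by rewrite /freq lerD2r ler_nat.
    by move: h2; rewrite /radius; lra.
  have pr0 := cmod_ge0 (pref dn rho).
  have pm : cmod (pref dn rho) = m * 16.
    by rewrite /m mulfVK ?pnatr_eq0 // /pref; case: ifP => e; rewrite ?cmod1 // ?cmodV ?nr ?e.
  have fE : free dn z = pref dn rho * trig dn rho by rewrite freeE.
  have lo : cmod (pref dn rho) * (16^-1 * expR (`|complex.Im rho| * pi)) <= cmod (free dn z).
    by rewrite fE cmodM ler_wpM2l.
  split.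
    apply: le_trans lo; rewrite pm.
    have := ler_wpM2l (ltW m0) e1; lra.
  rewrite fE zE; apply: le_trans (charf_pert dn r0 _) _; first lra.
  have : cmod (pref dn rho) * (expR (`|complex.Im rho| * pi) * (K / cmod rho / (1 - K / cmod rho))) <=
     cmod (pref dn rho) * (expR (`|complex.Im rho| * pi) * 99^-1).
    by rewrite ler_wpM2l // ler_wpM2l // expR_ge0.
  have : 0 <= cmod (pref dn rho) * expR (`|complex.Im rho| * pi) by rewrite mulr_ge0 ?expR_ge0.
  by move: lo; rewrite fE; lra.
rewrite size_zeros => h1 h2; split; first exact: h1.
exact: h2.
Qed.

(** At a zero, the comparison bounds [trig] by [et = kappa / (1 - kappa)] times the exponential, and
    [kappa <= 1/17] is exactly [et <= 1/16]. Expanding [et (1 + 11 et)] in [kappa] gives a quadratic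
    coefficient below 14, rounded up to 16. *)
Lemma charf_localize dn rho : 0 <= complex.Re rho -> rho != 0 -> K / cmod rho <= 17^-1 ->
  charf dn (rho ^+ 2) = 0 ->
  exists n, 0 <= freq dn n /\ pi * cmod (rho - ((freq dn n)%:C)%C) <=
    K / cmod rho * (1 + 16 * (K / cmod rho)).
Proof.
move=> re0 r0 kap fz; have kap0 : 0 <= K / cmod rho by rewrite divr_ge0 ?cmod_ge0.
set ka := K / cmod rho in kap kap0 *.
pose et := ka / (1 - ka).
have d0 : 0 < 1 - ka by lra.
have et0 : 0 <= et by rewrite divr_ge0 // ltW.
have etE : et * (1 - ka) = ka by rewrite mulfVK // gt_eqF.
have et1 : et <= 16^-1 by rewrite ler_pdivrMr; lra.
have pp : 0 < cmod (pref dn rho).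
  by rewrite cmod_gt0 /pref; case: (dn); rewrite ?oner_eq0 ?invr_eq0.
have [|n [n0 hn]] := near_freq re0 et0 et1 (dn := dn).
  have := charf_pert dn r0 (_ : K / cmod rho < 1); rewrite fz sub0r cmodN cmodM => h.
  rewrite -(ler_pM2l pp) [_ * expR _]mulrC; apply: h.
  by rewrite -/ka; lra.
exists n; split => //; apply: le_trans hn _.
have h1 : et * ka <= et * 17^-1 by rewrite ler_wpM2l.
have h2 : et <= 17/16 * ka by lra.
have h3 : et * et <= et * 16^-1 by rewrite ler_wpM2l.
have h4 : et * ka <= 17/16 * ka * ka by rewrite ler_wpM2r.
have h5 : et * et <= (17/16 * ka) * (17/16 * ka) by rewrite ler_pM.
have := mulr_ge0 kap0 kap0; lra.
Qed.

(* The first Dirichlet-Neumann disc has radius 0, so for k = 1 a zero near 0 has to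
   be excluded separately. *)
Lemma DN_small_zero rho : K <= 200^-1 -> charf true (rho ^+ 2) = 0 -> 10^-1 <= cmod rho.
Proof.
move=> Ks fz; rewrite leNgt; apply/negP => rs.
have /andP[_ pi4] := pihalf_02 R; have pi0 := pi_gt0 R.
(* For small [rho] the bound [1 / |rho|] of the trigonometric pair is useless. The pair of [s'' = 0]
   with the trivial weight gives [|dY(pi) - 1| <= 0.225], so the derivative cannot vanish at
   [pi]. *)
have kp : kpair (0 : C) (fun x : R => (x%:C)%C) (fun=> 1) pi 0.
  by apply: kpair_free => // x /andP[_ h]; rewrite mul0r expR0 mulr1.
have z0 : 0 <= cmod (rho ^+ 2) by exact: cmod_ge0.
have z1 : cmod (rho ^+ 2) <= 100^-1.
  have -> : 100^-1 = 10^-1 ^+ 2 :> R by field.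
  by rewrite cmodX; apply: lerXn2r; rewrite ?nnegrE ?cmod_ge0 ?invr_ge0 // ltW.
have zp : cmod (rho ^+ 2) * pi <= 100^-1 * 4 by rewrite ler_pM // ?(ltW pi0) //; lra.
have zp0 : 0 <= cmod (rho ^+ 2) * pi by rewrite mulr_ge0 // ltW.
have bk : pi * (K + cmod (rho ^+ 2) * pi) <= 4 * (200^-1 + 100^-1 * 4).
  apply: ler_pM; [exact: ltW|exact: addr_ge0|lra|exact: lerD].
have [|||||A0] := fsol_apriori mq mM0 hK (hY (rho ^+ 2)) kp (V := 0).
- exact: lexx.
- exact: lexx.
- exact: ltW.
- by move=> t _; rewrite cmod0 mul0r.
- by rewrite sub0r cmodN; lra.
move=> /(_ pi); rewrite pi_ge0 lexx => /(_ isT) [_ _].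
move: fz; rewrite /charf => ->; rewrite mulr1 sub0r !cmodN cmod1.
rewrite sub0r cmodN in A0.
rewrite !(mul0r, mul1r, addr0, mulr0, expR0).
rewrite cmod1 mul1r mulr0 mul0r addr0 in A0; rewrite !sub0r !cmodN.
set A := pi / _ in A0 *.
have hA : A <= 5 by rewrite ler_pdivrMr; lra.
have : A * K <= 5 * 200^-1 by rewrite ler_pM.
have : cmod (rho ^+ 2) * A * pi <= (100^-1 * 4) * 5.
  by rewrite mulrAC ler_pM.
lra.
Qed.

Lemma charf_zero_bound dn nu k rho : (0 < k)%N -> enumerates_zeros (charf dn) nu ->
  0 <= complex.Re rho -> rho ^+ 2 = nu k ->
  cmod (rho - ((freq dn k)%:C)%C) * freq dn k <= K / pi + 1000 * 1000 * K ^+ 2.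
Proof.
move=> k0 en re0 rE.
have pi2 := pi_ge2 R; have pip := pi_gt0 R.
have a1 := freq_ge_half R dn k0; have th0 := theta_ge0 R dn; have th1 := theta_le R dn.
have k1 : 1 <= k%:R :> R by rewrite ler1n.
have ak : freq dn k <= k%:R by rewrite /freq; lra.
have fz : charf dn (rho ^+ 2) = 0 by rewrite rE; exact: enumerates_zeros_root en k0.
have rc : cmod (nu k) = cmod rho ^+ 2 by rewrite -rE cmodX.
have rr := cmod_ge0 rho.
have sq_lt (x y : R) : 0 <= x -> 0 <= y -> x ^+ 2 < y ^+ 2 -> x < y.
  by move=> x0 y0; rewrite ltr_pXn2r ?nnegrE.
have [Ks|Kl] := leP K (200^-1 * k%:R); last first.
  (* The smallest disc to which the counting applies for this [K]; it contains the k-th zero since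
     [k < 200 K] gives [k <= N]. As [K > 1/200], its radius is at most [200 K + 1/2 <= 300 K]. *)
  pose N := Num.trunc (200 * K).
  have /andP[N1 N2] : N%:R <= 200 * K < N.+1%:R by apply: truncn_itv; rewrite mulr_ge0.
  have kN : (k <= N)%N by rewrite -ltnS -(ltr_nat R); lra.
  have [|h _] := @charf_count dn N nu (fun _ => leq_trans k0 kN) _ en; first lra.
  have {}h : cmod rho < radius dn N.
    apply: sq_lt => //; first exact: (radius_ge0 R).
    by rewrite -rc; exact: h.
  have h1 : cmod rho <= 300 * K.
    by move: h; rewrite /radius freqS /freq; lra.
  have h2 : cmod (rho - ((freq dn k)%:C)%C) <= 500 * K.
    apply: le_trans (cmodB _ _) _; rewrite cmodRC ger0_norm; lra.
  have : cmod (rho - ((freq dn k)%:C)%C) * freq dn k <= (500 * K) * (200 * K).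
    by rewrite ler_pM ?cmod_ge0 //; lra.
  have : 0 <= K / pi by rewrite divr_ge0 // ltW.
  have := sqr_ge0 K; lra.
have up : cmod rho < radius dn k.
  apply: sq_lt => //; first exact: (radius_ge0 R).
  have [|h _] := @charf_count dn k nu (fun _ => k0) _ en.
    by have : k.+1%:R = k%:R + 1 :> R by [rewrite -addn1 natrD]; lra.
  by rewrite -rc; exact: h.
(* The circle with index [k - 1] bounds [rho] from below, and its radius is at least [k / 2] unless
   it degenerates. That happens for the first Dirichlet-Neumann zero, where [DN_small_zero] supplies
   1/10. *)
have lo : radius dn k.-1 <= cmod rho /\ 10^-1 * k%:R <= cmod rho.
  have radE : radius dn k.-1 = freq dn k - 2^-1 by rewrite /radius prednK.
  have [/andP[dt /eqP ke]|ndn] := boolP (dn && (k == 1)%N).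
    rewrite radE ke /freq dt /theta; split.
      by apply: le_trans rr; lra.
    rewrite mulr1; apply: DN_small_zero; first by move: Ks; rewrite ke mulr1.
    by move: fz; rewrite dt.
  have dk : dn -> (0 < k.-1)%N.
    by move=> dt; move: ndn; rewrite dt /=; case: (k) k0 => [|[|]].
  have h : radius dn k.-1 <= cmod rho.
    apply/ltW/sq_lt => //; first exact: (radius_ge0 R).
    rewrite -rc; apply: (charf_count dk _ en).2; last by rewrite prednK.
    by rewrite prednK.
  split => //; apply: le_trans h; rewrite radE /freq /theta.
  case: (dn) dk => [/(_ isT)|_]; last lra.
  have : k%:R = k.-1%:R + 1 :> R by rewrite -[in LHS](prednK k0) -addn1 natrD.
  by rewrite -(ler1n R); lra.
have [lo1 lo2] := lo.
have rp : 0 < cmod rho by lra.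
have kap : K / cmod rho <= 20^-1 by rewrite ler_pdivrMr //; lra.
have kap0 : 0 <= K / cmod rho by rewrite divr_ge0.
have [||n [n0 hn]] := charf_localize re0 _ _ fz; [by rewrite -cmod_gt0|lra|].
set d := cmod _ in hn; have d0 : 0 <= d by exact: cmod_ge0.
have pd : 2 * d <= pi * d by rewrite ler_wpM2r.
set ka := K / cmod rho in kap kap0 hn.
have kk : ka * ka <= ka * 20^-1 by rewrite ler_wpM2l.
have dk : d <= 9/10 * ka by lra.
(* [|rho|] lies within 1/2 of the k-th frequency and within [d <= 0.045] of the n-th, and distinct
   frequencies are at least 1 apart. *)
have nk : n = k.
  have h1 : cmod rho <= d + freq dn n.
    have := cmodD (rho - ((freq dn n)%:C)%C) ((freq dn n)%:C)%C.
    by rewrite subrK cmodRC (ger0_norm n0).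
  have h2 := cmodB_ge ((freq dn n)%:C)%C rho.
  rewrite cmodBC cmodRC (ger0_norm n0) -/d in h2.
  move: lo1 up; rewrite /radius prednK // freqS /freq => lo1 up.
  rewrite /freq in h1 h2.
  apply/eqP; rewrite eqn_leq -(ltnS n k) -(ltnS k n) -!(ltr_nat R).
  have e m : m.+1%:R = m%:R + 1 :> R by rewrite -addn1 natrD.
  by rewrite !e; apply/andP; split; lra.
subst n; rewrite -/d.
have ra : freq dn k - d <= cmod rho.
  by have := cmodB_ge ((freq dn k)%:C)%C rho; rewrite cmodBC cmodRC (ger0_norm n0) -/d; lra.
have KE : ka * cmod rho = K by rewrite mulfVK // gt_eqF.
(* [|rho|] is at least the frequency minus [d], hence at least 2/5; so [ka] is at most [5/2 K] and
   every product of two small factors is [O(K^2)]. *)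
have k2 : ka * (2/5) <= K by rewrite -KE ler_wpM2l //; lra.
have h6 : ka * freq dn k <= K + ka * d.
  by rewrite -KE -mulrDr ler_wpM2l //; lra.
have h7 : ka * d <= 9/10 * (ka * ka) by have := ler_wpM2l kap0 dk; lra.
have h8 : ka * ka <= 25/4 * K ^+ 2.
  have k20 : 0 <= ka * (2/5) by lra.
  have := ler_pM k20 k20 k2 k2; rewrite expr2; lra.
have h9 : ka * freq dn k * (1 + 16 * ka) <= (K + ka * d) * (1 + 16 * ka).
  by rewrite ler_wpM2r //; lra.
have h10 : K * ka <= 5/2 * K ^+ 2.
  by have := ler_wpM2l K0 k2; lra.
have h11 : ka * d * ka <= 9/10 * (ka * ka) * 20^-1.
  by rewrite ler_pM // mulr_ge0.
have h12 : pi * d * freq dn k <= ka * (1 + 16 * ka) * freq dn k.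
  by rewrite ler_wpM2r.
(* Beyond [K], the expansion of [(K + ka d) (1 + 16 ka)] contributes at most 40, 6 and 5 times
   [K^2], from [16 K ka], [ka d] and [16 ka^2 d]. *)
have h13 : pi * d * freq dn k <= K + 60 * K ^+ 2.
  have := sqr_ge0 K; lra.
have -> : K / pi + 1000 * 1000 * K ^+ 2 = (K + 1000 * 1000 * K ^+ 2 * pi) / pi.
  by rewrite [RHS]mulrDl mulfK // gt_eqF.
rewrite ler_pdivlMr // mulrC mulrA; apply: le_trans h13 _.
by have := ler_wpM2l (sqr_ge0 K) pi2; have := sqr_ge0 K; lra.
Qed.

End Perturbed.

(** * Constants *)

Section SquareIntegrable.
Variable R : realType.
Notation C := (Cplx R).
Notation mu := (@lebesgue_measure R).

Lemma L2_cmeas (f : R -> C) : in_L2 f -> cmeas `]0, pi[ f.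
Proof. by case. Qed.

(** Integral of [|f| <= e / 2 + |f|^2 / (2 e)]; optimizing over [e] yields the Cauchy-Schwarz
    inequality against the constant 1. *)
Lemma L1_AMGM (f : R -> C) (e : R) : in_L2 f -> 0 < e ->
  (\int[mu]_(s in `]0%R, pi[) (cmod (f s))%:E <=
   (e * pi / 2 + L2norm f ^+ 2 / (2 * e))%:E)%E.
Proof.
move=> fL e0; have [_ _ i2] := fL.
have pe : 0 < 2 * e by rewrite mulr_gt0.
have mD : @measurable _ (measurableTypeR R) `]0%R, pi[ by [].
have mc := cmeas_cmod (L2_cmeas fL).
have i1 : mu.-integrable `]0%R, pi[ (EFin \o (fun=> e / 2)).
  by apply: (@continuous_itv_integrable _ _ _ 0 pi) => //; [move=> x; exact: cst_continuous|exact: subset_itv_oo_cc].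
have le1 s : cmod (f s) <= e / 2 + (2 * e)^-1 * cmod (f s) ^+ 2.
  have -> : e / 2 + (2 * e)^-1 * cmod (f s) ^+ 2 = cmod (f s) + (cmod (f s) - e) ^+ 2 / (2 * e).
    by field; rewrite gt_eqF.
  by rewrite lerDl divr_ge0 ?sqr_ge0 // ltW.
apply: (@le_trans _ _ (\int[mu]_(s in `]0%R, pi[) ((e / 2)%:E + (2 * e)^-1%:E * (cmod (f s) ^+ 2)%:E))%E).
  apply: ge0_le_integral => //.
  - by move=> s _; rewrite lee_fin cmod_ge0.
  - exact/measurable_EFinP.
  - apply: emeasurable_funD; first exact: measurable_cst.
    by apply: measurable_funeM; apply/measurable_EFinP/measurable_funX.
  - by move=> s _; rewrite -EFinM -EFinD lee_fin.
rewrite integralD //=; last exact: integrableZl.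
rewrite integralZl // integral_cst //.
have muE : (mu `]0%R, pi[ = pi%:E)%E.
  by rewrite lebesgue_measure_itv /= lte_fin pi_gt0 -EFinB subr0.
rewrite [X in (_ * X + _ <= _)%E](_ : _ = pi%:E); last exact: muE.
have iE : (\int[mu]_(x in `]0%R, pi[) (cmod (f x) ^+ 2)%:E = (L2norm f ^+ 2)%:E)%E.
  rewrite /L2norm sqr_sqrtr; first by rewrite fineK // integrable_fin_num.
  by apply: Rintegral_ge0 => s _; exact: sqr_ge0.
rewrite [X in (_ + _ * X <= _)%E](_ : _ = (L2norm f ^+ 2)%:E); last exact: iE.
by rewrite -!EFinM -EFinD lee_fin mulrAC [X in _ + X]mulrC.
Qed.

(** The optimal parameter is [L2norm f / sqrt pi], which may be 0; a small [t'] is added to the norm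
    to keep it positive, and the excess is arbitrary. *)
Lemma L1_le_L2 (f : R -> C) : in_L2 f ->
  (\int[mu]_(s in `]0%R, pi[) (cmod (f s))%:E <= (Num.sqrt pi * L2norm f)%:E)%E.
Proof.
move=> fL; have sp : 0 < Num.sqrt pi :> R by rewrite sqrtr_gt0 pi_gt0.
have sp2 : Num.sqrt pi * Num.sqrt pi = pi :> R by rewrite -expr2 sqr_sqrtr ?pi_ge0.
have N0 : 0 <= L2norm f by exact: sqrtr_ge0.
apply/lee_addgt0Pr => t t0; rewrite -EFinD.
pose t' := t / Num.sqrt pi; have t'0 : 0 < t' by rewrite divr_gt0.
have tE : t = Num.sqrt pi * t' by rewrite mulrC divfK // gt_eqF.
pose M := L2norm f + t'; have Mp : 0 < M by rewrite ltr_wpDl.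
have ep : 0 < M / Num.sqrt pi by rewrite divr_gt0.
apply: le_trans (L1_AMGM fL ep) _; rewrite lee_fin.
have -> : M / Num.sqrt pi * pi / 2 = Num.sqrt pi * M / 2.
  by rewrite -[X in _ * X / _]sp2 mulrA divfK ?gt_eqF // [M * _]mulrC.
have h : L2norm f ^+ 2 <= M ^+ 2.
  by rewrite lerXn2r ?nnegrE ?(ltW Mp) // lerDl ltW.
have -> : L2norm f ^+ 2 / (2 * (M / Num.sqrt pi)) = Num.sqrt pi * (L2norm f ^+ 2 / M) / 2.
  by field; rewrite !gt_eqF.
have h2 : L2norm f ^+ 2 / M <= M by rewrite ler_pdivrMr // -expr2.
have := ler_wpM2l (ltW sp) h2; rewrite {1}tE -mulrDr -/M; lra.
Qed.

Lemma L1_pair_le (q M0 : R -> C) : in_L2 q -> in_L2 M0 ->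
  (\int[mu]_(s in `]0%R, pi[) (cmod (q s))%:E +
   \int[mu]_(s in `]0%R, pi[) (cmod (M0 s))%:E <= (Num.sqrt pi * pair_norm q M0)%:E)%E.
Proof.
move=> qL ML; apply: le_trans (leeD (L1_le_L2 qL) (L1_le_L2 ML)) _.
rewrite -EFinD lee_fin -mulrDr ler_wpM2l ?sqrtr_ge0 // lerD2l.
by rewrite ler_peMl ?sqrtr_ge0 // ler1n.
Qed.

Lemma principal_sqrt_Re (z rho : C) : principal_sqrt z rho -> 0 <= complex.Re rho.
Proof.
move=> [_ [th [/andP[th1 th2] ->]]] /=; rewrite mulr_ge0 ?cmod_ge0 //.
by rewrite cos_ge0_pihalf // (ltW th1).
Qed.

(** The solutions are reparametrized by [z = rho^2] through [sqrtC]. With [K = sqrt pi * ||f||] the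
    two terms of [charf_zero_bound] become [||f|| / sqrt pi] and a multiple of [pi ||f||^2]. *)
Lemma eigenvalue_bound (dn : bool) (q M0 : R -> C) (S dS : C -> R -> C)
  (nu rho : nat -> C) (k : nat) :
  (0 < k)%N -> in_L2 q -> in_L2 M0 ->
  (forall r, sine_solution q M0 r (S r) (dS r)) ->
  enumerates_zeros (charf (fun z => S (sqrtC z)) (fun z => dS (sqrtC z)) dn) nu ->
  (forall j, (1 <= j)%N -> principal_sqrt (nu j) (rho j)) ->
  cmod (rho k - ((freq R dn k)%:C)%C) * freq R dn k <=
    ((Num.sqrt pi)^-1 + 1000 * 1000 * pi * pair_norm q M0) * pair_norm q M0.
Proof.
move=> k0 qL ML hS en hr.
have [r2 _] := hr k k0; have re := principal_sqrt_Re (hr k k0).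
have hY z : fsol q M0 z (fun=> 0) 1 (S (sqrtC z)) (dS (sqrtC z)).
  by have := sine_solution_fsol (hS (sqrtC z)); rewrite sqrtCK.
apply: le_trans (charf_zero_bound (L2_cmeas qL) (L2_cmeas ML) (L1_pair_le qL ML) hY k0 en re r2) _.
have sp : 0 < Num.sqrt pi :> R by rewrite sqrtr_gt0 pi_gt0.
have sp2 : Num.sqrt pi ^+ 2 = pi :> R by rewrite sqr_sqrtr ?pi_ge0.
rewrite (exprMn 2 (Num.sqrt pi)) sp2.
have -> : Num.sqrt pi * pair_norm q M0 / pi = (Num.sqrt pi)^-1 * pair_norm q M0.
  by rewrite -[X in _ / X]sp2; field; rewrite gt_eqF.
by rewrite [leRHS]mulrDl expr2 !mulrA.
Qed.

(** Let [s = 1 / sqrt pi]. If [c F <= c1 - s], then [c1] suffices. Otherwise [c r > c1 - s], so [s]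
    is at most [s / (c1 - s)] times [c r] and the whole sum is a multiple of [r]. The resulting [c2]
    blows up as [c1] approaches [s]. *)
Lemma max_absorb (c1 : R) : (Num.sqrt pi)^-1 < c1 -> exists c2, 0 < c2 /\
  forall F r : R, 0 <= F -> F <= r ->
    (Num.sqrt pi)^-1 + 1000 * 1000 * pi * F <= Num.max (c2 * r) c1.
Proof.
move=> hc; have sp : 0 < (Num.sqrt pi)^-1 :> R by rewrite invr_gt0 sqrtr_gt0 pi_gt0.
set s := (Num.sqrt pi)^-1 in hc sp *; set c := 1000 * 1000 * pi.
have c0 : 0 < c by rewrite !mulr_gt0 ?pi_gt0 ?ltr0n.
have d0 : 0 < c1 - s by rewrite subr_gt0.
exists (c * (1 + s / (c1 - s))); split.
  by rewrite mulr_gt0 // addr_gt0 // divr_gt0.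
move=> F r F0 Fr; rewrite le_max; apply/orP.
have cF : c * F <= c * r by rewrite ler_wpM2l // ltW.
have [h|h] := leP (c * F) (c1 - s); [right; lra|left].
have := ler_wpM2r (ltW (divr_gt0 sp d0)) (le_trans (ltW h) cF).
by rewrite mulrC divfK ?gt_eqF //; lra.
Qed.

End SquareIntegrable.

Theorem mainTheorem4 (R : realType) :
  (exists c1 c2 : R, 0 < c1 /\ 0 < c2 /\
     forall (k : nat) (r : R) (q M0 : R -> Cplx R) (mu rho' : nat -> Cplx R),
       (1 <= k)%N -> 0 < r ->
       in_L2 q -> in_L2 M0 -> pair_norm q M0 <= r ->
       Dirichlet_Neumann_eigenvalues q M0 mu ->
       (forall j : nat, (1 <= j)%N -> principal_sqrt (mu j) (rho' j)) ->
       cmod (rho' k - k%:R + 2^-1)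
         <= Num.max (c2 * r) c1 * pair_norm q M0 * (k%:R - 2^-1)^-1)
  /\
  (forall c1 : R, (Num.sqrt pi)^-1 < c1 ->
   exists c2 : R, 0 < c2 /\
     forall (k : nat) (r : R) (q M0 : R -> Cplx R),
       (1 <= k)%N -> 0 < r ->
       in_L2 q -> in_L2 M0 -> pair_norm q M0 <= r ->
       (forall mu rho' : nat -> Cplx R,
          Dirichlet_Neumann_eigenvalues q M0 mu ->
          (forall j : nat, (1 <= j)%N -> principal_sqrt (mu j) (rho' j)) ->
          cmod (rho' k - k%:R + 2^-1)
            <= Num.max (c2 * r) c1 * pair_norm q M0 * (k%:R - 2^-1)^-1)
       /\
       (forall lambda rho : nat -> Cplx R,
          Dirichlet_eigenvalues q M0 lambda ->
          (forall j : nat, (1 <= j)%N -> principal_sqrt (lambda j) (rho j)) ->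
          cmod (rho k - k%:R)
            <= Num.max (c2 * r) c1 * pair_norm q M0 * k%:R^-1)).
Proof.
have part2 (c1 : R) : (Num.sqrt pi)^-1 < c1 -> exists c2 : R, 0 < c2 /\
    forall (dn : bool) (k : nat) (r : R) (q M0 : R -> Cplx R) S dS (nu rho : nat -> Cplx R),
    (1 <= k)%N -> in_L2 q -> in_L2 M0 -> pair_norm q M0 <= r ->
    (forall r, sine_solution q M0 r (S r) (dS r)) ->
    enumerates_zeros (charf (fun z => S (sqrtC z)) (fun z => dS (sqrtC z)) dn) nu ->
    (forall j : nat, (1 <= j)%N -> principal_sqrt (nu j) (rho j)) ->
    cmod (rho k - ((freq R dn k)%:C)%C) <=
      Num.max (c2 * r) c1 * pair_norm q M0 * (freq R dn k)^-1.
  move=> hc; have [c2 [c20 h]] := max_absorb hc; exists c2; split => //.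
  move=> dn k r q M0 S dS nu rho k1 qL ML Fr hS en hr.
  have F0 : 0 <= pair_norm q M0 by rewrite addr_ge0 ?mulr_ge0 ?sqrtr_ge0.
  have a0 : 0 < freq R dn k by apply: lt_le_trans (freq_ge_half R dn k1); rewrite invr_gt0.
  rewrite ler_pdivlMr //; apply: le_trans (eigenvalue_bound k1 qL ML hS en hr) _.
  by rewrite ler_wpM2r // h.
split.
  have hc : (Num.sqrt pi)^-1 < (Num.sqrt pi)^-1 + 1 :> R by rewrite ltrDl.
  have [c2 [c20 h]] := part2 _ hc; exists ((Num.sqrt pi)^-1 + 1), c2.
  split; first by rewrite ltr_wpDl // invr_ge0 sqrtr_ge0.
  split=> // k r q M0 nu rho k1 _ qL ML Fr [S [dS [hS en]]] hr.
  have := h true k r q M0 S dS nu rho k1 qL ML Fr hS en hr.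
  by rewrite /freq /theta RCD RCN RCV !RCn opprB addrA addrAC.
move=> c1 hc; have [c2 [c20 h]] := part2 _ hc; exists c2; split => //.
move=> k r q M0 k1 _ qL ML Fr; split.
  move=> nu rho [S [dS [hS en]]] hr.
  have := h true k r q M0 S dS nu rho k1 qL ML Fr hS en hr.
  by rewrite /freq /theta RCD RCN RCV !RCn opprB addrA addrAC.
move=> nu rho [S [dS [hS en]]] hr.
have := h false k r q M0 S dS nu rho k1 qL ML Fr hS en hr.
by rewrite /freq /theta subr0 RCn.
Qed.
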